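(* Let $f\not\equiv 0$ be an odd entire function $\mathbb{C}\to\mathbb{C}$ such that for all $x,y,z,w\in\mathbb{C}$ $$f(x)f(y)f(z)f(w)-f\Big(\tfrac{x+y+z-w}{2}\Big)f\Big(\tfrac{x+y-z+w}{2}\Big)f\Big(\tfrac{x-y+z+w}{2}\Big)f\Big(\tfrac{-x+y+z+w}{2}\Big)$$ $$-f\Big(\tfrac{x+y+z+w}{2}\Big)f\Big(\tfrac{x+y-z-w}{2}\Big)f\Big(\tfrac{x-y+z-w}{2}\Big)f\Big(\tfrac{x-y-z+w}{2}\Big)=0.$$ Then there exist $\alpha,\beta\in\mathbb{C}$ such that one of the following holds: (1) $f(z)=z\,e^{\alpha z^2+\beta}$ for all $z$; (2) $f(z)=\sin(az)\,e^{\alpha z^2+\beta}$ for all $z$, for some $a\in\mathbb{C}$, $a\neq 0$; (3) $f(z)=\sigma(z,\Lambda)\,e^{\alpha z^2+\beta}$ for all $z$, for some lattice $\Lambda\subset\mathbb{C}$.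
   Context: A lattice $\Lambda\subset\mathbb{C}$ is a subgroup of the form $\omega_1\mathbb{Z}+\omega_2\mathbb{Z}$ with $\omega_1,\omega_2$ linearly independent over $\mathbb{R}$. Writing $\Lambda'=\Lambda\setminus\{0\}$, the Weierstrass sigma function is $$\sigma(z,\Lambda)=z\prod_{\lambda\in\Lambda'}\Big(1-\frac{z}{\lambda}\Big)\exp\Big(\frac{z}{\lambda}+\frac12\Big(\frac{z}{\lambda}\Big)^2\Big).$$ *)

(* Defs.v *)
From Stdlib Require Import Reals ZArith List.
From Coquelicot Require Import Coquelicot.
Open Scope R_scope.

Definition cexp (z : C) : C :=
  (exp (fst z) * cos (snd z), exp (fst z) * sin (snd z)).

Definition csin (z : C) : C :=
  Cdiv (Cminus (cexp (Cmult Ci z)) (cexp (Copp (Cmult Ci z)))) (Cmult (RtoC 2) Ci).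

Definition entire (f : C -> C) : Prop :=
  forall z : C, @ex_derive C_AbsRing C_NormedModule f z.

Definition R_lin_indep (w1 w2 : C) : Prop :=
  forall a b : R, Cplus (Cmult (RtoC a) w1) (Cmult (RtoC b) w2) = RtoC 0 ->
    a = 0 /\ b = 0.

Definition lat_pt (w1 w2 : C) (m n : Z) : C :=
  Cplus (Cmult (RtoC (IZR m)) w1) (Cmult (RtoC (IZR n)) w2).

Definition wfactor (z l : C) : C :=
  let u := Cdiv z l in
  Cmult (Cminus (RtoC 1) u) (cexp (Cplus u (Cmult (RtoC (/2)) (Cmult u u)))).

Definition zrange (N : nat) : list Z :=
  map (fun i => (Z.of_nat i - Z.of_nat N)%Z) (seq 0 (2 * N + 1)).

Definition sigma_partial (w1 w2 : C) (z : C) (N : nat) : C :=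
  fold_right Cmult (RtoC 1)
    (map (fun mn => wfactor z (lat_pt w1 w2 (fst mn) (snd mn)))
       (filter (fun mn => negb (Z.eqb (fst mn) 0 && Z.eqb (snd mn) 0))
          (list_prod (zrange N) (zrange N)))).

(* s is the Weierstrass sigma function of the lattice w1 Z + w2 Z:
   for every z, s z = z * prod_{l in Lambda'} (1 - z/l) exp(z/l + (z/l)^2/2),
   the (absolutely convergent) product being the limit of the partial
   products over the exhausting boxes |m|, |n| <= N. *)
Definition is_weierstrass_sigma (w1 w2 : C) (s : C -> C) : Prop :=
  forall z : C,
    filterlim (fun N => Cmult z (sigma_partial w1 w2 z N)) eventually
      (locally (s z)).

(* Main.v *)
Require Import Defs.
From Stdlib Require Import Reals ZArith List Permutation Lra Lia Psatz Classical ClassicalEpsilon.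
From Coquelicot Require Import Coquelicot.

(** Putting [x, y, z, w = a + b, a - b, c, c] gives Weierstrass' three-term equation. At a zero [w]
    of [f] it reads [f (a + w) f (a - w) = k f(a)^2] with [k <> 0], so the zeros of [f] are simple
    and form a discrete subgroup of [C], which is trivial, cyclic or a lattice. Take [s z = z], a sine
    or the Weierstrass sigma function accordingly: then [E = f / s] is an even zero-free entire
    function. If the subgroup is trivial or cyclic, the three-term equation bounds the order of [f],
    hence of [E], by two. If it is a lattice, [E (z + w) E (z - w) / E(z)^2] is constant for the two
    generators [w], so [log |E|] has constant second differences along the lattice and grows at
    most cubically. By Borel-Caratheodory [log E] is a cubic polynomial, and it is even. *)

(** * Continuity and complex differentiability *)

(** All three cases end in one lemma about even zero-free functions with |E| <= exp(K (1 + |z|)^3).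
    The exponent 3 is generous on purpose: [log E] becomes a polynomial of degree at most 3 and
    evenness strikes out its odd part, so quadratic and cubic growth lead to the same result and
    constants never have to be sharp. The obstacle is the lattice case, where a direct growth
    comparison of [f] with sigma would require lower bounds for sigma off its zeros. Instead [f] is
    divided by the partial products over square boxes. Up to constants and exponentials of quadratic
    polynomials these are polynomials with zeros at the box points; moving a box by one generator
    only trades its boundary rows, and the trade, compared at two points [z] and [z0], tends to 1.
    The remaining constants depend on the box alone and cancel in the comparison. Sigma appears
    last, as [f] divided by the limit of the quotients, so the convergence of its product follows
    from that of the quotients. *)

(* The map [e] is the identity when the domain is [C] and [RtoC] when it is [R]; [der] is
   Caratheodory's form of differentiability. *)
Definition cont {X : Type} (e : X -> C) (f : X -> C) (x : X) : Prop :=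
  forall eps : R, 0 < eps -> exists delta : R, 0 < delta /\
    forall y : X, Cmod (e y - e x) < delta -> Cmod (f y - f x) < eps.

Definition der {X : Type} (e : X -> C) (f : X -> C) (x : X) (l : C) : Prop :=
  exists phi : X -> C, cont e phi x /\ phi x = l /\
    forall y : X, f y = (f x + phi y * (e y - e x))%C.

Notation contC := (cont (fun z : C => z)).
Notation contR := (cont RtoC).
Notation derC := (der (fun z : C => z)).
Notation derR := (der RtoC).

Lemma Cmod_minus_sym (a b : C) : Cmod (a - b) = Cmod (b - a).
Proof. rewrite <- Cmod_opp. f_equal. ring. Qed.

Lemma Cmod_triangle3 (a b c : C) : Cmod (a - c) <= Cmod (a - b) + Cmod (b - c).
Proof. replace (a - c)%C with ((a - b) + (b - c))%C by ring. apply Cmod_triangle. Qed.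

Lemma Cmod_ge_sub (a b : C) : Cmod a - Cmod b <= Cmod (a - b).
Proof.
  pose proof (Cmod_triangle (a - b) b) as H.
  replace (a - b + b)%C with a in H by ring. lra.
Qed.

Lemma Cmod_le_add (a b : C) : Cmod (a - b) <= Cmod a + Cmod b.
Proof. rewrite <- (Cmod_opp b). apply Cmod_triangle. Qed.

Lemma Cmod_zero (a : C) : a = 0 -> Cmod a = 0.
Proof. intros ->. apply Cmod_0. Qed.

Lemma Cminus_neq0 (a b : C) : a <> b -> (a - b <> 0)%C.
Proof.
  intros H H0. apply H. replace a with (a - b + b)%C by ring. rewrite H0. ring.
Qed.

Lemma Cminus_eq0 (a b : C) : (a - b = 0)%C -> a = b.
Proof. intros H. replace a with (a - b + b)%C by ring. rewrite H. ring. Qed.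

Lemma Cmult_integral (a b : C) : (a * b = 0)%C -> a = 0%C \/ b = 0%C.
Proof.
  intros H. destruct (classic (a = 0%C)) as [Ha|Ha]; [now left|right].
  apply Cmod_eq_0. apply (f_equal Cmod) in H. rewrite Cmod_mult, Cmod_0 in H.
  apply Cmod_gt_0 in Ha. nra.
Qed.

Lemma RtoC_neq0 (r : R) : r <> 0 -> RtoC r <> 0%C.
Proof. intros H E. apply H. now apply RtoC_inj. Qed.

Lemma Cmod_RtoC_pos (r : R) : 0 <= r -> Cmod r = r.
Proof. intros. rewrite Cmod_R. now apply Rabs_pos_eq. Qed.

Section Continuity.
Context {X : Type} (e : X -> C).

Lemma cont_ext (f g : X -> C) x : (forall y, f y = g y) -> cont e f x -> cont e g x.
Proof.
  intros E H eps He. destruct (H eps He) as [d [Hd H']]. exists d. split; [easy|].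
  intros y Hy. rewrite <- !E. auto.
Qed.

Lemma cont_const (c : C) x : cont e (fun _ => c) x.
Proof.
  intros eps He. exists 1. split; [lra|]. intros y _.
  rewrite Cmod_zero by ring. easy.
Qed.

Lemma cont_emb x : cont e e x.
Proof. intros eps He. exists eps. auto. Qed.

Lemma cont_bounded (f : X -> C) x : cont e f x ->
  exists d M, 0 < d /\ 0 < M /\ forall y, Cmod (e y - e x) < d -> Cmod (f y) <= M.
Proof.
  intros H. destruct (H 1 ltac:(lra)) as [d [Hd H']].
  exists d, (Cmod (f x) + 1). pose proof (Cmod_ge_0 (f x)).
  repeat split; try lra. intros y Hy. specialize (H' y Hy).
  pose proof (Cmod_ge_sub (f y) (f x)). lra.
Qed.

Lemma cont_plus (f g : X -> C) x :
  cont e f x -> cont e g x -> cont e (fun y => (f y + g y)%C) x.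
Proof.
  intros Hf Hg eps He.
  destruct (Hf (eps / 2) ltac:(lra)) as [d1 [H1 H1']].
  destruct (Hg (eps / 2) ltac:(lra)) as [d2 [H2 H2']].
  exists (Rmin d1 d2). split; [now apply Rmin_pos|]. intros y Hy.
  specialize (H1' y (Rlt_le_trans _ _ _ Hy (Rmin_l _ _))).
  specialize (H2' y (Rlt_le_trans _ _ _ Hy (Rmin_r _ _))).
  replace (f y + g y - (f x + g x))%C with ((f y - f x) + (g y - g x))%C by ring.
  pose proof (Cmod_triangle (f y - f x) (g y - g x)). lra.
Qed.

Lemma cont_mult (f g : X -> C) x :
  cont e f x -> cont e g x -> cont e (fun y => (f y * g y)%C) x.
Proof.
  intros Hf Hg eps He.
  destruct (cont_bounded g x Hg) as [d0 [M [H0 [HM H0']]]].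
  pose proof (Cmod_ge_0 (f x)) as Hfx.
  assert (He1 : 0 < eps / (2 * M)) by (apply Rdiv_lt_0_compat; lra).
  assert (He2 : 0 < eps / (2 * (Cmod (f x) + 1))) by (apply Rdiv_lt_0_compat; lra).
  destruct (Hf _ He1) as [d1 [H1 H1']].
  destruct (Hg _ He2) as [d2 [H2 H2']].
  exists (Rmin d0 (Rmin d1 d2)). split; [repeat apply Rmin_pos; easy|]. intros y Hy.
  assert (Hy0 := Rlt_le_trans _ _ _ Hy (Rmin_l _ _)).
  assert (Hy' := Rlt_le_trans _ _ _ Hy (Rmin_r _ _)).
  specialize (H0' y Hy0).
  specialize (H1' y (Rlt_le_trans _ _ _ Hy' (Rmin_l _ _))).
  specialize (H2' y (Rlt_le_trans _ _ _ Hy' (Rmin_r _ _))).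
  replace (f y * g y - f x * g x)%C with ((f y - f x) * g y + f x * (g y - g x))%C by ring.
  eapply Rle_lt_trans; [apply Cmod_triangle|]. rewrite !Cmod_mult.
  assert (A : Cmod (f y - f x) * Cmod (g y) <= eps / (2 * M) * M).
  { apply Rmult_le_compat; try apply Cmod_ge_0; lra. }
  assert (B : Cmod (f x) * Cmod (g y - g x)
              <= Cmod (f x) * (eps / (2 * (Cmod (f x) + 1)))).
  { apply Rmult_le_compat_l; lra. }
  replace (eps / (2 * M) * M) with (eps / 2) in A by (field; lra).
  assert (Cmod (f x) * (eps / (2 * (Cmod (f x) + 1))) < eps / 2); [|lra].
  replace (Cmod (f x) * (eps / (2 * (Cmod (f x) + 1))))
    with (eps / 2 - eps / (2 * (Cmod (f x) + 1))) by (field; lra). lra.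
Qed.

Lemma cont_opp (f : X -> C) x : cont e f x -> cont e (fun y => (- f y)%C) x.
Proof.
  intros H. eapply cont_ext; [|apply (cont_mult (fun _ => (-(1))%C) f x (cont_const _ _) H)].
  intros y. simpl. ring.
Qed.

Lemma cont_minus (f g : X -> C) x :
  cont e f x -> cont e g x -> cont e (fun y => (f y - g y)%C) x.
Proof. intros Hf Hg. exact (cont_plus f _ x Hf (cont_opp g x Hg)). Qed.

Lemma cont_away0 (f : X -> C) x : cont e f x -> f x <> 0%C ->
  exists d, 0 < d /\ forall y, Cmod (e y - e x) < d -> Cmod (f x) / 2 <= Cmod (f y).
Proof.
  intros H H0. apply Cmod_gt_0 in H0. destruct (H (Cmod (f x) / 2) ltac:(lra)) as [d [Hd H']].
  exists d. split; [easy|]. intros y Hy. specialize (H' y Hy).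
  pose proof (Cmod_ge_sub (f x) (f y)). rewrite Cmod_minus_sym in H'. lra.
Qed.

Lemma cont_inv (f : X -> C) x : cont e f x -> f x <> 0%C -> cont e (fun y => (/ f y)%C) x.
Proof.
  intros H H0 eps He.
  destruct (cont_away0 f x H H0) as [d0 [Hd0 H0']].
  assert (Hm := H0). apply Cmod_gt_0 in Hm.
  assert (He1 : 0 < eps * (Cmod (f x) * Cmod (f x) / 2)).
  { apply Rmult_lt_0_compat; nra. }
  destruct (H _ He1) as [d1 [Hd1 H1]].
  exists (Rmin d0 d1). split; [now apply Rmin_pos|]. intros y Hy.
  specialize (H0' y (Rlt_le_trans _ _ _ Hy (Rmin_l _ _))).
  specialize (H1 y (Rlt_le_trans _ _ _ Hy (Rmin_r _ _))).
  assert (Hy0 : f y <> 0%C) by (apply Cmod_gt_0; lra).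
  replace (/ f y - / f x)%C with (- (f y - f x) / (f y * f x))%C by (field; auto).
  rewrite Cmod_div, Cmod_opp, Cmod_mult by (intros E; apply Cmult_integral in E; tauto).
  apply Rlt_div_l; [nra|]. eapply Rlt_le_trans; [exact H1|].
  apply Rmult_le_compat_l; nra.
Qed.

Lemma cont_comp (g : C -> C) (f : X -> C) x :
  contC g (f x) -> cont e f x -> cont e (fun y => g (f y)) x.
Proof.
  intros Hg Hf eps He. destruct (Hg eps He) as [d [Hd Hg']].
  destruct (Hf d Hd) as [d' [Hd' Hf']]. exists d'. auto.
Qed.

Lemma cont_pow (f : X -> C) n x : cont e f x -> cont e (fun y => (f y ^ n)%C) x.
Proof.
  intros H. induction n as [|n IH]; simpl; [apply cont_const|].
  now apply cont_mult.
Qed.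

Lemma der_cont (f : X -> C) x l : der e f x l -> cont e f x.
Proof.
  intros [phi [H1 [H2 H3]]]. eapply cont_ext; [intros y; symmetry; apply H3|].
  apply cont_plus; [apply cont_const|]. apply cont_mult; [easy|].
  apply cont_minus; [apply cont_emb|apply cont_const].
Qed.

Lemma der_ext (f g : X -> C) x l : (forall y, f y = g y) -> der e f x l -> der e g x l.
Proof.
  intros E [phi [H1 [H2 H3]]]. exists phi. repeat split; auto.
  intros y. rewrite <- !E. auto.
Qed.

Lemma der_eq (f : X -> C) x l l' : der e f x l -> l = l' -> der e f x l'.
Proof. now intros H <-. Qed.

Lemma der_const (c : C) x : der e (fun _ => c) x 0%C.
Proof. exists (fun _ => 0%C). split; [apply cont_const|split; [easy|]]. intros; ring. Qed.

Lemma der_emb x : der e e x 1%C.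
Proof. exists (fun _ => 1%C). split; [apply cont_const|split; [easy|]]. intros; ring. Qed.

Lemma der_plus (f g : X -> C) x l m :
  der e f x l -> der e g x m -> der e (fun y => (f y + g y)%C) x (l + m)%C.
Proof.
  intros [p [P1 [P2 P3]]] [q [Q1 [Q2 Q3]]]. exists (fun y => (p y + q y)%C).
  split; [now apply cont_plus|]. split; [congruence|].
  intros y. rewrite (P3 y), (Q3 y). ring.
Qed.

Lemma der_mult (f g : X -> C) x l m :
  der e f x l -> der e g x m -> der e (fun y => (f y * g y)%C) x (l * g x + f x * m)%C.
Proof.
  intros [p [P1 [P2 P3]]] Hg. assert (Cg := der_cont _ _ _ Hg).
  destruct Hg as [q [Q1 [Q2 Q3]]]. exists (fun y => (p y * g y + f x * q y)%C).
  split; [apply cont_plus; apply cont_mult; auto; apply cont_const|]. split; [congruence|].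
  intros y. rewrite (P3 y), (Q3 y). ring.
Qed.

Lemma der_scal (c : C) (f : X -> C) x l : der e f x l -> der e (fun y => (c * f y)%C) x (c * l)%C.
Proof.
  intros H. eapply der_eq; [apply der_mult; [apply der_const|exact H]|]. simpl. ring.
Qed.

Lemma der_opp (f : X -> C) x l : der e f x l -> der e (fun y => (- f y)%C) x (- l)%C.
Proof.
  intros H. eapply der_ext; [|eapply der_eq; [apply (der_scal (-(1))%C _ _ _ H)|ring]].
  intros; simpl; ring.
Qed.

Lemma der_minus (f g : X -> C) x l m :
  der e f x l -> der e g x m -> der e (fun y => (f y - g y)%C) x (l - m)%C.
Proof. intros Hf Hg. exact (der_plus _ _ _ _ _ Hf (der_opp _ _ _ Hg)). Qed.

Lemma der_comp (g f : _ -> C) (x : X) l m :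
  derC g (f x) l -> der e f x m -> der e (fun y => g (f y)) x (l * m)%C.
Proof.
  intros [p [P1 [P2 P3]]] Hf. assert (Cf := der_cont _ _ _ Hf).
  destruct Hf as [q [Q1 [Q2 Q3]]]. exists (fun y => (p (f y) * q y)%C).
  split; [apply cont_mult; [now apply cont_comp|easy]|]. split; [congruence|].
  intros y. rewrite (P3 (f y)). rewrite (Q3 y) at 2. ring.
Qed.

End Continuity.

Create HintDb cts.
#[export] Hint Resolve cont_const cont_emb : cts.

Ltac cts := intros; first
  [ solve [auto with cts]
  | apply cont_minus; cts | apply cont_plus; cts | apply cont_opp; cts
  | apply cont_mult; cts | apply cont_pow; cts | apply cont_inv; [cts|auto]
  | match goal with |- cont _ (fun t => ?F (@?g t)) _ => apply (cont_comp _ F g); cts end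
  | idtac ].

Lemma derC_of_eps (f : C -> C) (z l : C) :
  (forall eps, 0 < eps -> exists d, 0 < d /\ forall y, Cmod (y - z) < d ->
     Cmod (f y - f z - l * (y - z)) <= eps * Cmod (y - z)) -> derC f z l.
Proof.
  intros H.
  (* The slope function is the difference quotient, completed by the value [l] at [y = z]. *)
  exists (fun y => if excluded_middle_informative (y = z) then l else ((f y - f z) / (y - z))%C).
  split; [|split].
  - intros eps He. destruct (H (eps / 2) ltac:(lra)) as [d [Hd0 Hd]].
    exists d. split; [easy|]. intros y Hy.
    destruct (excluded_middle_informative (z = z)); [|easy].
    destruct (excluded_middle_informative (y = z)) as [->|Hyz].
    + rewrite Cmod_zero by ring. easy.
    + specialize (Hd y Hy).
      assert (Hn : (y - z <> 0)%C) by now apply Cminus_neq0.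
      replace ((f y - f z) / (y - z) - l)%C with ((f y - f z - l * (y - z)) / (y - z))%C
        by (field; easy).
      rewrite Cmod_div by easy. apply Cmod_gt_0 in Hn.
      apply Rle_lt_trans with (eps / 2); [|lra].
      apply Rle_div_l; easy.
  - destruct (excluded_middle_informative (z = z)); easy.
  - intros y. destruct (excluded_middle_informative (y = z)) as [->|Hyz]; [ring|].
    field. now apply Cminus_neq0.
Qed.

Lemma derC_eps (f : C -> C) (z l : C) : derC f z l ->
  forall eps, 0 < eps -> exists d, 0 < d /\ forall y, Cmod (y - z) < d ->
     Cmod (f y - f z - l * (y - z)) <= eps * Cmod (y - z).
Proof.
  intros [p [P1 [P2 P3]]] eps He. destruct (P1 eps He) as [d [Hd H]].
  exists d. split; [easy|]. intros y Hy. rewrite (P3 y), <- P2.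
  replace (f z + p y * (y - z) - f z - p z * (y - z))%C with ((p y - p z) * (y - z))%C by ring.
  rewrite Cmod_mult. apply Rmult_le_compat_r; [apply Cmod_ge_0|]. now apply Rlt_le, H.
Qed.

Lemma derC_local (f g : C -> C) (x l : C) d : 0 < d ->
  (forall y, Cmod (y - x) < d -> f y = g y) -> derC f x l -> derC g x l.
Proof.
  intros Hd E H. apply derC_of_eps. intros eps He.
  destruct (derC_eps f x l H eps He) as [d1 [Hd1 K]].
  exists (Rmin d d1). split; [now apply Rmin_pos|]. intros y Hy.
  rewrite <- !E; [|rewrite Cmod_zero by ring; easy|exact (Rlt_le_trans _ _ _ Hy (Rmin_l _ _))].
  apply K. exact (Rlt_le_trans _ _ _ Hy (Rmin_r _ _)).
Qed.

Lemma derC_inv_id (x : C) : x <> 0%C -> derC (fun z => (/ z)%C) x (- / (x * x))%C.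
Proof.
  intros H. apply derC_of_eps. intros eps He. assert (Hm := H). apply Cmod_gt_0 in Hm.
  destruct (cont_inv (fun z : C => z) (fun z => z) x (cont_emb _ x) H (eps * Cmod x)) as [d [Hd K]]; [nra|].
  exists (Rmin d (Cmod x)). split; [now apply Rmin_pos|]. intros y Hy.
  specialize (K y (Rlt_le_trans _ _ _ Hy (Rmin_l _ _))).
  assert (Hyx := Rlt_le_trans _ _ _ Hy (Rmin_r _ _)).
  assert (Hy0 : y <> 0%C).
  { intros ->. rewrite Cmod_minus_sym in Hyx. replace (x - 0)%C with x in Hyx by ring. lra. }
  replace (/ y - / x - - / (x * x) * (y - x))%C with (- (/ y - / x) / x * (y - x))%C by (field; auto).
  rewrite Cmod_mult, Cmod_div, Cmod_opp by easy.
  apply Rmult_le_compat_r; [apply Cmod_ge_0|]. apply Rle_div_l; lra.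
Qed.

Lemma der_inv {X} (e : X -> C) (f : X -> C) x l : der e f x l -> f x <> 0%C ->
  der e (fun y => (/ f y)%C) x (- l / (f x * f x))%C.
Proof.
  intros H H0. eapply der_eq; [apply der_comp with (g := fun z => (/ z)%C);
   [now apply derC_inv_id|exact H]|]. field. auto.
Qed.

Lemma derC_unique (f : C -> C) (x l m : C) : derC f x l -> derC f x m -> l = m.
Proof.
  intros Hl Hm. apply NNPP. intros Hn. apply Cminus_neq0, Cmod_gt_0 in Hn.
  set (e := Cmod (l - m) / 4).
  destruct (derC_eps f x l Hl e ltac:(unfold e; lra)) as [d1 [Hd1 K1]].
  destruct (derC_eps f x m Hm e ltac:(unfold e; lra)) as [d2 [Hd2 K2]].
  set (d := Rmin d1 d2 / 2). assert (Hd : 0 < Rmin d1 d2) by now apply Rmin_pos.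
  pose proof (Rmin_l d1 d2). pose proof (Rmin_r d1 d2).
  assert (Ey : Cmod (x + RtoC d - x) = d).
  { replace (x + d - x)%C with (RtoC d) by ring. apply Cmod_RtoC_pos. unfold d. lra. }
  specialize (K1 (x + RtoC d)%C ltac:(rewrite Ey; unfold d; lra)).
  specialize (K2 (x + RtoC d)%C ltac:(rewrite Ey; unfold d; lra)).
  pose proof (Cmod_le_add (f (x + d) - f x - m * (x + d - x))%C (f (x + d) - f x - l * (x + d - x))%C) as T.
  replace (f (x + d) - f x - m * (x + d - x) - (f (x + d) - f x - l * (x + d - x)))%C
    with ((l - m) * (x + d - x))%C in T by ring.
  rewrite Cmod_mult, Ey in *. unfold e in *. assert (0 < d) by (unfold d; lra). nra.
Qed.

Lemma is_derive_derC (f : C -> C) (z l : C) :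
  @is_derive C_AbsRing C_NormedModule f z l -> derC f z l.
Proof.
  intros [_ H]. specialize (H z (fun P HP => HP)). apply derC_of_eps. intros eps He.
  destruct (H (mkposreal _ He)) as [d Hd]. exists d. split; [apply cond_pos|]. intros y Hy.
  specialize (Hd y Hy).
  change (Cmod (f y - f z - (y - z) * l) <= eps * Cmod (y - z)) in Hd.
  now rewrite (Cmult_comm l).
Qed.

Definition holo (f : C -> C) : Prop := forall z, exists l, derC f z l.

(** The derivative as a total operator, by choice: where [f] is not differentiable the value is
    arbitrary, so it is handled through [Dc_spec] and [Dc_unique]. *)
Definition Dc (f : C -> C) (z : C) : C := @epsilon C (inhabits (RtoC 0)) (derC f z).

Lemma Dc_spec f : holo f -> forall z, derC f z (Dc f z).
Proof. intros H z. apply (@epsilon_spec C (inhabits (RtoC 0)) (derC f z)). apply H. Qed.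

Lemma Dc_unique f z l : derC f z l -> Dc f z = l.
Proof.
  intros H. apply derC_unique with f z; [|easy].
  apply (@epsilon_spec C (inhabits (RtoC 0)) (derC f z)). eauto.
Qed.

Lemma entire_holo f : entire f -> holo f.
Proof. intros H z. destruct (H z) as [l Hl]. exists l. now apply is_derive_derC. Qed.

Lemma holo_cont f : holo f -> forall z, contC f z.
Proof. intros H z. destruct (H z) as [l Hl]. now apply der_cont with l. Qed.

(** * Integrals of complex-valued functions of a real variable *)

(** The constant sqrt 2 is rounded up to 2. This is the origin of the factor 2 in [CI_bound],
    [Seg_bound] and [telescoping_cauchy], which all argue on real and imaginary parts. *)
Lemma Cmod_le_2max (z : C) M : Rabs (fst z) <= M -> Rabs (snd z) <= M -> Cmod z <= 2 * M.
Proof.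
  intros H1 H2. pose proof (Cmod_2Rmax z) as H.
  assert (0 <= M) by (pose proof (Rabs_pos (fst z)); lra).
  assert (Rmax (Rabs (fst z)) (Rabs (snd z)) <= M) by (now apply Rmax_lub).
  assert (S : 0 <= sqrt 2 <= 2).
  { split; [apply sqrt_pos|]. rewrite <- (sqrt_square 2) at 2 by lra. apply sqrt_le_1; lra. }
  assert (0 <= Rmax (Rabs (fst z)) (Rabs (snd z))).
  { eapply Rle_trans; [apply Rabs_pos|apply Rmax_l]. }
  nra.
Qed.

Lemma fst_le_Cmod (z : C) : Rabs (fst z) <= Cmod z.
Proof. eapply Rle_trans; [apply Rmax_l|apply Rmax_Cmod]. Qed.

Lemma snd_le_Cmod (z : C) : Rabs (snd z) <= Cmod z.
Proof. eapply Rle_trans; [apply Rmax_r|apply Rmax_Cmod]. Qed.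

Definition CI (F : R -> C) (a b : R) : C :=
  (RInt (fun t => fst (F t)) a b, RInt (fun t => snd (F t)) a b).

Lemma contR_components (F : R -> C) t : contR F t ->
  continuous (fun u => fst (F u)) t /\ continuous (fun u => snd (F u)) t.
Proof.
  intros H. split; apply filterlim_locally; intros eps;
  destruct (H eps (cond_pos eps)) as [d [Hd H']]; exists (mkposreal d Hd); intros y Hy;
  change (Rabs (y - t) < d) in Hy;
  (assert (K : Cmod (F y - F t) < eps)
    by (apply H'; rewrite <- RtoC_minus, Cmod_R; exact Hy)).
  - change (Rabs (fst (F y) - fst (F t)) < eps).
    eapply Rle_lt_trans; [|exact K]. apply (fst_le_Cmod (F y - F t)%C).
  - change (Rabs (snd (F y) - snd (F t)) < eps).
    eapply Rle_lt_trans; [|exact K]. apply (snd_le_Cmod (F y - F t)%C).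
Qed.

Lemma contR_of_continuous (f : R -> R) t : continuous f t -> contR (fun u => RtoC (f u)) t.
Proof.
  intros H eps He. apply (proj1 (filterlim_locally _ _)) with (eps := mkposreal eps He) in H.
  destruct H as [d Hd]. exists d. split; [apply cond_pos|]. intros y Hy.
  rewrite <- RtoC_minus, Cmod_R in *. apply (Hd y Hy).
Qed.

Lemma ex_RInt_fst F a b : (forall t, contR F t) -> ex_RInt (fun t => fst (F t)) a b.
Proof. intros H. apply (@ex_RInt_continuous R_CompleteNormedModule). intros z _. apply (contR_components F z (H z)). Qed.

Lemma ex_RInt_snd F a b : (forall t, contR F t) -> ex_RInt (fun t => snd (F t)) a b.
Proof. intros H. apply (@ex_RInt_continuous R_CompleteNormedModule). intros z _. apply (contR_components F z (H z)). Qed.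

Lemma CI_ext F G a b : (forall t, F t = G t) -> CI F a b = CI G a b.
Proof.
  intros H. unfold CI. f_equal; apply RInt_ext; intros; now rewrite H.
Qed.

Lemma CI_plus F G a b : (forall t, contR F t) -> (forall t, contR G t) ->
  CI (fun t => (F t + G t)%C) a b = (CI F a b + CI G a b)%C.
Proof.
  intros HF HG. unfold CI, Cplus. simpl. f_equal.
  - apply (@RInt_plus R_CompleteNormedModule); apply ex_RInt_fst; auto.
  - apply (@RInt_plus R_CompleteNormedModule); apply ex_RInt_snd; auto.
Qed.

Lemma CI_scal c F a b : (forall t, contR F t) ->
  CI (fun t => (c * F t)%C) a b = (c * CI F a b)%C.
Proof.
  intros HF. unfold CI, Cmult. simpl.
  assert (E1 := fun l => @RInt_scal R_CompleteNormedModule (fun t => fst (F t)) a b l (ex_RInt_fst F a b HF)).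
  assert (E2 := fun l => @RInt_scal R_CompleteNormedModule (fun t => snd (F t)) a b l (ex_RInt_snd F a b HF)).
  assert (X1 : forall l, ex_RInt (fun t => l * fst (F t)) a b).
  { intros l. apply (@ex_RInt_scal R_NormedModule). now apply ex_RInt_fst. }
  assert (X2 : forall l, ex_RInt (fun t => l * snd (F t)) a b).
  { intros l. apply (@ex_RInt_scal R_NormedModule). now apply ex_RInt_snd. }
  f_equal.
  - rewrite (@RInt_minus R_CompleteNormedModule (fun t => fst c * fst (F t)) (fun t => snd c * snd (F t))) by auto.
    change (@minus _ ?x ?y) with (x - y). f_equal; [apply E1|apply E2].
  - rewrite (@RInt_plus R_CompleteNormedModule (fun t => fst c * snd (F t)) (fun t => snd c * fst (F t))) by auto.
    change (@plus _ ?x ?y) with (x + y). f_equal; [apply E2|apply E1].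
Qed.

Lemma CI_minus F G a b : (forall t, contR F t) -> (forall t, contR G t) ->
  CI (fun t => (F t - G t)%C) a b = (CI F a b - CI G a b)%C.
Proof.
  intros HF HG.
  rewrite (CI_ext _ (fun t => (F t + (-(1)) * G t)%C)) by (intros; ring).
  rewrite CI_plus, CI_scal; auto; [ring|].
  cts.
Qed.

Lemma CI_bound F a b M : a <= b -> (forall t, contR F t) ->
  (forall t, a <= t <= b -> Cmod (F t) <= M) -> Cmod (CI F a b) <= 2 * ((b - a) * M).
Proof.
  intros Hab HF HM. apply Cmod_le_2max; simpl.
  - apply abs_RInt_le_const; [easy|now apply ex_RInt_fst|].
    intros t Ht. eapply Rle_trans; [apply fst_le_Cmod|auto].
  - apply abs_RInt_le_const; [easy|now apply ex_RInt_snd|].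
    intros t Ht. eapply Rle_trans; [apply snd_le_Cmod|auto].
Qed.

Lemma CI_const c a b : CI (fun _ => c) a b = ((b - a)%R * c)%C.
Proof.
  unfold CI. rewrite !RInt_const. unfold scal; simpl. unfold mult; simpl.
  unfold Cmult; simpl. f_equal; ring.
Qed.

Lemma derR_components (P : R -> C) t l : derR P t l ->
  is_derive (fun u => fst (P u)) t (fst l) /\ is_derive (fun u => snd (P u)) t (snd l).
Proof.
  intros [phi [H1 [H2 H3]]].
  assert (K : forall eps, 0 < eps -> locally t (fun y =>
    Cmod (P y - P t - l * RtoC (y - t)) <= eps * Rabs (y - t))).
  { intros eps He. destruct (H1 eps He) as [d [Hd H]]. exists (mkposreal d Hd). intros y Hy.
    change (Rabs (y - t) < d) in Hy.
    rewrite (H3 y), <- H2.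
    replace (P t + phi y * (y - t) - P t - phi t * (y - t)%R)%C
      with ((phi y - phi t) * RtoC (y - t))%C by (rewrite RtoC_minus; ring).
    rewrite Cmod_mult, Cmod_R. apply Rmult_le_compat_r; [apply Rabs_pos|].
    apply Rlt_le, H. rewrite <- RtoC_minus, Cmod_R. exact Hy. }
  split; (split; [apply is_linear_scal_l|]); intros x Hx;
    rewrite <- (is_filter_lim_locally_unique _ _ Hx); clear x Hx; intros eps;
    destruct (K eps (cond_pos eps)) as [d Hd]; exists d; intros y Hy;
    specialize (Hd y Hy); (eapply Rle_trans; [|exact Hd]).
  - eapply Rle_trans; [|apply fst_le_Cmod]. right.
    unfold norm, minus, plus, opp, scal, mult; simpl. unfold abs; simpl. unfold mult; simpl. f_equal. ring.
  - eapply Rle_trans; [|apply snd_le_Cmod]. right.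
    unfold norm, minus, plus, opp, scal, mult; simpl. unfold abs; simpl. unfold mult; simpl. f_equal. ring.
Qed.

Lemma CI_FTC P p a b : (forall t, derR P t (p t)) -> (forall t, contR p t) ->
  CI p a b = (P b - P a)%C.
Proof.
  intros HP Hp. unfold CI. apply injective_projections; simpl.
  - apply is_RInt_unique.
    apply (is_RInt_derive (V := R_CompleteNormedModule) (fun t => fst (P t)) (fun t => fst (p t))).
    + intros x _. apply (derR_components P x (p x) (HP x)).
    + intros x _. apply (contR_components p x (Hp x)).
  - apply is_RInt_unique.
    apply (is_RInt_derive (V := R_CompleteNormedModule) (fun t => snd (P t)) (fun t => snd (p t))).
    + intros x _. apply (derR_components P x (p x) (HP x)).
    + intros x _. apply (contR_components p x (Hp x)).
Qed.

Lemma CI_Chasles F a b c : (forall t, contR F t) -> (CI F a b + CI F b c)%C = CI F a c.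
Proof.
  intros HF. unfold CI, Cplus. simpl. f_equal.
  - apply (@RInt_Chasles R_CompleteNormedModule); apply ex_RInt_fst; auto.
  - apply (@RInt_Chasles R_CompleteNormedModule); apply ex_RInt_snd; auto.
Qed.

(** Affine substitution; [u = 1/2] bisects a segment and [u = -1] reverses it. *)
Lemma CI_comp_lin F u v a b : (forall t, contR F t) ->
  (RtoC u * CI (fun t => F (u * t + v)%R) a b)%C = CI F (u * a + v) (u * b + v).
Proof.
  intros HF.
  assert (HG : forall t, contR (fun t => F (u * t + v)%R) t).
  { intros t eps He. destruct (HF (u * t + v) eps He) as [d [Hd H]].
    assert (Hu : 0 < Rabs u + 1) by (pose proof (Rabs_pos u); lra).
    exists (d / (Rabs u + 1)). split; [now apply Rdiv_lt_0_compat|]. intros y Hy. apply H.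
    rewrite <- RtoC_minus, Cmod_R in *.
    replace (u * y + v - (u * t + v)) with (u * (y - t)) by ring. rewrite Rabs_mult.
    apply Rlt_div_r in Hy; [|easy]. pose proof (Rabs_pos (y - t)). pose proof (Rabs_pos u). nra. }
  rewrite <- CI_scal by easy.
  unfold CI, Cmult. apply injective_projections; cbn [fst snd].
  - rewrite <- (@RInt_comp_lin R_CompleteNormedModule (fun t => fst (F t)) u v a b) by (now apply ex_RInt_fst).
    apply RInt_ext. intros. unfold scal; simpl. unfold mult; simpl. ring.
  - rewrite <- (@RInt_comp_lin R_CompleteNormedModule (fun t => snd (F t)) u v a b) by (now apply ex_RInt_snd).
    apply RInt_ext. intros. unfold scal; simpl. unfold mult; simpl. ring.
Qed.

(** The disc lies in the square [-B, B]^2, where [uniform_continuity_2d] applies to each real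
    component of [f]; [eps / 4] absorbs the factor 2 of [Cmod_le_2max]. *)
Lemma unif_cont_disc (f : C -> C) (B : R) : (forall z, contC f z) -> forall eps, 0 < eps ->
  exists d, 0 < d /\ forall x y, Cmod x <= B -> Cmod y <= B -> Cmod (y - x) < d ->
    Cmod (f y - f x) < eps.
Proof.
  intros Hf eps He.
  assert (He4 : 0 < eps / 4) by lra.
  assert (A : forall p : C -> R, (forall z, Rabs (p z) <= Cmod z) ->
    (forall z w, p (z - w)%C = p z - p w) -> forall x y,
    continuity_2d_pt (fun u v => p (f (u, v))) x y).
  { intros p Hp Hp' x y e. destruct (Hf (x, y) e (cond_pos e)) as [d [Hd H]].
    assert (Hd2 : 0 < d / 4) by lra. exists (mkposreal _ Hd2). simpl. intros u v Hu Hv.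
    rewrite <- Hp'. eapply Rle_lt_trans; [apply Hp|]. apply H.
    apply Rle_lt_trans with (2 * (d / 4)); [|lra].
    apply Cmod_le_2max; simpl; unfold Rminus in *; apply Rlt_le; assumption. }
  assert (U : forall p : C -> R, (forall z, Rabs (p z) <= Cmod z) ->
    (forall z w, p (z - w)%C = p z - p w) ->
    exists d, 0 < d /\ forall x y, Cmod x <= B -> Cmod y <= B -> Cmod (y - x) < d ->
    Rabs (p (f y) - p (f x)) < eps / 4).
  { intros p Hp Hp'.
    destruct (uniform_continuity_2d (fun u v => p (f (u, v))) (-B) B (-B) B
      (fun x y _ _ => A p Hp Hp' x y) (mkposreal _ He4)) as [d Hd].
    exists d. split; [apply cond_pos|]. intros [x1 x2] [y1 y2] Hx Hy Hxy.
    pose proof (fst_le_Cmod (x1,x2)). pose proof (snd_le_Cmod (x1,x2)).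
    pose proof (fst_le_Cmod (y1,y2)). pose proof (snd_le_Cmod (y1,y2)).
    pose proof (fst_le_Cmod ((y1,y2) - (x1,x2))%C).
    pose proof (snd_le_Cmod ((y1,y2) - (x1,x2))%C). simpl in *.
    apply Hd; try (apply Rabs_le_between; lra); try (unfold Rminus; lra). }
  destruct (U fst fst_le_Cmod (fun z w => eq_refl)) as [d1 [Hd1 H1]].
  destruct (U snd snd_le_Cmod (fun z w => eq_refl)) as [d2 [Hd2 H2]].
  exists (Rmin d1 d2). split; [now apply Rmin_pos|]. intros x y Hx Hy Hxy.
  specialize (H1 x y Hx Hy (Rlt_le_trans _ _ _ Hxy (Rmin_l _ _))).
  specialize (H2 x y Hx Hy (Rlt_le_trans _ _ _ Hxy (Rmin_r _ _))).
  apply Rle_lt_trans with (2 * (eps / 4)); [|lra].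
  apply Cmod_le_2max; simpl; unfold Rminus in *; lra.
Qed.

(** Walk from the origin to [z] along the ray in steps of length at most [d / 2], with [d] a modulus
    of uniform continuity for 1. Each step raises the bound by 1, and the number of steps depends on
    [B] only. *)
Lemma bounded_disc (f : C -> C) (B : R) : (forall z, contC f z) ->
  exists M, 0 < M /\ forall z, Cmod z <= B -> Cmod (f z) <= M.
Proof.
  intros Hf. destruct (unif_cont_disc f B Hf 1 ltac:(lra)) as [d [Hd H]].
  assert (K : forall n, exists M, 0 < M /\ forall z, Cmod z <= B -> Cmod z <= INR n * (d / 2) -> Cmod (f z) <= M).
  { induction n as [|n [M [HM IH]]].
    - exists (Cmod (f 0%C) + 1). pose proof (Cmod_ge_0 (f 0%C)). split; [lra|]. intros z _ Hz.
      replace z with (RtoC 0); [lra|]. symmetry. apply Cmod_eq_0. simpl in Hz. pose proof (Cmod_ge_0 z). lra.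
    - exists (M + 1). split; [lra|]. intros z Hz Hn. rewrite S_INR in Hn.
      pose proof (pos_INR n) as n0. pose proof (Cmod_ge_0 z) as z0.
      set (r := INR n / (INR n + 1)).
      assert (Er : r * (INR n + 1) = INR n) by (unfold r; field; lra).
      assert (Hr : 0 <= r <= 1) by (split; [apply Rdiv_le_0_compat; lra|apply Rle_div_l; lra]).
      assert (Hz' : Cmod (RtoC r * z) = r * Cmod z) by (rewrite Cmod_mult, Cmod_RtoC_pos; lra).
      assert (Q1 : Cmod (f (RtoC r * z)%C) <= M) by (apply IH; rewrite Hz'; nra).
      assert (Q2 : Cmod (f z - f (RtoC r * z)%C) < 1).
      { apply H; [rewrite Hz'; nra|easy|].
        replace (z - r * z)%C with (RtoC (1 - r) * z)%C by (rewrite RtoC_minus; ring).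
        rewrite Cmod_mult, Cmod_RtoC_pos by lra.
        apply Rle_lt_trans with (d / 2); [|lra].
        apply Rle_trans with ((1 - r) * ((INR n + 1) * (d / 2))); [apply Rmult_le_compat_l; lra|nra]. }
      pose proof (Cmod_ge_sub (f z) (f (RtoC r * z)%C)). lra. }
  destruct (INR_unbounded (B / (d / 2))) as [n Hn]. destruct (K n) as [M [HM HK]].
  exists M. split; [easy|]. intros z Hz. apply HK; [easy|]. apply Rlt_div_l in Hn; lra.
Qed.

(** * Goursat and Morera *)

Definition Seg (f : C -> C) (a b : C) : C :=
  ((b - a) * CI (fun t => f (a + RtoC t * (b - a))%C) 0 1)%C.

Lemma contR_fseg f (a b : C) : (forall z, contC f z) ->
  forall t, contR (fun t => f (a + RtoC t * (b - a))%C) t.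
Proof. cts. Qed.

Lemma Seg_FTC F f a b : (forall z, derC F z (f z)) -> (forall z, contC f z) ->
  Seg f a b = (F b - F a)%C.
Proof.
  intros HF Hf. unfold Seg. rewrite <- CI_scal by now apply contR_fseg.
  rewrite (CI_FTC (fun t => F (a + RtoC t * (b - a))%C)).
  - f_equal; f_equal; [ring|f_equal; ring].
  - intros t. eapply der_eq.
    + apply der_comp with (g := F); [apply HF|].
      apply der_plus; [apply der_const|]. apply der_mult; [apply der_emb|apply der_const].
    + cbv beta. ring.
  - cts.
Qed.

Lemma Seg_minus f g a b : (forall z, contC f z) -> (forall z, contC g z) ->
  Seg (fun z => (f z - g z)%C) a b = (Seg f a b - Seg g a b)%C.
Proof.
  intros Hf Hg. unfold Seg. rewrite CI_minus by now apply contR_fseg. ring.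
Qed.

Lemma Seg_bound f a b M : (forall z, contC f z) ->
  (forall t, 0 <= t <= 1 -> Cmod (f (a + RtoC t * (b - a))%C) <= M) ->
  Cmod (Seg f a b) <= 2 * M * Cmod (b - a).
Proof.
  intros Hf HM. unfold Seg. rewrite Cmod_mult.
  pose proof (CI_bound (fun t => f (a + RtoC t * (b - a))%C) 0 1 M ltac:(lra)
    (contR_fseg f a b Hf) HM). pose proof (Cmod_ge_0 (b - a)). nra.
Qed.

Lemma Seg_split f a b : (forall z, contC f z) ->
  Seg f a b = (Seg f a ((a + b) / 2) + Seg f ((a + b) / 2) b)%C.
Proof.
  intros Hf. unfold Seg.
  assert (HF := contR_fseg f a b Hf).
  assert (E1 := CI_comp_lin _ (/2) 0 0 1 HF).
  assert (E2 := CI_comp_lin _ (/2) (/2) 0 1 HF).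
  replace (/2 * 0 + 0) with 0 in E1 by lra. replace (/2 * 1 + 0) with (/2) in E1 by lra.
  replace (/2 * 0 + /2) with (/2) in E2 by lra. replace (/2 * 1 + /2) with 1 in E2 by lra.
  rewrite <- (CI_Chasles _ 0 (/2) 1 HF), <- E1, <- E2.
  rewrite (CI_ext (fun t => f (a + RtoC t * ((a + b) / 2 - a))%C)
    (fun t => f (a + RtoC (/ 2 * t + 0) * (b - a))%C) 0 1).
  2:{ intros t. f_equal. rewrite RtoC_plus, RtoC_mult, RtoC_inv by lra. field. }
  rewrite (CI_ext (fun t => f ((a + b) / 2 + RtoC t * (b - (a + b) / 2))%C)
    (fun t => f (a + RtoC (/ 2 * t + / 2) * (b - a))%C) 0 1).
  2:{ intros t. f_equal. rewrite RtoC_plus, RtoC_mult, RtoC_inv by lra. field. }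
  rewrite RtoC_inv by lra. field.
Qed.

Lemma Seg_rev f a b : (forall z, contC f z) -> Seg f b a = (- Seg f a b)%C.
Proof.
  intros Hf. unfold Seg.
  assert (HF := contR_fseg f a b Hf).
  assert (E1 := CI_comp_lin _ (-1) 1 0 1 HF).
  replace (-1 * 0 + 1) with 1 in E1 by lra. replace (-1 * 1 + 1) with 0 in E1 by lra.
  pose proof (CI_Chasles _ 0 1 0 HF) as E2.
  assert (E3 : CI (fun t => f (a + t * (b - a))%C) 0 0 = RtoC 0).
  { unfold CI. now rewrite !RInt_point. }
  rewrite E3, <- E1 in E2.
  replace (CI (fun t => f (a + t * (b - a))%C) 0 1)
    with (RtoC (-(-1)) * CI (fun t => f (a + (-1 * t + 1)%R * (b - a))%C) 0 1)%C.
  - rewrite (CI_ext (fun t => f (b + t * (a - b))%C) (fun t => f (a + (-1 * t + 1)%R * (b - a))%C) 0 1).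
    + replace (- (-1)) with 1 by lra. ring.
    + intros t. f_equal. rewrite RtoC_plus, RtoC_mult. ring.
  - replace (- (-1)) with 1 by lra. replace (-1) with (- (1)) in * by lra.
    symmetry. apply Cminus_eq0. rewrite <- E2, RtoC_opp. ring.
Qed.

(** The quantity on the left is the integral of [f - f x] over the segment from [x] to [y]: a
    first-order Taylor estimate governed by the oscillation of [f]. *)
Lemma der_increment_bound F f x y M : (forall z, derC F z (f z)) -> (forall z, contC f z) ->
  (forall t, 0 <= t <= 1 -> Cmod (f (x + RtoC t * (y - x))%C - f x) <= M) ->
  Cmod (F y - F x - f x * (y - x)) <= 2 * M * Cmod (y - x).
Proof.
  intros HF Hf HM. rewrite <- (Seg_FTC F f x y HF Hf).
  replace (Seg f x y - f x * (y - x))%C with (Seg (fun z => (f z - f x)%C) x y).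
  - apply Seg_bound; [|easy]. cts.
  - rewrite (Seg_minus f (fun _ => f x)) by cts.
    unfold Seg at 2. rewrite CI_const. rewrite Rminus_0_r. ring.
Qed.

Lemma der_zero_const F : (forall z, derC F z 0%C) -> forall x y, F x = F y.
Proof.
  intros HF x y.
  pose proof (der_increment_bound F (fun _ => RtoC 0) y x 0 HF (fun z => cont_const _ _ z)) as H.
  apply Cminus_eq0, Cmod_eq_0. apply Rle_antisym; [|apply Cmod_ge_0].
  replace (F x - F y)%C with (F x - F y - 0 * (x - y))%C by ring.
  eapply Rle_trans; [apply H|].
  - intros t _. rewrite Cmod_zero by ring. lra.
  - lra.
Qed.

Lemma seg_in_disc (a b p : C) r t : 0 <= t <= 1 -> Cmod (a - p) <= r -> Cmod (b - p) <= r ->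
  Cmod (a + RtoC t * (b - a) - p) <= r.
Proof.
  intros Ht Ha Hb.
  replace (a + RtoC t * (b - a) - p)%C with (RtoC (1 - t) * (a - p) + RtoC t * (b - p))%C
    by (rewrite RtoC_minus; ring).
  eapply Rle_trans; [apply Cmod_triangle|].
  rewrite !Cmod_mult, !Cmod_RtoC_pos by lra. nra.
Qed.

(** Differentiation under the integral sign. The affine argument [g t + s * a t] and the weight
    [k t] are shaped for three uses: circle means as functions of the radius, weighted circle means
    as functions of the centre, and division by a linear factor. *)
Lemma derC_integral_param F f (g a k : R -> C) A B M (s : C) :
  (forall z, derC F z (f z)) -> (forall z, contC f z) -> A <= B ->
  (forall t, contR g t) -> (forall t, contR a t) -> (forall t, contR k t) ->
  (forall t, A <= t <= B -> Cmod (g t) <= M /\ Cmod (a t) <= M /\ Cmod (k t) <= M) ->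
  derC (fun s => CI (fun t => F (g t + s * a t) * k t)%C A B) s
    (CI (fun t => f (g t + s * a t) * a t * k t)%C A B).
Proof.
  intros HF Hf HAB Hg Ha Hk HM. apply derC_of_eps. intros eps He.
  assert (HFc : forall z, contC F z) by (intros z; now apply der_cont with (f z)).
  set (M1 := Rabs M + 1). assert (HM1 : 1 <= M1) by (unfold M1; pose proof (Rabs_pos M); lra).
  assert (HM' : forall t, A <= t <= B -> Cmod (g t) <= M1 /\ Cmod (a t) <= M1 /\ Cmod (k t) <= M1).
  { intros t Ht. specialize (HM t Ht). pose proof (Rle_abs M). unfold M1. lra. }
  pose proof (Cmod_ge_0 s) as Hs0.
  (* Cancels the constants collected at the end: a factor 2 from each of two integral bounds, the
     length [B - A], and [M1] twice. The [+ 1] keeps the denominator positive when [A = B]. *)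
  set (e1 := eps / (4 * (B - A + 1) * M1 * M1)).
  assert (Hd1 : 0 < 4 * (B - A + 1) * M1 * M1) by (repeat apply Rmult_lt_0_compat; lra).
  assert (He1 : 0 < e1) by (apply Rdiv_lt_0_compat; lra).
  (* This disc contains every argument [g t + w * a t] with |w| <= |s| + 1, hence the segments
     between the arguments for [s] and for a nearby [y]. *)
  destruct (unif_cont_disc f (M1 + (Cmod s + 1) * M1) Hf e1 He1) as [d [Hd H]].
  exists (Rmin 1 (d / M1)).
  assert (HdM : 0 < d / M1) by (apply Rdiv_lt_0_compat; lra).
  split; [apply Rmin_pos; lra|]. intros y Hy.
  assert (Hy1 := Rlt_le_trans _ _ _ Hy (Rmin_l _ _)).
  assert (Hy2 := Rlt_le_trans _ _ _ Hy (Rmin_r _ _)).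
  assert (C1 : forall s t, contR (fun t => (g t + s * a t)%C) t).
  { cts. }
  assert (C2 : forall s t, contR (fun t => (F (g t + s * a t) * k t)%C) t).
  { cts. }
  assert (C3 : forall t, contR (fun t => (f (g t + s * a t) * a t * k t)%C) t).
  { cts. }
  rewrite (Cmult_comm _ (y - s)%C), <- CI_scal, <- CI_minus, <- CI_minus; auto.
  2, 3: cts.
  eapply Rle_trans; [apply CI_bound with (M := 2 * e1 * (Cmod (y - s) * M1) * M1)|].
  - easy.
  - cts.
  - intros t Ht. destruct (HM' t Ht) as [Mg [Ma Mk]].
    pose proof (Cmod_ge_0 (a t)). pose proof (Cmod_ge_0 (y - s)).
    replace (F (g t + y * a t) * k t - F (g t + s * a t) * k t
              - (y - s) * (f (g t + s * a t) * a t * k t))%C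
      with ((F (g t + y * a t) - F (g t + s * a t) -
              f (g t + s * a t) * (g t + y * a t - (g t + s * a t))) * k t)%C by ring.
    assert (Ys : Cmod (y) <= Cmod s + 1).
    { pose proof (Cmod_ge_sub y s). lra. }
    assert (Bd : forall w, Cmod w <= Cmod s + 1 -> Cmod (g t + w * a t) <= M1 + (Cmod s + 1) * M1).
    { intros w Hw. eapply Rle_trans; [apply Cmod_triangle|]. rewrite Cmod_mult.
      pose proof (Cmod_ge_0 w). nra. }
    assert (Df : Cmod (g t + y * a t - (g t + s * a t)) <= Cmod (y - s) * M1).
    { replace (g t + y * a t - (g t + s * a t))%C with ((y - s) * a t)%C by ring.
      rewrite Cmod_mult. nra. }
    assert (Dd : Cmod (y - s) * M1 < d).
    { apply Rlt_div_r in Hy2; lra. }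
    rewrite Cmod_mult. apply Rmult_le_compat; try apply Cmod_ge_0; [|easy].
    eapply Rle_trans; [apply (der_increment_bound F f _ _ e1 HF Hf)|].
    + intros u Hu. apply Rlt_le, H; [apply Bd; lra| |].
      * replace (g t + s * a t + u * (g t + y * a t - (g t + s * a t)))%C with
          (g t + (s + u * (y - s)) * a t)%C by ring.
        apply Bd. eapply Rle_trans; [apply Cmod_triangle|].
        rewrite Cmod_mult, Cmod_RtoC_pos by lra. nra.
      * replace (g t + s * a t + u * (g t + y * a t - (g t + s * a t)) - (g t + s * a t))%C
          with (RtoC u * (g t + y * a t - (g t + s * a t)))%C by ring.
        rewrite Cmod_mult, Cmod_RtoC_pos by lra.
        pose proof (Cmod_ge_0 (g t + y * a t - (g t + s * a t))). nra.
    + apply Rmult_le_compat_l; lra.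
  - replace (2 * ((B - A) * (2 * e1 * (Cmod (y - s) * M1) * M1))) with
     ((B - A) / (B - A + 1) * (eps * Cmod (y - s))).
    2:{ unfold e1. field. lra. }
    rewrite <- (Rmult_1_l (eps * Cmod (y - s))) at 2.
    pose proof (Cmod_ge_0 (y - s)).
    apply Rmult_le_compat_r; [nra|]. apply Rle_div_l; lra.
Qed.

Definition triangle_integral (f : C -> C) (a b c : C) : C := (Seg f a b + Seg f b c + Seg f c a)%C.

(** The triangle 0, z, y turns [Seg f 0 y - Seg f 0 z] into the integral over the segment from [z]
    to [y]; the mean of [f] over that segment is the Caratheodory slope. *)
Lemma morera f : (forall z, contC f z) ->
  (forall a b c, triangle_integral f a b c = 0%C) ->
  forall z, derC (Seg f 0) z (f z).
Proof.
  intros Hf HT z.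
  exists (fun w => CI (fun t => f (z + RtoC t * (w - z))%C) 0 1). split; [|split].
  - intros eps He. destruct (Hf z (eps / 4) ltac:(lra)) as [d [Hd H]].
    exists d. split; [easy|]. intros w Hw.
    assert (Ez : CI (fun t => f (z + RtoC t * (z - z))%C) 0 1 = CI (fun _ => f z) 0 1).
    { apply CI_ext. intros t. f_equal. ring. }
    rewrite Ez, <- CI_minus; [|cts|cts].
    eapply Rle_lt_trans; [apply CI_bound with (M := eps / 4)|lra].
    + lra.
    + cts.
    + intros t Ht. apply Rlt_le, H.
      replace (z + t * (w - z) - z)%C with (RtoC t * (w - z))%C by ring.
      rewrite Cmod_mult, Cmod_RtoC_pos by lra. pose proof (Cmod_ge_0 (w - z)). nra.
  - rewrite (CI_ext _ (fun _ => f z)) by (intros t; f_equal; ring).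
    rewrite CI_const, Rminus_0_r. ring.
  - intros y. specialize (HT (RtoC 0) z y). unfold triangle_integral in HT. rewrite (Seg_rev f 0 y Hf) in HT.
    change (Seg f 0 y = (Seg f 0 z + CI (fun t => f (z + t * (y - z))%C) 0 1 * (y - z))%C).
    replace (CI (fun t => f (z + t * (y - z))%C) 0 1 * (y - z))%C with (Seg f z y)
      by (unfold Seg; ring).
    apply Cminus_eq0.
    transitivity (- (Seg f 0 z + Seg f z y + - Seg f 0 y))%C; [ring|rewrite HT; ring].
Qed.

(** Increments are majorized by differences of [b], so the tail beyond [n] is at most [b n] without
    summing a series. Applied with [b] geometric for nested triangles and with [b n] of order 1/n
    for the sigma quotients. *)
Lemma telescoping_cauchy (u : nat -> C) (b : nat -> R) :
  (forall n, Cmod (u (S n) - u n) <= b n - b (S n)) -> (forall n, 0 <= b n) ->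
  (forall eps, 0 < eps -> exists n, b n < eps) ->
  exists l, forall n, Cmod (u n - l) <= 2 * b n.
Proof.
  intros Hu Hb Hb0.
  assert (K : forall n k, Cmod (u (n + k)%nat - u n) <= b n - b (n + k)%nat).
  { intros n k. induction k as [|k IH].
    - rewrite Nat.add_0_r, Cmod_zero by ring. lra.
    - rewrite Nat.add_succ_r. specialize (Hu (n + k)%nat).
      pose proof (Cmod_triangle3 (u (S (n + k))) (u (n + k)%nat) (u n)). lra. }
  assert (P : forall p : C -> R, (forall z, Rabs (p z) <= Cmod z) ->
    (forall z w, p (z - w)%C = p z - p w) -> exists l, forall n, Rabs (p (u n) - l) <= b n).
  { intros p Hp Hp'.
    assert (K' : forall n m, (n <= m)%nat -> Rabs (p (u m) - p (u n)) <= b n).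
    { intros n m Hm. rewrite <- Hp'. eapply Rle_trans; [apply Hp|].
      replace m with (n + (m - n))%nat by lia. specialize (K n (m - n)%nat).
      pose proof (Hb (n + (m - n))%nat). lra. }
    assert (Cc : Cauchy_crit (fun n => p (u n))).
    { intros eps He. destruct (Hb0 (eps / 2) ltac:(lra)) as [N HN].
      exists N. intros n m Hn Hm. unfold Rdist.
      pose proof (K' N n Hn). pose proof (K' N m Hm).
      replace (p (u n) - p (u m)) with ((p (u n) - p (u N)) - (p (u m) - p (u N))) by ring.
      pose proof (Rabs_triang (p (u n) - p (u N)) (- (p (u m) - p (u N)))) as T.
      rewrite Rabs_Ropp in T. unfold Rminus at 1. lra. }
    destruct (Rcomplete.R_complete _ Cc) as [l Hl]. exists l. intros n.
    apply Rnot_lt_le. intros Hlt.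
    destruct (Hl (Rabs (p (u n) - l) - b n) ltac:(lra)) as [N HN].
    specialize (HN (max N n) ltac:(lia)). unfold Rdist in HN.
    specialize (K' n (max N n) ltac:(lia)).
    pose proof (Rabs_triang (p (u n) - p (u (max N n))) (p (u (max N n)) - l)) as T.
    replace (p (u n) - p (u (max N n)) + (p (u (max N n)) - l)) with (p (u n) - l) in T by ring.
    rewrite (Rabs_minus_sym (p (u n)) (p (u (max N n)))) in T. lra. }
  destruct (P fst fst_le_Cmod (fun z w => eq_refl)) as [l1 H1].
  destruct (P snd snd_le_Cmod (fun z w => eq_refl)) as [l2 H2].
  exists (l1, l2). intros n. apply Cmod_le_2max; [apply (H1 n)|apply (H2 n)].
Qed.

(** Bisection by the side midpoints: the integral is the sum over four triangles, so one of them
    carries at least a quarter of it. The bound on [a' - a] makes the first vertices a Cauchy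
    sequence under iteration. *)
Lemma goursat_step f a b c s : (forall z, contC f z) ->
  Cmod (b - a) <= s -> Cmod (c - b) <= s -> Cmod (a - c) <= s ->
  exists a' b' c', Cmod (b' - a') <= s / 2 /\ Cmod (c' - b') <= s / 2 /\ Cmod (a' - c') <= s / 2 /\
    Cmod (a' - a) <= s / 2 /\ Cmod (triangle_integral f a b c) <= 4 * Cmod (triangle_integral f a' b' c').
Proof.
  intros Hf H1 H2 H3.
  assert (Hh : forall x y u : C, Cmod (y - x) <= s -> (u = (y - x) / 2 \/ u = - ((y - x) / 2))%C -> Cmod u <= s / 2).
  { intros x y u H [-> | ->]; [|rewrite Cmod_opp];
      (rewrite Cmod_div by (apply RtoC_neq0; lra)); rewrite Cmod_RtoC_pos by lra; lra. }
  set (m1 := ((a + b) / 2)%C). set (m2 := ((b + c) / 2)%C). set (m3 := ((c + a) / 2)%C).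
  assert (E : triangle_integral f a b c =
    (triangle_integral f a m1 m3 + triangle_integral f m1 b m2 + triangle_integral f m3 m2 c + triangle_integral f m1 m2 m3)%C).
  { unfold triangle_integral. rewrite (Seg_split f a b Hf), (Seg_split f b c Hf), (Seg_split f c a Hf). fold m1 m2 m3.
    rewrite (Seg_rev f m1 m2 Hf), (Seg_rev f m2 m3 Hf), (Seg_rev f m1 m3 Hf). ring. }
  assert (Ht := Cmod_triangle (triangle_integral f a m1 m3 + triangle_integral f m1 b m2 + triangle_integral f m3 m2 c) (triangle_integral f m1 m2 m3)).
  assert (Ht' := Cmod_triangle (triangle_integral f a m1 m3 + triangle_integral f m1 b m2) (triangle_integral f m3 m2 c)).
  assert (Ht'' := Cmod_triangle (triangle_integral f a m1 m3) (triangle_integral f m1 b m2)). rewrite <- E in Ht.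
  assert (D : Cmod (triangle_integral f a b c) <= 4 * Cmod (triangle_integral f a m1 m3) \/
    Cmod (triangle_integral f a b c) <= 4 * Cmod (triangle_integral f m1 b m2) \/
    Cmod (triangle_integral f a b c) <= 4 * Cmod (triangle_integral f m3 m2 c) \/
    Cmod (triangle_integral f a b c) <= 4 * Cmod (triangle_integral f m1 m2 m3)) by lra.
  destruct D as [D|[D|[D|D]]];
    [exists a, m1, m3|exists m1, b, m2|exists m3, m2, c|exists m1, m2, m3];
    (split; [|split; [|split; [|split; [|exact D]]]]); unfold m1, m2, m3;
    try (apply (Hh _ _ _ H1); solve [left; field|right; field]);
    try (apply (Hh _ _ _ H2); solve [left; field|right; field]);
    try (apply (Hh _ _ _ H3); solve [left; field|right; field]).
  (* Only the corner triangle at [a] is left, whose first vertex has not moved. *)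
  rewrite Cmod_zero by ring. pose proof (Cmod_ge_0 (b - a)). lra.
Qed.

Lemma goursat f : holo f -> forall a b c, triangle_integral f a b c = 0%C.
Proof.
  intros Hh a b c. assert (Hf := holo_cont f Hh).
  set (Tri := (C * C * C)%type).
  (* The size hypotheses are placed inside [P] as premises, so that every pair of a size and a
     triangle has a successor and [choice] gives a total function [next]. *)
  set (P := fun (s : R) (T T' : Tri) =>
    let '(a, b, c) := T in let '(a', b', c') := T' in
    Cmod (b - a) <= s -> Cmod (c - b) <= s -> Cmod (a - c) <= s ->
    Cmod (b' - a') <= s / 2 /\ Cmod (c' - b') <= s / 2 /\ Cmod (a' - c') <= s / 2 /\
    Cmod (a' - a) <= s / 2 /\
    Cmod (triangle_integral f a b c) <= 4 * Cmod (triangle_integral f a' b' c')).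
  assert (HP : forall sT, exists T', P (fst sT) (snd sT) T').
  { intros [s [[a0 b0] c0]]. unfold P. simpl.
    destruct (classic (Cmod (b0 - a0) <= s /\ Cmod (c0 - b0) <= s /\ Cmod (a0 - c0) <= s)) as [[H1 [H2 H3]]|HN].
    - destruct (goursat_step f a0 b0 c0 s Hf H1 H2 H3) as [a' [b' [c' H]]].
      exists (a', b', c'). auto.
    - exists (a0, b0, c0). tauto. }
  apply choice in HP. destruct HP as [next Hnext].
  set (s0 := Cmod (b - a) + Cmod (c - b) + Cmod (a - c)).
  pose proof (Cmod_ge_0 (b - a)). pose proof (Cmod_ge_0 (c - b)). pose proof (Cmod_ge_0 (a - c)).
  assert (Hs0 : 0 <= s0) by (unfold s0; lra).
  set (s := fun n : nat => s0 / 2 ^ n).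
  assert (sS : forall n, s (S n) = s n / 2).
  { intros n. unfold s. simpl. field. apply pow_nonzero. lra. }
  set (T := fix T (n : nat) : Tri := match n with O => (a, b, c) | S m => next (s m, T m) end).
  set (Tri_a := fun T : Tri => fst (fst T)). set (Tri_b := fun T : Tri => snd (fst T)).
  set (Tri_c := fun T : Tri => snd T).
  set (I := fun T : Tri => triangle_integral f (Tri_a T) (Tri_b T) (Tri_c T)).
  assert (HT : forall n, Cmod (Tri_b (T n) - Tri_a (T n)) <= s n /\
    Cmod (Tri_c (T n) - Tri_b (T n)) <= s n /\ Cmod (Tri_a (T n) - Tri_c (T n)) <= s n).
  { induction n as [|n [IH1 [IH2 IH3]]].
    - replace (s 0%nat) with s0 by (unfold s; simpl; field).
      change (T 0%nat) with (a, b, c). unfold Tri_a, Tri_b, Tri_c. cbn [fst snd]. unfold s0. repeat split; lra.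
    - specialize (Hnext (s n, T n)). rewrite sS. simpl fst in Hnext. simpl snd in Hnext.
      change (T (S n)) with (next (s n, T n)). unfold P in Hnext.
      revert Hnext. generalize (next (s n, T n)). intros [[a2 b2] c2]. destruct (T n) as [[a1 b1] c1]. intros Hnext.
      unfold Tri_a, Tri_b, Tri_c in *. cbn [fst snd] in *. tauto. }
  assert (HT' : forall n, Cmod (Tri_a (T (S n)) - Tri_a (T n)) <= s n / 2 /\
      Cmod (I (T n)) <= 4 * Cmod (I (T (S n)))).
  { intros n. destruct (HT n) as [H1' [H2' H3']]. specialize (Hnext (s n, T n)).
    change (T (S n)) with (next (s n, T n)). unfold P in Hnext. simpl fst in Hnext. simpl snd in Hnext.
    revert Hnext. generalize (next (s n, T n)). intros [[a2 b2] c2]. destruct (T n) as [[a1 b1] c1]. intros Hnext.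
    unfold I, Tri_a, Tri_b, Tri_c in *. cbn [fst snd] in *. tauto. }
  assert (sp : forall n, 0 <= s n).
  { intros n. unfold s. apply Rdiv_le_0_compat; [easy|]. apply pow_lt. lra. }
  destruct (telescoping_cauchy (fun n => Tri_a (T n)) s) as [p Hp].
  - intros n. rewrite sS. destruct (HT' n). lra.
  - easy.
  - intros eps He. destruct (Pow_x_infinity 2) with (b := (s0 + 1) / eps) as [N HN].
    + rewrite Rabs_pos_eq; lra.
    + exists N. specialize (HN N ltac:(lia)).
      assert (H2N : 0 < 2 ^ N) by (apply pow_lt; lra).
      rewrite Rabs_pos_eq in HN by lra.
      unfold s. apply Rlt_div_l; [easy|]. apply Rge_le, Rle_div_l in HN; lra.
  - assert (HI : forall n, Cmod (I (T 0%nat)) <= 4 ^ n * Cmod (I (T n))).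
    { induction n as [|n IH]; [simpl; lra|]. destruct (HT' n) as [_ H4].
      assert (0 < 4 ^ n) by (apply pow_lt; lra). simpl pow. nra. }
    destruct (Hh p) as [l Hl].
    apply Cmod_eq_0. apply Rle_antisym; [|apply Cmod_ge_0].
    change (Cmod (I (T 0%nat)) <= 0).
    apply le_epsilon. intros eps He. rewrite Rplus_0_l.
    set (e := eps / (200 * (s0 + 1) * (s0 + 1))).
    assert (Hq : 0 < 200 * (s0 + 1) * (s0 + 1)) by nra.
    assert (Hep : 0 < e) by (apply Rdiv_lt_0_compat; lra).
    destruct (derC_eps f p l Hl e Hep) as [d [Hd Hde]].
    assert (Hn : exists n, 3 * s n < d).
    { destruct (Pow_x_infinity 2) with (b := (3 * s0 + 1) / d) as [N HN].
      - rewrite Rabs_pos_eq; lra.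
      - exists N. specialize (HN N ltac:(lia)).
        assert (H2N : 0 < 2 ^ N) by (apply pow_lt; lra).
        rewrite Rabs_pos_eq in HN by lra.
        apply Rge_le, Rle_div_l in HN; [|easy].
        unfold s. replace (3 * (s0 / 2 ^ N)) with (3 * s0 / 2 ^ N) by (field; lra).
        apply Rlt_div_l; [easy|]. lra. }
    destruct Hn as [n Hn]. specialize (HI n). specialize (Hp n). simpl in Hp.
    destruct (HT n) as [S1 [S2 S3]].
    unfold I in HI at 2.
    set (an := Tri_a (T n)) in *. set (bn := Tri_b (T n)) in *. set (cn := Tri_c (T n)) in *.
    (* The first-order part of [f] at the limit point has a primitive, so its triangle integral
       vanishes and only the remainder [r] counts. *)
    set (h := fun z => (f p + l * (z - p))%C).
    assert (Hhc : forall z, contC h z).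
    { unfold h. cts. }
    assert (HH : forall z, derC (fun z => (f p * z + l / 2 * ((z - p) * (z - p)))%C) z (h z)).
    { intros z. assert (E0 := der_minus _ _ _ z _ _ (der_emb (fun z : C => z) z) (der_const (fun z : C => z) p z)).
      eapply der_eq.
      - apply der_plus; [apply der_scal, der_emb|]. apply der_scal. apply der_mult; exact E0.
      - unfold h. simpl. field. }
    set (r := fun z => (f z - h z)%C).
    assert (Hrc : forall z, contC r z) by (unfold r; cts).
    assert (ER : triangle_integral f an bn cn = triangle_integral r an bn cn).
    { unfold triangle_integral, r. rewrite !Seg_minus by auto.
      rewrite !(Seg_FTC _ h _ _ HH Hhc). ring. }
    rewrite ER in HI.
    (* [telescoping_cauchy] places the first vertex within [2 * s n] of [p]; one more side length
       reaches the other two vertices, so 3 serves for all. *)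
    assert (Da : Cmod (an - p) <= 3 * s n) by (pose proof (sp n); lra).
    assert (Db : Cmod (bn - p) <= 3 * s n).
    { pose proof (Cmod_triangle3 bn an p). lra. }
    assert (Dc : Cmod (cn - p) <= 3 * s n).
    { pose proof (Cmod_triangle3 cn an p). rewrite (Cmod_minus_sym cn an) in *. lra. }
    assert (Rb : forall x y, Cmod (x - p) <= 3 * s n -> Cmod (y - p) <= 3 * s n ->
      Cmod (y - x) <= s n -> Cmod (Seg r x y) <= 6 * e * s n * s n).
    { intros x y Hx Hy Hxy. eapply Rle_trans; [apply Seg_bound with (M := e * (3 * s n)); [easy|]|].
      - intros t Ht. pose proof (seg_in_disc x y p _ t Ht Hx Hy) as Hz.
        unfold r, h. specialize (Hde (x + t * (y - x))%C ltac:(lra)).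
        replace (f (x + t * (y - x)) - (f p + l * (x + t * (y - x) - p)))%C
          with (f (x + t * (y - x)) - f p - l * (x + t * (y - x) - p))%C by ring.
        eapply Rle_trans; [exact Hde|]. apply Rmult_le_compat_l; lra.
      - pose proof (sp n). pose proof (Cmod_ge_0 (y - x)).
        replace (6 * e * s n * s n) with (2 * (e * (3 * s n)) * s n) by ring.
        apply Rmult_le_compat_l; [|easy]. nra. }
    pose proof (Rb an bn Da Db S1). pose proof (Rb bn cn Db Dc S2). pose proof (Rb cn an Dc Da S3).
    assert (TT : Cmod (triangle_integral r an bn cn) <= 18 * e * s n * s n).
    { unfold triangle_integral. pose proof (Cmod_triangle (Seg r an bn + Seg r bn cn) (Seg r cn an)).
      pose proof (Cmod_triangle (Seg r an bn) (Seg r bn cn)). lra. }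
    (* The factor 4 lost at each bisection is regained exactly, since the bound is quadratic in the
       halved size. *)
    assert (E4 : 4 ^ n * (18 * e * s n * s n) = 18 * e * s0 * s0).
    { unfold s. replace 4 with (2 * 2) by lra. rewrite Rpow_mult_distr. field. apply pow_nonzero; lra. }
    assert (0 < 4 ^ n) by (apply pow_lt; lra).
    apply Rle_trans with (18 * e * s0 * s0).
    { rewrite <- E4. eapply Rle_trans; [exact HI|]. apply Rmult_le_compat_l; lra. }
    replace eps with (e * (200 * (s0 + 1) * (s0 + 1))) by (unfold e; field; lra).
    nra.
Qed.

(** * Circle means and smoothness *)

Lemma cexp_plus (a b : C) : cexp (a + b) = (cexp a * cexp b)%C.
Proof.
  unfold cexp, Cmult. simpl. rewrite exp_plus, cos_plus, sin_plus. f_equal; ring.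
Qed.

Lemma cexp_0 : cexp 0 = 1%C.
Proof. unfold cexp. simpl. rewrite exp_0, cos_0, sin_0. apply injective_projections; simpl; ring. Qed.

Lemma cexp_opp (a : C) : (cexp a * cexp (- a) = 1)%C.
Proof. rewrite <- cexp_plus. replace (a + - a)%C with (RtoC 0) by ring. apply cexp_0. Qed.

Lemma cexp_neq0 (a : C) : cexp a <> 0%C.
Proof.
  intros H. pose proof (cexp_opp a) as E. rewrite H, Cmult_0_l in E.
  apply C1_nz. now symmetry.
Qed.

Lemma Cmod_cexp (z : C) : Cmod (cexp z) = exp (fst z).
Proof.
  unfold Cmod, cexp. simpl.
  replace (exp (fst z) * cos (snd z) * (exp (fst z) * cos (snd z) * 1) +
    exp (fst z) * sin (snd z) * (exp (fst z) * sin (snd z) * 1)) with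
    (exp (fst z) * exp (fst z) * ((sin (snd z))² + (cos (snd z))²)) by (unfold Rsqr; ring).
  rewrite sin2_cos2, Rmult_1_r. apply sqrt_square. apply Rlt_le, exp_pos.
Qed.

Lemma derivable_eps (f : R -> R) (l : R) : is_derive f 0 l -> forall eps, 0 < eps ->
  exists d, 0 < d /\ forall x, Rabs x < d -> Rabs (f x - f 0 - l * x) <= eps * Rabs x.
Proof.
  intros [_ H] eps He. destruct (H 0 (fun P HP => HP) (mkposreal _ He)) as [d Hd].
  exists d. split; [apply cond_pos|]. intros x Hx.
  assert (B : ball 0 d x) by (change (Rabs (x - 0) < d); now rewrite Rminus_0_r).
  specialize (Hd x B). change (Rabs (f x - f 0 - (x - 0) * l) <= eps * Rabs (x - 0)) in Hd.
  rewrite Rminus_0_r in Hd. now rewrite (Rmult_comm l).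
Qed.

(** [cexp] is given by real functions, so the derivative at 0 is assembled from those of [exp],
    [cos] and [sin]; [derC_cexp] carries it to other points by the addition formula. *)
Lemma derC_cexp_0 : derC cexp 0 1.
Proof.
  apply derC_of_eps. intros eps He.
  set (e := Rmin 1 (eps / 6)).
  assert (He' : 0 < e) by (apply Rmin_pos; lra).
  pose proof (Rmin_l 1 (eps / 6)) as He1. pose proof (Rmin_r 1 (eps / 6)) as He2. fold e in He1, He2.
  destruct (derivable_eps exp 1 ltac:(rewrite <- exp_0; apply is_derive_exp) e He') as [d1 [Hd1 H1]].
  destruct (derivable_eps cos 0 ltac:(replace 0 with (- sin 0) at 2 by (rewrite sin_0; ring); apply is_derive_cos) e He') as [d2 [Hd2 H2]].
  destruct (derivable_eps sin 1 ltac:(rewrite <- cos_0; apply is_derive_sin) e He') as [d3 [Hd3 H3]].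
  exists (Rmin (Rmin d1 (e / 2)) (Rmin d2 d3)). split; [repeat apply Rmin_pos; lra|].
  intros h Hh.
  assert (A1 := Rlt_le_trans _ _ _ Hh (Rmin_l _ _)). assert (A2 := Rlt_le_trans _ _ _ Hh (Rmin_r _ _)).
  assert (A3 := Rlt_le_trans _ _ _ A1 (Rmin_l _ _)). assert (A4 := Rlt_le_trans _ _ _ A1 (Rmin_r _ _)).
  assert (A5 := Rlt_le_trans _ _ _ A2 (Rmin_l _ _)). assert (A6 := Rlt_le_trans _ _ _ A2 (Rmin_r _ _)).
  replace (h - 0)%C with h in * by ring. rewrite cexp_0.
  destruct h as [x y]. pose proof (fst_le_Cmod (x, y)) as Bx. pose proof (snd_le_Cmod (x, y)) as By.
  simpl in Bx, By. set (m := Cmod (x, y)) in *.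
  specialize (H1 x ltac:(lra)). specialize (H2 y ltac:(lra)). specialize (H3 y ltac:(lra)).
  rewrite exp_0 in H1. rewrite cos_0 in H2. rewrite sin_0 in H3.
  pose proof (Rabs_pos x). pose proof (Rabs_pos y).
  assert (K1 : Rabs (exp x - 1 - 1 * x) <= e * m) by nra.
  assert (K2 : Rabs (cos y - 1 - 0 * y) <= e * m) by nra.
  assert (K3 : Rabs (sin y - 0 - 1 * y) <= e * m) by nra.
  assert (K4 : Rabs (exp x - 1) <= e).
  { replace (exp x - 1) with ((exp x - 1 - 1 * x) + x) by ring.
    eapply Rle_trans; [apply Rabs_triang|]. nra. }
  assert (K5 : Rabs (exp x) <= 2).
  { replace (exp x) with ((exp x - 1) + 1) by ring.
    eapply Rle_trans; [apply Rabs_triang|]. rewrite Rabs_R1. lra. }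
  assert (m0 : 0 <= m) by apply Cmod_ge_0.
  apply Rle_trans with (2 * (3 * (e * m))); [|nra].
  apply Cmod_le_2max; simpl.
  - replace (exp x * cos y + - (1) + - (1 * x - 0 * y)) with
      (exp x * (cos y - 1 - 0 * y) + (exp x - 1 - 1 * x)) by ring.
    eapply Rle_trans; [apply Rabs_triang|]. rewrite Rabs_mult.
    pose proof (Rabs_pos (cos y - 1 - 0 * y)). pose proof (Rabs_pos (exp x)). nra.
  - replace (exp x * sin y + - 0 + - (1 * y + 0 * x)) with
      (exp x * (sin y - 0 - 1 * y) + y * (exp x - 1)) by ring.
    eapply Rle_trans; [apply Rabs_triang|]. rewrite !Rabs_mult.
    pose proof (Rabs_pos (sin y - 0 - 1 * y)). pose proof (Rabs_pos (exp x)).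
    pose proof (Rabs_pos (exp x - 1)). nra.
Qed.

Lemma derC_cexp z : derC cexp z (cexp z).
Proof.
  apply der_ext with (fun y => (cexp z * cexp (y - z))%C).
  - intros y. rewrite <- cexp_plus. f_equal. ring.
  - eapply der_eq; [apply der_scal|].
    + apply (der_comp (fun z : C => z) cexp (fun y => (y - z)%C) z 1 (1 - 0)%C).
      * replace (z - z)%C with (RtoC 0) by ring. apply derC_cexp_0.
      * apply der_minus; [apply der_emb|apply der_const].
    + ring.
Qed.

(** * Closure properties of entire functions *)

Lemma holo_const c : holo (fun _ => c).
Proof. intros z. exists 0%C. apply der_const. Qed.
Lemma holo_id : holo (fun z => z).
Proof. intros z. exists 1%C. apply (der_emb (fun z : C => z)). Qed.
Lemma holo_plus f g : holo f -> holo g -> holo (fun z => (f z + g z)%C).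
Proof. intros Hf Hg z. destruct (Hf z), (Hg z). eexists. now apply der_plus; eauto. Qed.
Lemma holo_minus f g : holo f -> holo g -> holo (fun z => (f z - g z)%C).
Proof. intros Hf Hg z. destruct (Hf z), (Hg z). eexists. now apply der_minus; eauto. Qed.
Lemma holo_mult f g : holo f -> holo g -> holo (fun z => (f z * g z)%C).
Proof. intros Hf Hg z. destruct (Hf z), (Hg z). eexists. now apply der_mult; eauto. Qed.
Lemma holo_inv f : holo f -> (forall z, f z <> 0%C) -> holo (fun z => (/ f z)%C).
Proof. intros Hf H0 z. destruct (Hf z). eexists. apply der_inv; eauto. Qed.
Lemma holo_comp f g : holo f -> holo g -> holo (fun z => f (g z)).
Proof. intros Hf Hg z. destruct (Hg z) as [m Hm]. destruct (Hf (g z)) as [l Hl]. eexists. eapply der_comp; eauto. Qed.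
Lemma holo_pow f n : holo f -> holo (fun z => (f z ^ n)%C).
Proof. intros Hf. induction n; simpl; [apply holo_const|now apply holo_mult]. Qed.
Lemma holo_cexp : holo cexp.
Proof. intros z. exists (cexp z). apply derC_cexp. Qed.
Lemma holo_ext f g : (forall z, f z = g z) -> holo f -> holo g.
Proof. intros E H z. destruct (H z) as [l Hl]. exists l. now apply der_ext with f. Qed.

Lemma holo_opp f : holo f -> holo (fun z => (- f z)%C).
Proof. intros Hf z. destruct (Hf z). eexists. now apply der_opp; eauto. Qed.

Create HintDb holo.
#[export] Hint Resolve holo_const holo_id holo_cexp : holo.

Ltac holos := intros; first
  [ solve [auto with holo]
  | match goal with |- holo (fun z => (@?f z / ?c)%C) => apply (holo_mult f (fun _ => (/ c)%C)); holos end
  | apply holo_minus; holos | apply holo_plus; holos | apply holo_opp; holos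
  | apply holo_mult; holos | apply holo_pow; holos
  | match goal with |- holo (fun z => ?F (@?g z)) => apply (holo_comp F g); holos end
  | idtac ].

(** [icirc] below is both the inverse and the conjugate of [circ]; integrals against its powers are
    Fourier coefficients on a circle. *)
Definition circ (t : R) : C := cexp (Ci * t).
Definition icirc (t : R) : C := cexp (- (Ci * t)).

Lemma derR_circ t : derR circ t (Ci * circ t).
Proof.
  unfold circ. eapply der_eq; [apply der_comp with (g := cexp); [apply derC_cexp|]|].
  - apply der_scal, (der_emb RtoC).
  - ring.
Qed.

Lemma derR_icirc t : derR icirc t (- Ci * icirc t).
Proof.
  unfold icirc. eapply der_eq; [apply der_comp with (g := cexp); [apply derC_cexp|]|].
  - apply der_opp, der_scal, (der_emb RtoC).
  - ring.
Qed.

Lemma contR_circ t : contR circ t.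
Proof. exact (der_cont _ _ _ _ (derR_circ t)). Qed.
Lemma contR_icirc t : contR icirc t.
Proof. exact (der_cont _ _ _ _ (derR_icirc t)). Qed.

Lemma Cmod_circ t : Cmod (circ t) = 1.
Proof. unfold circ. rewrite Cmod_cexp. simpl. replace (0 * t - 1 * 0) with 0 by ring. apply exp_0. Qed.
Lemma Cmod_icirc t : Cmod (icirc t) = 1.
Proof. unfold icirc. rewrite Cmod_cexp. simpl. replace (- (0 * t - 1 * 0)) with 0 by ring. apply exp_0. Qed.
Lemma circ_icirc t : (circ t * icirc t = 1)%C.
Proof. apply cexp_opp. Qed.
Lemma circ_0 : circ 0 = 1%C.
Proof. unfold circ. rewrite Cmult_0_r. apply cexp_0. Qed.
Lemma circ_2PI : circ (2 * PI) = 1%C.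
Proof.
  unfold circ, cexp. simpl. replace (0 * (2 * PI) - 1 * 0) with 0 by ring.
  replace (0 * 0 + 1 * (2 * PI)) with (2 * PI) by ring.
  rewrite exp_0, cos_2PI, sin_2PI. apply injective_projections; simpl; ring.
Qed.
Lemma icirc_0 : icirc 0 = 1%C.
Proof. pose proof (circ_icirc 0) as E. now rewrite circ_0, Cmult_1_l in E. Qed.
Lemma icirc_2PI : icirc (2 * PI) = 1%C.
Proof. pose proof (circ_icirc (2 * PI)) as E. now rewrite circ_2PI, Cmult_1_l in E. Qed.

Lemma twoPI_pos : 0 < 2 * PI.
Proof. pose proof PI_RGT_0. lra. Qed.

#[export] Hint Resolve contR_circ contR_icirc holo_cont : cts.

Lemma contR_circle F (w s : C) : (forall z, contC F z) -> forall t, contR (fun t => F (w + s * circ t)%C) t.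
Proof. cts. Qed.

(* Integration by parts, since [icirc t = exp (- i t)]. *)
Lemma circle_parts F f (w s : C) n : (forall z, derC F z (f z)) -> (forall z, contC f z) ->
  (INR (S n) * CI (fun t => F (w + s * circ t) * icirc t ^ S n) 0 (2 * PI) =
   s * CI (fun t => f (w + s * circ t) * icirc t ^ n) 0 (2 * PI))%C.
Proof.
  intros HF Hf.
  assert (HFc : forall z, contC F z) by (intros z; now apply der_cont with (f z)).
  assert (C1 : forall t, contR (fun t => (F (w + s * circ t) * icirc t ^ S n)%C) t).
  { cts. }
  assert (C2 : forall t, contR (fun t => (f (w + s * circ t) * icirc t ^ n)%C) t).
  { cts. }
  assert (Dp : forall t m, derR (fun t => (icirc t ^ m)%C) t (- (RtoC (INR m)) * Ci * icirc t ^ m)%C).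
  { intros t m. induction m as [|m IH].
    - simpl. eapply der_eq; [apply der_const|ring].
    - eapply der_eq; [exact (der_mult _ _ _ _ _ _ (derR_icirc t) IH)|].
      rewrite S_INR, RtoC_plus. simpl. ring. }
  assert (E : CI (fun t => (Ci * (s * (f (w + s * circ t) * icirc t ^ n) -
        RtoC (INR (S n)) * (F (w + s * circ t) * icirc t ^ S n)))%C) 0 (2 * PI) = 0%C).
  { rewrite (CI_FTC (fun t => (F (w + s * circ t) * icirc t ^ S n)%C)).
    - rewrite circ_0, circ_2PI, icirc_0, icirc_2PI. ring.
    - intros t. eapply der_eq.
      + apply der_mult; [|apply Dp]. apply der_comp with (g := F); [apply HF|].
        apply der_plus; [apply der_const|]. apply der_scal, derR_circ.
      + cbv beta. simpl Cpow.
        transitivity (f (w + s * circ t) * s * Ci * (circ t * icirc t) * icirc t ^ n +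
          F (w + s * circ t) * (- RtoC (INR (S n)) * Ci * (icirc t * icirc t ^ n)))%C; [ring|].
        rewrite circ_icirc. ring.
    - cts. }
  assert (C3 : forall t, contR (fun t => (s * (f (w + s * circ t) * icirc t ^ n))%C) t) by cts.
  assert (C4 : forall t, contR (fun t => (RtoC (INR (S n)) * (F (w + s * circ t) * icirc t ^ S n))%C) t) by cts.
  rewrite CI_scal, CI_minus, !CI_scal in E; auto.
  2: cts.
  apply Cmult_integral in E. destruct E as [E|E].
  - exfalso. apply (f_equal Cmod) in E. rewrite Cmod_Ci, Cmod_0 in E. lra.
  - symmetry. now apply Cminus_eq0.
Qed.

(** The mean is differentiable in the complex radius [s] with derivative 0, hence equals its value
    at [s = 0]. The derivative in [s] vanishes because its integrand is, up to a constant, a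
    derivative in [t] of a function with period 2 pi. *)
Lemma mean_value_C1 F f (w s : C) : (forall z, derC F z (f z)) -> (forall z, contC f z) ->
  CI (fun t => F (w + s * circ t)%C) 0 (2 * PI) = (RtoC (2 * PI) * F w)%C.
Proof.
  intros HF Hf.
  assert (HFc : forall z, contC F z) by (intros z; now apply der_cont with (f z)).
  pose proof twoPI_pos as P2.
  assert (Hd : forall s, derC (fun s => CI (fun t => (F (w + s * circ t) * 1)%C) 0 (2 * PI)) s 0%C).
  { intros s0. eapply der_eq.
    - apply (derC_integral_param F f (fun _ => w) circ (fun _ => RtoC 1) 0 (2 * PI) (Cmod w + 1) s0); auto.
      + lra.
      + cts.
      + cts.
      + cts.
      + intros t _. rewrite Cmod_circ, Cmod_R, Rabs_R1. pose proof (Cmod_ge_0 w). lra.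
    (* For [s0 = 0] the integrand is a constant times [circ]; otherwise it is the derivative in [t]
       of [F (w + s0 * circ t)] times [- Ci / s0]. *)
    - destruct (classic (s0 = 0%C)) as [-> | Hs].
      + rewrite (CI_ext _ (fun t => (- Ci * f w * (Ci * circ t))%C)).
        * rewrite CI_scal, (CI_FTC circ).
          -- rewrite circ_0, circ_2PI. ring.
          -- apply derR_circ.
          -- cts.
          -- cts.
        * intros t. rewrite Cmult_0_l, Cplus_0_r.
          transitivity (- (Ci * Ci) * f w * circ t)%C; [|ring].
          replace (Ci * Ci)%C with (-(1))%C by (apply injective_projections; simpl; ring). ring.
      + rewrite (CI_ext _ (fun t => (- (Ci / s0) * (f (w + s0 * circ t) * (s0 * (Ci * circ t))))%C)).
        * assert (Cx : forall t, contR (fun t => (f (w + s0 * circ t) * (s0 * (Ci * circ t)))%C) t).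
          { cts. }
          rewrite CI_scal, (CI_FTC (fun t => F (w + s0 * circ t)%C)); auto.
          -- rewrite circ_0, circ_2PI. ring.
          -- intros t. eapply der_eq; [apply der_comp with (g := F); [apply HF|]|].
             ++ apply der_plus; [apply der_const|]. apply der_scal, derR_circ.
             ++ ring.
        * intros t. transitivity (- (Ci * Ci) * f (w + s0 * circ t) * circ t)%C.
          -- replace (Ci * Ci)%C with (-(1))%C by (apply injective_projections; simpl; ring). ring.
          -- field. easy. }
  pose proof (der_zero_const _ Hd s 0%C) as E. cbv beta in E.
  rewrite (CI_ext _ (fun t => (F (w + s * circ t) * 1)%C)) by (intros; ring).
  rewrite E, (CI_ext _ (fun _ => F w)).
  - rewrite CI_const, Rminus_0_r. ring.
  - intros t. rewrite Cmult_0_l, Cplus_0_r. ring.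
Qed.

Lemma holo_primitive f : holo f -> exists F, forall z, derC F z (f z).
Proof. intros H. exists (Seg f 0). apply morera; [now apply holo_cont|now apply goursat]. Qed.

(* If [G] is a primitive of [f], then by [circle_parts] [f] and, after differentiating under the
   integral sign, also its derivative are circle means of [G]. *)
Lemma holo_Dc f : holo f -> holo (Dc f).
Proof.
  intros Hf. destruct (holo_primitive f Hf) as [G HG]. pose proof (holo_cont f Hf) as cf.
  pose proof twoPI_pos as P2.
  assert (P0 : RtoC (2 * PI) <> 0%C) by (apply RtoC_neq0; lra).
  set (J := fun (g : C -> C) n w => CI (fun t => (g (circ t + w * 1) * icirc t ^ n)%C) 0 (2 * PI)).
  assert (EJ : forall g n w, J g n w = CI (fun t => (g (w + 1 * circ t) * icirc t ^ n)%C) 0 (2 * PI)).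
  { intros g n w. apply CI_ext. intros t. do 2 f_equal. ring. }
  assert (Par : forall n w, (RtoC (INR (S n)) * J G (S n) w = J f n w)%C).
  { intros n w. rewrite !EJ, (circle_parts G f w 1 n HG cf). ring. }
  assert (dJ : forall n w, derC (J G n) w (J f n w)).
  { intros n w. unfold J. eapply der_eq.
    - apply (derC_integral_param G f circ (fun _ => RtoC 1) (fun t => (icirc t ^ n)%C) 0 (2 * PI) 1 w); auto; try cts; [lra|].
      rewrite Cmod_pow, Cmod_circ, Cmod_icirc, Cmod_R, Rabs_R1, pow1. lra.
    - apply CI_ext. intros t. ring. }
  assert (MVG : forall w, J G 0%nat w = (RtoC (2 * PI) * G w)%C).
  { intros w. rewrite EJ, <- (mean_value_C1 G f w 1 HG cf). apply CI_ext. intros t. simpl. ring. }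
  assert (MVf : forall w, J f 0%nat w = (RtoC (2 * PI) * f w)%C).
  { intros w. apply derC_unique with (J G 0%nat) w; [apply dJ|].
    eapply der_ext; [intros y; symmetry; apply MVG|]. now apply der_scal. }
  assert (Ef : forall w, f w = (/ RtoC (2 * PI) * J G 1%nat w)%C).
  { intros w. replace (J G 1%nat w) with (RtoC (2 * PI) * f w)%C; [field; easy|].
    rewrite <- MVf, <- Par. simpl. ring. }
  assert (ED : forall w, Dc f w = (/ RtoC (2 * PI) * (2 * J G 2%nat w))%C).
  { intros w. apply Dc_unique. eapply der_ext; [intros y; symmetry; apply Ef|].
    eapply der_eq; [apply der_scal, dJ|]. rewrite <- Par. simpl INR. rewrite RtoC_plus. ring. }
  intros w. eexists. eapply der_ext; [intros y; symmetry; apply ED|]. do 2 apply der_scal. apply dJ.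
Qed.

Lemma Dc_cont f : holo f -> forall z, contC (Dc f) z.
Proof. intros H. now apply holo_cont, holo_Dc. Qed.

Lemma mean_value f (w s : C) : holo f ->
  CI (fun t => f (w + s * circ t)%C) 0 (2 * PI) = (RtoC (2 * PI) * f w)%C.
Proof. intros H. apply mean_value_C1 with (Dc f); [now apply Dc_spec|now apply Dc_cont]. Qed.

(** Weierstrass' convergence theorem. Triangle integrals pass to the limit, so [f] is continuous
    with vanishing triangle integrals; by [morera] it is the derivative of an entire function, and
    by [holo_Dc] it is entire. *)
Lemma holo_limit (fn : nat -> C -> C) f : (forall n, holo (fn n)) ->
  (forall B eps, 0 < eps -> exists n, forall z, Cmod z <= B -> Cmod (fn n z - f z) <= eps) ->
  holo f.
Proof.
  intros Hn Hl.
  assert (Hc : forall z, contC f z).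
  { intros z eps He. destruct (Hl (Cmod z + 1) (eps / 4) ltac:(lra)) as [n H].
    destruct (holo_cont _ (Hn n) z (eps / 4) ltac:(lra)) as [d [Hd H']].
    exists (Rmin 1 d). split; [apply Rmin_pos; lra|]. intros y Hy.
    assert (Hy1 := Rlt_le_trans _ _ _ Hy (Rmin_l _ _)). specialize (H' y (Rlt_le_trans _ _ _ Hy (Rmin_r _ _))).
    pose proof (Cmod_ge_sub y z). pose proof (H y ltac:(lra)) as Hy'. pose proof (H z ltac:(lra)) as Hz'.
    pose proof (Cmod_triangle3 (f y) (fn n y) (f z)). pose proof (Cmod_triangle3 (fn n y) (fn n z) (f z)).
    rewrite Cmod_minus_sym in Hy'. lra. }
  assert (HF : forall z, derC (Seg f 0) z (f z)).
  { apply morera; [easy|]. intros a b c. apply Cmod_eq_0. apply Rle_antisym; [|apply Cmod_ge_0].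
    apply le_epsilon. intros eps He. rewrite Rplus_0_l.
    set (B := Cmod a + Cmod b + Cmod c). set (L := 2 * (Cmod (b - a) + Cmod (c - b) + Cmod (a - c))).
    pose proof (Cmod_ge_0 a). pose proof (Cmod_ge_0 b). pose proof (Cmod_ge_0 c).
    pose proof (Cmod_ge_0 (b - a)). pose proof (Cmod_ge_0 (c - b)). pose proof (Cmod_ge_0 (a - c)).
    assert (HL : 0 <= L) by (unfold L; lra).
    destruct (Hl B (eps / (L + 1)) ltac:(apply Rdiv_lt_0_compat; lra)) as [n Hn1].
    assert (S1 : forall x y, Cmod x <= B -> Cmod y <= B ->
      Cmod (Seg f x y - Seg (fn n) x y) <= 2 * (eps / (L + 1)) * Cmod (y - x)).
    { intros x y Hx Hy. rewrite <- Seg_minus by (auto; now apply holo_cont).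
      apply Seg_bound.
      - cts.
      - intros t Ht. rewrite Cmod_minus_sym. apply Hn1.
        pose proof (seg_in_disc x y 0 B t Ht) as Q.
        replace (x - 0)%C with x in Q by ring. replace (y - 0)%C with y in Q by ring.
        replace (x + t * (y - x) - 0)%C with (x + t * (y - x))%C in Q by ring. auto. }
    pose proof (S1 a b ltac:(unfold B; lra) ltac:(unfold B; lra)) as Q1.
    pose proof (S1 b c ltac:(unfold B; lra) ltac:(unfold B; lra)) as Q2.
    pose proof (S1 c a ltac:(unfold B; lra) ltac:(unfold B; lra)) as Q3.
    replace (triangle_integral f a b c) with
      ((Seg f a b - Seg (fn n) a b) + (Seg f b c - Seg (fn n) b c) + (Seg f c a - Seg (fn n) c a))%C.
    2:{ unfold triangle_integral. transitivity (Seg f a b + Seg f b c + Seg f c a - (Seg (fn n) a b + Seg (fn n) b c + Seg (fn n) c a))%C; [ring|].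
        pose proof (goursat (fn n) (Hn n) a b c) as Q. unfold triangle_integral in *. rewrite Q. ring. }
    pose proof (Cmod_triangle ((Seg f a b - Seg (fn n) a b) + (Seg f b c - Seg (fn n) b c)) (Seg f c a - Seg (fn n) c a)).
    pose proof (Cmod_triangle (Seg f a b - Seg (fn n) a b) (Seg f b c - Seg (fn n) b c)).
    apply Rle_trans with (eps / (L + 1) * L); [unfold L at 2; lra|].
    replace eps with (eps / (L + 1) * (L + 1)) at 2 by (field; lra).
    apply Rmult_le_compat_l; [|lra]. apply Rlt_le, Rdiv_lt_0_compat; lra. }
  assert (hF : holo (Seg f 0)) by (intros z; eauto).
  apply holo_ext with (Dc (Seg f 0)); [|now apply holo_Dc].
  intros z. now apply Dc_unique.
Qed.

(** Hadamard's formula: the quotient is the integral of [f' (l + t (z - l))] over [t] in [0, 1],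
    which is entire in [z] and takes the value [f' l] at [l]. *)
Lemma holo_divide f l : holo f -> f l = 0%C ->
  exists g, holo g /\ (forall z, f z = ((z - l) * g z)%C) /\ g l = Dc f l.
Proof.
  intros Hf H0. exists (fun z => CI (fun t => (Dc f ((l - RtoC t * l) + z * RtoC t) * 1)%C) 0 1).
  pose proof (holo_Dc f Hf) as hD.
  split; [|split].
  - intros z. eexists.
    apply (derC_integral_param (Dc f) (Dc (Dc f)) (fun t => (l - RtoC t * l)%C) RtoC (fun _ => RtoC 1)
      0 1 (2 * Cmod l + 1) z).
    + now apply Dc_spec.
    + now apply Dc_cont.
    + lra.
    + cts.
    + cts.
    + cts.
    + intros t Ht. pose proof (Cmod_ge_0 l). rewrite !Cmod_RtoC_pos by lra. repeat split; try lra.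
      eapply Rle_trans; [apply Cmod_le_add|]. rewrite Cmod_mult, Cmod_RtoC_pos by lra. nra.
  - intros z. pose proof (Seg_FTC f (Dc f) l z (Dc_spec f Hf) (Dc_cont f Hf)) as E.
    rewrite H0 in E. transitivity (f z - 0)%C; [ring|]. rewrite <- E. unfold Seg. f_equal.
    apply CI_ext. intros t. rewrite Cmult_1_r. f_equal. ring.
  - rewrite (CI_ext _ (fun _ => Dc f l)).
    + rewrite CI_const, Rminus_0_r. ring.
    + intros t. rewrite Cmult_1_r. f_equal. ring.
Qed.

(** A weak maximum principle derived from the mean value property alone. With the kernel
    [k t = r * circ t / (w + r * circ t - z)] the integral of [h * k] equals [h z] times the
    integral of [k]. The numbers are |k| <= 4/3 and |1 - k| <= 1/3, so the integral of [k] has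
    modulus at least 2 pi / 3, and the quotient of the bounds is 8. *)
Lemma cauchy_circle_bound h (w z : C) (r M : R) : holo h -> 0 < r -> Cmod (z - w) <= r / 4 ->
  (forall t, Cmod (h (w + r * circ t)%C) <= M) -> Cmod (h z) <= 8 * M.
Proof.
  intros Hh Hr Hz HM. pose proof twoPI_pos as P2.
  assert (M0 : 0 <= M) by (eapply Rle_trans; [apply Cmod_ge_0|apply (HM 0)]).
  destruct (holo_divide (fun y => (h y - h z)%C) z) as [q [Hq [Eq _]]].
  { holos. }
  { ring. }
  set (den := fun t => (w + RtoC r * circ t - z)%C).
  assert (Hrc : forall t, Cmod (RtoC r * circ t) = r).
  { intros t. rewrite Cmod_mult, Cmod_circ, Cmod_RtoC_pos by lra. ring. }
  assert (Hden : forall t, 3 / 4 * r <= Cmod (den t)).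
  { intros t. unfold den. pose proof (Cmod_ge_sub (RtoC r * circ t) (z - w)).
    rewrite Hrc in H. replace (w + r * circ t - z)%C with (r * circ t - (z - w))%C by ring. lra. }
  assert (Hden0 : forall t, den t <> 0%C).
  { intros t. apply Cmod_gt_0. specialize (Hden t). lra. }
  assert (cden : forall t, contR den t).
  { unfold den. cts. }
  set (k := fun t => (RtoC r * circ t * / den t)%C).
  assert (ck : forall t, contR k t).
  { unfold k. cts. }
  assert (chk : forall t, contR (fun t => (h (w + r * circ t) * k t)%C) t).
  { cts. }
  assert (Kk : forall t, Cmod (k t) <= 4 / 3).
  { intros t. unfold k. rewrite Cmod_mult, Hrc, Cmod_inv by auto. specialize (Hden t).
    apply Rle_div_l; lra. }
  assert (K1 : forall t, Cmod (1 - k t) <= 1 / 3).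
  { intros t. replace (1 - k t)%C with ((w - z) * / den t)%C.
    - rewrite Cmod_mult, Cmod_minus_sym, Cmod_inv by auto. specialize (Hden t). apply Rle_div_l; lra.
    - unfold k. replace (w - z)%C with (den t - r * circ t)%C by (unfold den; ring). field. auto. }
  (* The integrand is [(y - w) * q y] on the circle, where [q] is the entire quotient of [h - h z]
     by [y - z]; its mean is its value at the centre, which is 0. *)
  assert (E : CI (fun t => (h (w + r * circ t) * k t - h z * k t)%C) 0 (2 * PI) = 0%C).
  { assert (hq : holo (fun y => ((y - w) * q y)%C)).
    { holos. }
    pose proof (mean_value _ w r hq) as E0. cbv beta in E0.
    replace (RtoC (2 * PI) * ((w - w) * q w))%C with (RtoC 0) in E0 by ring. rewrite <- E0.
    apply CI_ext. intros t. specialize (Eq (w + r * circ t)%C). fold (den t) in Eq.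
    unfold k. transitivity ((h (w + r * circ t) - h z) * (r * circ t * / den t))%C; [ring|].
    rewrite Eq. field. auto. }
  rewrite CI_minus, CI_scal in E; auto.
  2: cts.
  apply Cminus_eq0 in E.
  assert (B1 : Cmod (CI (fun t => (h (w + r * circ t) * k t)%C) 0 (2 * PI)) <= 2 * ((2 * PI - 0) * (M * (4 / 3)))).
  { apply CI_bound; auto; [lra|]. intros t _. rewrite Cmod_mult. apply Rmult_le_compat; auto; apply Cmod_ge_0. }
  rewrite E, Cmod_mult in B1.
  assert (B2 : Cmod (CI (fun t => (1 - k t)%C) 0 (2 * PI)) <= 2 * ((2 * PI - 0) * (1 / 3))).
  { apply CI_bound; auto; [lra|]. cts. }
  rewrite CI_minus, CI_const in B2; auto.
  2: cts.
  pose proof (Cmod_ge_sub (RtoC (2 * PI - 0) * 1) (CI k 0 (2 * PI))) as B3.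
  rewrite Cmult_1_r in *. rewrite (Cmod_RtoC_pos (2 * PI - 0)) in B3 by lra.
  pose proof (Cmod_ge_0 (h z)).
  assert (B4 : 2 * PI / 3 <= Cmod (CI k 0 (2 * PI))) by lra.
  assert (B5 : Cmod (h z) * (2 * PI / 3) <= 2 * ((2 * PI - 0) * (M * (4 / 3)))) by nra.
  apply Rmult_le_reg_r with (2 * PI / 3); lra.
Qed.

(** * Zeros, logarithms and growth of entire functions *)

Lemma small_multiple_zero (x K : R) : 0 <= x -> 0 <= K ->
  (forall r, 1 <= r -> x * r <= K) -> x = 0.
Proof.
  intros Hx HK H. apply Rle_antisym; [|easy]. apply Rnot_lt_le. intros Hlt.
  assert (A : 0 <= (K + 1) / x) by (apply Rdiv_le_0_compat; lra).
  specialize (H ((K + 1) / x + 1) ltac:(lra)).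
  replace (x * ((K + 1) / x + 1)) with (K + 1 + x) in H by (field; lra). lra.
Qed.

Lemma Cmod_circle_pt (w : C) r t : 0 <= r -> Cmod (w + r * circ t) <= Cmod w + r.
Proof.
  intros Hr. eapply Rle_trans; [apply Cmod_triangle|].
  rewrite Cmod_mult, Cmod_circ, Cmod_RtoC_pos by easy. lra.
Qed.

(** If [f] were divisible by every power of [z - w], the circle bound applied to the cofactors would
    give |f z| <= 8 M / 4^n for all [n], so [f] would vanish at [z]. *)
Lemma holo_order f w : holo f -> (exists z, f z <> 0%C) ->
  exists n g, holo g /\ (forall z, f z = ((z - w) ^ n * g z)%C) /\ g w <> 0%C.
Proof.
  intros Hf [z Hz]. apply NNPP. intros HN. apply Hz.
  assert (K : forall n, exists g, holo g /\ forall z, f z = ((z - w) ^ n * g z)%C).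
  { induction n as [|n [g [Hg Eg]]].
    - exists f. split; [easy|]. intros; simpl; ring.
    - destruct (classic (g w = 0%C)) as [H0|H0].
      + destruct (holo_divide g w Hg H0) as [h [Hh [Eh _]]].
        exists h. split; [easy|]. intros y. rewrite Eg, Eh. simpl. ring.
      + exfalso. apply HN. now exists n, g. }
  (* The radius is at least four times |z - w|, both for [cauchy_circle_bound] and for the decay
     4^(-n); the [+ 4] keeps it positive when [z = w]. *)
  pose proof (Cmod_ge_0 (z - w)) as Z0. set (r := 4 * Cmod (z - w) + 4).
  destruct (bounded_disc f (Cmod w + r) (holo_cont f Hf)) as [M [HM0 HM]].
  assert (B : forall n, Cmod (f z) * 4 ^ n <= 8 * M).
  { intros n. destruct (K n) as [g [Hg Eg]].
    assert (rn : 0 < r ^ n) by (apply pow_lt; unfold r; lra).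
    assert (Bg : Cmod (g z) <= 8 * (M / r ^ n)).
    { apply (cauchy_circle_bound g w z r); auto; [unfold r; lra|unfold r; lra|].
      intros t. specialize (HM (w + r * circ t)%C ltac:(apply Cmod_circle_pt; unfold r; lra)).
      rewrite Eg, Cmod_mult, Cmod_pow in HM.
      replace (w + r * circ t - w)%C with (r * circ t)%C in HM by ring.
      rewrite Cmod_mult, Cmod_circ, Cmod_RtoC_pos, Rmult_1_r in HM by (unfold r; lra).
      apply Rle_div_r; [easy|]. lra. }
    rewrite Eg, Cmod_mult, Cmod_pow.
    assert (P : Cmod (z - w) ^ n * 4 ^ n <= r ^ n).
    { rewrite <- Rpow_mult_distr. apply pow_incr. unfold r; lra. }
    assert (Bg' : Cmod (g z) * r ^ n <= 8 * M).
    { replace (8 * M) with (8 * (M / r ^ n) * r ^ n) by (field; lra). apply Rmult_le_compat_r; lra. }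
    pose proof (Cmod_ge_0 (g z)).
    apply Rle_trans with (Cmod (g z) * r ^ n); [|easy].
    rewrite Rmult_assoc, (Rmult_comm (Cmod (g z))), <- Rmult_assoc, Rmult_comm.
    now apply Rmult_le_compat_l. }
  apply Cmod_eq_0. apply small_multiple_zero with (8 * M); [apply Cmod_ge_0|lra|].
  intros r0 Hr0. destruct (Pow_x_infinity 4) with (b := r0) as [N HN'].
  - rewrite Rabs_pos_eq; lra.
  - specialize (HN' N ltac:(lia)). rewrite Rabs_pos_eq in HN' by (apply pow_le; lra).
    specialize (B N). pose proof (Cmod_ge_0 (f z)). nra.
Qed.

(** Entire functions form an integral domain. In the sequel this plays the part of the identity
    theorem: an equation is multiplied by a nonzero entire function, checked, and cancelled. *)
Lemma holo_mult_zero f g : holo f -> holo g -> (forall z, (f z * g z = 0)%C) ->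
  (exists z, f z <> 0%C) -> forall z, g z = 0%C.
Proof.
  intros Hf Hg H [w Hw] z. apply NNPP. intros Hz.
  destruct (holo_order g w Hg (ex_intro _ z Hz)) as [n [h [Hh [Eh Hhw]]]].
  destruct (cont_away0 _ _ w (holo_cont f Hf w) Hw) as [d1 [Hd1 H1]].
  destruct (cont_away0 _ _ w (holo_cont h Hh w) Hhw) as [d2 [Hd2 H2]].
  set (d := Rmin d1 d2 / 2). assert (Hd : 0 < Rmin d1 d2) by now apply Rmin_pos.
  pose proof (Rmin_l d1 d2). pose proof (Rmin_r d1 d2).
  set (y := (w + RtoC d)%C).
  assert (Hy : Cmod (y - w) = d).
  { unfold y. replace (w + d - w)%C with (RtoC d) by ring. apply Cmod_RtoC_pos. unfold d; lra. }
  specialize (H1 y ltac:(unfold d in Hy; lra)). specialize (H2 y ltac:(unfold d in Hy; lra)).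
  apply Cmod_gt_0 in Hw. apply Cmod_gt_0 in Hhw.
  specialize (H y). apply Cmult_integral in H. destruct H as [H|H].
  - rewrite H, Cmod_0 in H1. lra.
  - rewrite Eh in H. apply Cmult_integral in H. destruct H as [H|H].
    + apply Cpow_nz in H; [easy|]. apply Cmod_gt_0. unfold d in Hy. lra.
    + rewrite H, Cmod_0 in H2. lra.
Qed.

Lemma cexp_surj (c : C) : c <> 0%C -> exists b, cexp b = c.
Proof.
  intros Hc. apply Cmod_gt_0 in Hc as Hm. set (m := Cmod c) in *.
  set (x := fst c / m). set (y := snd c / m).
  assert (Exy : x * x + y * y = 1).
  { unfold x, y. assert (E : m * m = fst c * fst c + snd c * snd c).
    { unfold m, Cmod. rewrite sqrt_sqrt; [simpl; ring|]. simpl. nra. }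
    apply Rmult_eq_reg_r with (m * m); [|nra].
    replace ((fst c / m * (fst c / m) + snd c / m * (snd c / m)) * (m * m)) with
      (fst c * fst c + snd c * snd c) by (field; lra). lra. }
  assert (Hx : -1 <= x <= 1) by nra.
  assert (Ht : exists t, cos t = x /\ sin t = y).
  { destruct (Rle_dec 0 y) as [Hy|Hy].
    - exists (acos x). split; [now apply cos_acos|]. rewrite sin_acos by easy.
      replace (1 - x²) with (y²) by (unfold Rsqr; lra). now apply sqrt_Rsqr.
    - exists (- acos x). rewrite cos_neg, sin_neg. split; [now apply cos_acos|]. rewrite sin_acos by easy.
      replace (1 - x²) with ((- y)²) by (unfold Rsqr; lra). rewrite sqrt_Rsqr by lra. ring. }
  destruct Ht as [t [Ht1 Ht2]]. exists (ln m, t). unfold cexp. simpl.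
  rewrite exp_ln, Ht1, Ht2 by easy. unfold x, y. apply injective_projections; simpl; field; lra.
Qed.

(** A primitive [g] of [E' / E] makes [E * cexp (- g)] constant, and that nonzero constant is itself
    a value of [cexp]. *)
Lemma holo_log E : holo E -> (forall z, E z <> 0%C) -> exists g, holo g /\ forall z, E z = cexp (g z).
Proof.
  intros HE H0.
  assert (Hq : holo (fun z => (Dc E z * / E z)%C)).
  { apply holo_mult; [now apply holo_Dc|now apply holo_inv]. }
  destruct (holo_primitive _ Hq) as [g Hg].
  assert (Hd : forall z, derC (fun z => (E z * cexp (- g z))%C) z 0%C).
  { intros z. eapply der_eq.
    - apply der_mult; [now apply Dc_spec|].
      apply (der_comp (fun z : C => z) cexp (fun z => (- g z)%C)); [apply derC_cexp|].
      apply der_opp, Hg.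
    - cbv beta. field. auto. }
  assert (Hk : (E 0 * cexp (- g 0) <> 0)%C).
  { intros K. apply Cmult_integral in K. destruct K as [K|K]; [now apply (H0 0%C)|now apply cexp_neq0 in K]. }
  destruct (cexp_surj _ Hk) as [b Hb].
  exists (fun z => (g z + b)%C). split.
  - apply holo_plus; [intros z; eauto|apply holo_const].
  - intros z. rewrite cexp_plus, Hb. pose proof (der_zero_const _ Hd 0%C z) as Ez. cbv beta in Ez.
    rewrite Ez. transitivity (E z * (cexp (g z) * cexp (- g z)))%C; [|ring].
    rewrite cexp_opp. ring.
Qed.

Lemma CI_bound_int F (g : R -> R) a b : a <= b -> (forall t, contR F t) -> (forall t, continuous g t) ->
  (forall t, Cmod (F t) <= g t) -> Cmod (CI F a b) <= 2 * RInt g a b.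
Proof.
  intros Hab HF Hg HM.
  assert (Eg : ex_RInt g a b) by (apply (@ex_RInt_continuous R_CompleteNormedModule); auto).
  apply Cmod_le_2max; simpl.
  - apply (norm_RInt_le (V := R_NormedModule) (fun t => fst (F t)) g a b); [easy| | |].
    + intros t _. eapply Rle_trans; [apply fst_le_Cmod|auto].
    + now apply (@RInt_correct R_CompleteNormedModule), ex_RInt_fst.
    + now apply (@RInt_correct R_CompleteNormedModule).
  - apply (norm_RInt_le (V := R_NormedModule) (fun t => snd (F t)) g a b); [easy| | |].
    + intros t _. eapply Rle_trans; [apply snd_le_Cmod|auto].
    + now apply (@RInt_correct R_CompleteNormedModule), ex_RInt_snd.
    + now apply (@RInt_correct R_CompleteNormedModule).
Qed.

Lemma CI_conj F a b : (forall t, contR F t) -> CI (fun t => Cconj (F t)) a b = Cconj (CI F a b).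
Proof.
  intros HF. unfold CI, Cconj. simpl. f_equal.
  apply (@RInt_opp R_CompleteNormedModule (fun t => snd (F t))). now apply ex_RInt_snd.
Qed.

Lemma Cconj_circ t : Cconj (circ t) = icirc t.
Proof.
  unfold circ, icirc, cexp, Cconj. simpl.
  replace (0 * 0 + 1 * t) with t by ring. replace (- (0 * 0 + 1 * t)) with (- t) by ring.
  replace (0 * t - 1 * 0) with 0 by ring. rewrite Ropp_0, cos_neg, sin_neg. f_equal. ring.
Qed.

Lemma contR_conj F t : contR F t -> contR (fun t => Cconj (F t)) t.
Proof.
  intros H eps He. destruct (H eps He) as [d [Hd H']]. exists d. split; [easy|]. intros y Hy.
  rewrite <- Cminus_conj, Cmod_conj. auto.
Qed.

(* Borel-Caratheodory: [int h exp(4it) = 0], so the integral of [h exp(-4it)], which is the fourth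
   derivative, only sees [2 Re h], whose L1 norm is controlled by an upper bound of [Re h]. *)
Lemma cubic_growth_D4 h K : holo h -> 0 <= K -> (forall z, fst (h z) <= K * (1 + Cmod z) ^ 3) ->
  forall w, Dc (Dc (Dc (Dc h))) w = 0%C.
Proof.
  intros Hh HK HB w. pose proof twoPI_pos as P2.
  set (h1 := Dc h). set (h2 := Dc h1). set (h3 := Dc h2). set (h4 := Dc h3).
  assert (H1 : holo h1) by now apply holo_Dc. assert (H2 : holo h2) by now apply holo_Dc.
  assert (H3 : holo h3) by now apply holo_Dc. assert (H4 : holo h4) by now apply holo_Dc.
  apply Cmod_eq_0. apply small_multiple_zero with (96 * (16 * K + Cmod (h w)) * (1 + Cmod w)).
  { apply Cmod_ge_0. }
  { pose proof (Cmod_ge_0 (h w)). pose proof (Cmod_ge_0 w). repeat apply Rmult_le_pos; lra. }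
  (* Radii [r >= 1 + |w|] suffice: the fourth derivative carries r^4 against a right side of order
     r^3, so |h4 w| * r stays bounded. *)
  intros r0 Hr0. pose proof (Cmod_ge_0 w) as W0. set (r := r0 * (1 + Cmod w)).
  assert (Hr1 : 1 + Cmod w <= r) by (unfold r; nra).
  assert (Main : Cmod (h4 w) * r <= 96 * (16 * K + Cmod (h w))).
  2:{ unfold r in Main. rewrite <- Rmult_assoc in Main.
      pose proof (Cmod_ge_0 (h4 w)).
      apply Rle_trans with (Cmod (h4 w) * r0 * (1 + Cmod w)).
      - change (Dc (Dc (Dc (Dc h)))) with h4. assert (0 <= Cmod (h4 w) * r0) by nra. nra.
      - eapply Rle_trans; [exact Main|]. pose proof (Cmod_ge_0 (h w)).
        assert (0 <= 96 * (16 * K + Cmod (h w))) by lra. nra. }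
  (* Four integrations by parts, with factors 4, 3, 2, 1 and [r] each time, followed by the mean
     value property for [h4]: this is Cauchy's formula for the fourth derivative. *)
  assert (E1 := circle_parts h h1 w r 3 (Dc_spec h Hh) (Dc_cont h Hh)).
  assert (E2 := circle_parts h1 h2 w r 2 (Dc_spec h1 H1) (Dc_cont h1 H1)).
  assert (E3 := circle_parts h2 h3 w r 1 (Dc_spec h2 H2) (Dc_cont h2 H2)).
  assert (E4 := circle_parts h3 h4 w r 0 (Dc_spec h3 H3) (Dc_cont h3 H3)).
  rewrite (CI_ext (fun t => (h4 (w + r * circ t) * icirc t ^ 0)%C) (fun t => h4 (w + r * circ t)%C)) in E4
    by (intros; simpl; ring).
  rewrite (mean_value h4 w r H4) in E4.
  set (I4 := CI (fun t => (h (w + r * circ t) * icirc t ^ 4)%C) 0 (2 * PI)) in *.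
  assert (EI : (24 * I4 = RtoC (r ^ 4) * (RtoC (2 * PI) * h4 w))%C).
  { replace (INR 4) with 4 in E1 by (simpl; lra). replace (INR 3) with 3 in E2 by (simpl; lra).
    replace (INR 2) with 2 in E3 by (simpl; lra). replace (INR 1) with 1 in E4 by (simpl; lra).
    transitivity (6 * (4 * I4))%C; [ring|]. rewrite E1.
    match type of E2 with (_ * ?X = _)%C => transitivity (2 * r * (3 * X))%C; [ring|] end. rewrite E2.
    match type of E3 with (_ * ?X = _)%C => transitivity (r * r * (2 * X))%C; [ring|] end. rewrite E3.
    match type of E4 with (_ * ?X = _)%C => transitivity (r * r * r * (1 * X))%C; [ring|] end. rewrite E4.
    rewrite RtoC_pow. ring. }
  assert (hc := holo_cont h Hh).
  assert (ch : forall t, contR (fun t => h (w + r * circ t)%C) t) by now apply contR_circle.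
  assert (J0 : CI (fun t => (h (w + r * circ t) * circ t ^ 4)%C) 0 (2 * PI) = 0%C).
  { assert (hq : holo (fun z => ((z - w) ^ 4 * h z)%C)).
    { holos. }
    pose proof (mean_value _ w r hq) as E. cbv beta in E.
    replace (RtoC (2 * PI) * ((w - w) ^ 4 * h w))%C with (RtoC 0) in E by ring.
    rewrite (CI_ext _ (fun t => (RtoC r ^ 4 * (h (w + r * circ t) * circ t ^ 4))%C)) in E
      by (intros; ring).
    rewrite CI_scal in E.
    - apply Cmult_integral in E. destruct E as [E|E]; [|easy].
      exfalso. apply Cpow_nz in E; [easy|]. apply RtoC_neq0. lra.
    - cts. }
  assert (J1 : CI (fun t => (Cconj (h (w + r * circ t)) * icirc t ^ 4)%C) 0 (2 * PI) = 0%C).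
  { rewrite (CI_ext _ (fun t => Cconj (h (w + r * circ t) * circ t ^ 4)%C)).
    - rewrite CI_conj, J0.
      + unfold Cconj. simpl. apply injective_projections; simpl; ring.
      + cts.
    - intros t. rewrite Cmult_conj, Cpow_conj, Cconj_circ. easy. }
  assert (EI2 : I4 = CI (fun t => (RtoC (2 * fst (h (w + r * circ t)%C)) * icirc t ^ 4)%C) 0 (2 * PI)).
  { transitivity (I4 + CI (fun t => (Cconj (h (w + r * circ t)) * icirc t ^ 4)%C) 0 (2 * PI))%C.
    - rewrite J1. ring.
    - unfold I4. rewrite <- CI_plus.
      + apply CI_ext. intros t. rewrite <- Cmult_plus_distr_r. f_equal.
        apply injective_projections; simpl; ring.
      + cts.
      + intros t. apply cont_mult; [now apply contR_conj|cts]. }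
  (* On the circle 1 + |z| <= 1 + |w| + r <= 2 r, hence the factor 8. *)
  set (B := K * (8 * r ^ 3)).
  assert (r3 : 0 < r ^ 3) by (apply pow_lt; lra).
  assert (B0 : 0 <= B) by (unfold B; nra).
  assert (HBc : forall t, fst (h (w + r * circ t)%C) <= B).
  { intros t. eapply Rle_trans; [apply HB|]. unfold B. apply Rmult_le_compat_l; [easy|].
    replace (8 * r ^ 3) with ((2 * r) ^ 3) by ring. apply pow_incr.
    pose proof (Cmod_ge_0 (w + r * circ t)). pose proof (Cmod_circle_pt w r t ltac:(lra)). lra. }
  assert (cf : forall t, continuous (fun t => fst (h (w + r * circ t)%C)) t).
  { intros t. apply (contR_components _ t (ch t)). }
  (* Since the real part is at most [B] and [B >= 0], the function [4 B - 2 Re h] dominates |2 Re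
     h|; unlike the absolute value, its integral is known from the mean value property. *)
  assert (cg : forall t, continuous (fun t => 4 * B - 2 * fst (h (w + r * circ t)%C)) t).
  { intros t. apply (continuous_minus (V := R_NormedModule)); [apply continuous_const|].
    apply (continuous_scal_r (V := R_NormedModule) 2). apply cf. }
  assert (BI : Cmod I4 <= 2 * RInt (fun t => 4 * B - 2 * fst (h (w + r * circ t)%C)) 0 (2 * PI)).
  { rewrite EI2. apply CI_bound_int; [lra| |easy|].
    - intros t. apply cont_mult; [|cts].
      apply contR_of_continuous. apply (continuous_scal_r (V := R_NormedModule) 2). apply cf.
    - intros t. rewrite Cmod_mult, Cmod_pow, Cmod_icirc, pow1, Rmult_1_r, Cmod_R.
      specialize (HBc t). apply Rabs_le. lra. }
  assert (ER : RInt (fun t => 4 * B - 2 * fst (h (w + r * circ t)%C)) 0 (2 * PI) =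
     2 * PI * (4 * B - 2 * fst (h w))).
  { rewrite (@RInt_minus R_CompleteNormedModule (fun _ => 4 * B) (fun t => 2 * fst (h (w + r * circ t)%C))).
    - rewrite RInt_const.
      assert (ES := @RInt_scal R_CompleteNormedModule (fun t => fst (h (w + r * circ t)%C)) 0 (2 * PI) 2
        (ex_RInt_fst (fun t => h (w + r * circ t)%C) _ _ ch)).
      change (RInt (fun t => 2 * fst (h (w + r * circ t)%C)) 0 (2 * PI) = 2 * RInt (fun t => fst (h (w + r * circ t)%C)) 0 (2 * PI)) in ES.
      rewrite ES. clear ES.
      pose proof (f_equal fst (mean_value h w r Hh)) as MV. unfold CI in MV. simpl in MV.
      change (@minus _ ?x ?y) with (x - y). change (@scal _ _ ?x ?y) with (x * y).
      rewrite MV. match goal with |- @eq _ ?a ?b => change (@eq R a b) end. ring.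
    - apply (@ex_RInt_const R_NormedModule).
    - apply (@ex_RInt_scal R_NormedModule). now apply (ex_RInt_fst (fun t => h (w + r * circ t)%C)). }
  rewrite ER in BI.
  apply (f_equal Cmod) in EI. rewrite !Cmod_mult, !Cmod_RtoC_pos in EI; try lra.
  2:{ apply pow_le; lra. }
  assert (F : fst (h w) >= - Cmod (h w)).
  { pose proof (fst_le_Cmod (h w)) as Q. apply Rabs_le_between in Q. lra. }
  assert (Q1 : r ^ 4 * (2 * PI * Cmod (h4 w)) <= 24 * (2 * (2 * PI * (4 * B + 2 * Cmod (h w))))) by nra.
  assert (Q2 : r ^ 4 * Cmod (h4 w) <= 24 * (2 * (4 * B + 2 * Cmod (h w)))) by nra.
  assert (Q3 : 24 * (2 * (4 * B + 2 * Cmod (h w))) <= r ^ 3 * (96 * (16 * K + Cmod (h w)))).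
  { unfold B. assert (1 <= r ^ 3) by (apply pow_R1_Rle; lra). pose proof (Cmod_ge_0 (h w)). nra. }
  apply Rmult_le_reg_l with (r ^ 3); [easy|]. simpl in Q2 |- *. simpl in Q3. lra.
Qed.

Lemma D_zero_affine h c : holo h -> (forall z, Dc h z = c) -> forall z, h z = (h 0 + c * z)%C.
Proof.
  intros Hh Hc z.
  assert (Hd : forall z, derC (fun z => (h z - c * z)%C) z 0%C).
  { intros y. eapply der_eq.
    - apply der_minus; [apply Dc_spec, Hh|]. apply der_scal, (der_emb (fun z : C => z)).
    - rewrite Hc. ring. }
  pose proof (der_zero_const _ Hd z 0%C) as E. cbv beta in E.
  transitivity (h z - c * z + c * z)%C; [ring|]. rewrite E. ring.
Qed.

Lemma primitive_unique h p P : holo h -> (forall z, Dc h z = p z) -> (forall z, derC P z (p z)) ->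
  forall z, h z = (P z + (h 0 - P 0))%C.
Proof.
  intros Hh Hp HP z.
  assert (Hd : forall z, derC (fun z => (h z - P z)%C) z 0%C).
  { intros y. eapply der_eq; [apply der_minus; [apply Dc_spec, Hh|apply HP]|].
    rewrite Hp. ring. }
  pose proof (der_zero_const _ Hd z 0%C) as E. cbv beta in E.
  transitivity (h z - P z + P z)%C; [ring|]. rewrite E. ring.
Qed.

Lemma D4_zero_cubic h : holo h -> (forall z, Dc (Dc (Dc (Dc h))) z = 0%C) ->
  exists a b c d : C, forall z, h z = (a + b * z + c * (z * z) + d * (z * z * z))%C.
Proof.
  intros Hh H4.
  assert (H1 := holo_Dc h Hh). assert (H2 := holo_Dc _ H1). assert (H3 := holo_Dc _ H2).
  pose proof (D_zero_affine _ _ H3 H4) as E3.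
  set (d0 := Dc (Dc (Dc h)) 0) in *.
  assert (E3' : forall z, Dc (Dc (Dc h)) z = d0) by (intros z; rewrite E3; ring).
  pose proof (D_zero_affine _ _ H2 E3') as E2. set (c0 := Dc (Dc h) 0) in *.
  assert (dz : forall z, derC (fun z : C => z) z 1) by (apply (der_emb (fun z : C => z))).
  pose proof (primitive_unique _ (fun z => (c0 + d0 * z)%C) (fun z => (c0 * z + d0 / 2 * (z * z))%C) H1 E2) as E1.
  lapply E1; clear E1.
  2:{ intros z. eapply der_eq.
      - apply der_plus; [apply der_scal, dz|]. apply der_scal. apply der_mult; apply dz.
      - simpl. field. }
  intros E1. set (b0 := Dc h 0) in *.
  pose proof (primitive_unique _ (fun z => (b0 + c0 * z + d0 / 2 * (z * z))%C)
    (fun z => (b0 * z + c0 / 2 * (z * z) + d0 / 6 * (z * z * z))%C) Hh) as E0.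
  lapply E0; clear E0.
  2:{ intros z. rewrite E1. ring. }
  intros E0. lapply E0; clear E0.
  2:{ intros z. eapply der_eq.
      - apply der_plus; [apply der_plus; [apply der_scal, dz|]|].
        + apply der_scal. apply der_mult; apply dz.
        + apply der_scal. apply der_mult; [apply der_mult; apply dz|apply dz].
      - simpl. field. }
  intros E0. exists (h 0), b0, (c0 / 2)%C, (d0 / 6)%C. intros z. rewrite E0. ring.
Qed.

(** Evenness of [E] only says that [g z - g (- z)] is a period of [cexp]. Differentiating the
    identity exp(2 b z + 2 d z^3) = 1 removes that ambiguity and gives 2 b + 6 d z^2 = 0 for all
    [z], hence b = d = 0. *)
Lemma even_zero_free_cubic_growth E K : holo E -> (forall z, E z <> 0%C) -> (forall z, E (- z)%C = E z) ->
  0 <= K -> (forall z, Cmod (E z) <= exp (K * (1 + Cmod z) ^ 3)) ->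
  exists alpha beta : C, forall z, E z = cexp (alpha * (z * z) + beta).
Proof.
  intros HE H0 Ev HK HB. destruct (holo_log E HE H0) as [g [Hg Eg]].
  assert (H4 := cubic_growth_D4 g K Hg HK).
  lapply H4; clear H4.
  2:{ intros z. specialize (HB z). rewrite Eg, Cmod_cexp in HB. apply Rnot_lt_le. intros Hl.
      apply exp_increasing in Hl. lra. }
  intros H4. destruct (D4_zero_cubic g Hg H4) as [a [b [c [d Eq]]]].
  assert (E1 : forall z, (cexp (2 * b * z + 2 * d * (z * z * z)) = 1)%C).
  { intros z. specialize (Ev z). rewrite !Eg, !Eq in Ev.
    transitivity (cexp (a + b * z + c * (z * z) + d * (z * z * z)) * cexp (- (a + b * - z + c * (- z * - z) + d * (- z * - z * - z))))%C.
    - rewrite <- cexp_plus. f_equal. ring.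
    - rewrite <- Ev. apply cexp_opp. }
  assert (dz : forall z, derC (fun z : C => z) z 1) by (apply (der_emb (fun z : C => z))).
  assert (E2 : forall z, (2 * b + 6 * d * (z * z) = 0)%C).
  { intros z.
    assert (A : derC (fun z => cexp (2 * b * z + 2 * d * (z * z * z))%C) z
       (cexp (2 * b * z + 2 * d * (z * z * z)) * (2 * b + 6 * d * (z * z)))%C).
    { eapply der_eq.
      - apply (der_comp (fun z : C => z) cexp (fun z => (2 * b * z + 2 * d * (z * z * z))%C)); [apply derC_cexp|].
        apply der_plus; [apply der_scal, dz|]. apply der_scal.
        apply der_mult; [apply der_mult; apply dz|apply dz].
      - simpl. ring. }
    assert (B : derC (fun z => cexp (2 * b * z + 2 * d * (z * z * z))%C) z 0).
    { eapply der_ext; [intros y; symmetry; apply E1|]. apply der_const. }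
    pose proof (derC_unique _ _ _ _ A B) as Q. rewrite E1 in Q. now rewrite Cmult_1_l in Q. }
  assert (Eb : b = 0%C).
  { pose proof (E2 0%C) as Q. transitivity (/ 2 * (2 * b + 6 * d * (0 * 0)))%C; [field|]. rewrite Q. ring. }
  assert (Ed : d = 0%C).
  { pose proof (E2 1%C) as Q. rewrite Eb in Q.
    transitivity (/ 6 * (2 * 0 + 6 * d * (1 * 1)))%C; [field|]. rewrite Q. ring. }
  exists c, a. intros z. rewrite Eg, Eq, Eb, Ed. f_equal. ring.
Qed.

(** * Zero set and growth of solutions *)

(* Weierstrass' equation in [a, b, c, d] at [d = 0]. *)
Definition three_term (f : C -> C) : Prop := forall a b c : C,
  (f (a + b) * f (a - b) * (f c * f c) =
   f a * f a * (f (b + c) * f (c - b)) + f (a + c) * f (a - c) * (f b * f b))%C.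

Definition sigma_like (f : C -> C) : Prop :=
  holo f /\ (forall z, f (- z)%C = (- f z)%C) /\ (exists z, f z <> 0%C) /\ three_term f.

Lemma cont_zero_at0 (H : C -> C) : contC H 0 -> (forall t : C, t <> 0%C -> H t = 0%C) -> H 0%C = 0%C.
Proof.
  intros Hc H0. apply NNPP. intros Hn. destruct (cont_away0 _ _ _ Hc Hn) as [d [Hd Hd']].
  specialize (Hd' (RtoC (d / 2))). rewrite (H0 (RtoC (d / 2))), Cmod_0 in Hd' by (apply RtoC_neq0; lra).
  apply Cmod_gt_0 in Hn. assert (Cmod (H 0%C) / 2 <= 0); [|lra]. apply Hd'.
  replace (RtoC (d / 2) - 0)%C with (RtoC (d / 2)) by ring. rewrite Cmod_RtoC_pos; lra.
Qed.

Lemma odd_zero f : (forall z, f (- z)%C = (- f z)%C) -> f 0%C = 0%C.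
Proof.
  intros H. specialize (H 0%C). replace (- 0)%C with (RtoC 0) in H by ring.
  transitivity (/ 2 * (f 0 - - f 0))%C; [field|]. rewrite <- H. ring.
Qed.

Lemma power_sum_5_27_32 n : 5 ^ n + 27 ^ n = 32 ^ n -> n = 1%nat.
Proof.
  destruct n as [|[|n]]; [simpl; lra|easy|]. intros H. exfalso.
  assert (K : 5 ^ S (S n) + 27 ^ S (S n) < 32 ^ S (S n)); [|lra]. clear H.
  induction n as [|n IH]; [simpl; lra|].
  assert (0 < 5 ^ S (S n)) by (apply pow_lt; lra). assert (0 < 27 ^ S (S n)) by (apply pow_lt; lra).
  change (5 * 5 ^ S (S n) + 27 * 27 ^ S (S n) < 32 * 32 ^ S (S n)). lra.
Qed.

(* With [a, b, c = 3t, 2t, t], comparing terms of lowest order [n] at [t = 0] in the three-term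
   equation yields [5^n + 27^n = 32^n]. *)
Lemma sigma_like_D0 f : sigma_like f -> Dc f 0 <> 0%C.
Proof.
  intros [Hf [Ho [Hz HW]]]. destruct (holo_order f 0 Hf Hz) as [n [g [Hg [Eg Hg0]]]].
  assert (gc := holo_cont g Hg).
  assert (Eg' : forall z, f z = (z ^ n * g z)%C).
  { intros z. rewrite Eg. f_equal. f_equal. ring. }
  (* The three-term equation divided by t^(4 n); continuity extends it to [t = 0], where it becomes
     a numerical equation times (g 0)^4. *)
  set (H := fun t => (RtoC (5 ^ n) * (g (5 * t) * (g t * g t * g t)) + RtoC (27 ^ n) * (g (3 * t) * g (3 * t) * g (3 * t) * g t)
     - RtoC (32 ^ n) * (g (4 * t) * (g (2 * t) * g (2 * t) * g (2 * t))))%C).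
  assert (cm : forall k : R, contC (fun t => g (k * t)%C) 0).
  { cts. }
  assert (H0 : H 0%C = 0%C).
  { apply cont_zero_at0.
    - unfold H. cts.
    - intros t Ht. specialize (HW (3 * t)%C (2 * t)%C t).
      replace (3 * t + 2 * t)%C with (5 * t)%C in HW by ring.
      replace (3 * t - 2 * t)%C with t in HW by ring.
      replace (2 * t + t)%C with (3 * t)%C in HW by ring.
      replace (t - 2 * t)%C with (- t)%C in HW by ring.
      replace (3 * t + t)%C with (4 * t)%C in HW by ring.
      replace (3 * t - t)%C with (2 * t)%C in HW by ring.
      rewrite Ho, !Eg', !Cpow_mult_l in HW.
      assert (Hp : (t ^ n <> 0)%C) by now apply Cpow_nz.
      assert (Hp4 : (t ^ n * t ^ n * t ^ n * t ^ n <> 0)%C).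
      { intros E. repeat (apply Cmult_integral in E; destruct E as [E|E]; try easy). }
      assert (E : (t ^ n * t ^ n * t ^ n * t ^ n * H t = 0)%C).
      { unfold H.
        replace 27 with (3 * 3 * 3) by lra. replace 32 with (4 * 2 * 2 * 2) by lra.
        rewrite !Rpow_mult_distr, !RtoC_mult, !RtoC_pow.
        match type of HW with ?l = ?r => transitivity (l - r)%C; [ring|rewrite HW; ring] end. }
      apply Cmult_integral in E. tauto. }
  unfold H in H0. rewrite !Cmult_0_r in H0.
  assert (E : (RtoC (5 ^ n + 27 ^ n - 32 ^ n) * (g 0 * g 0 * g 0 * g 0) = 0)%C).
  { rewrite RtoC_minus, RtoC_plus. match type of H0 with ?l = _ => transitivity l; [ring|exact H0] end. }
  apply Cmult_integral in E. destruct E as [E|E].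
  2:{ exfalso. repeat (apply Cmult_integral in E; destruct E as [E|E]; try easy). }
  apply RtoC_inj in E. assert (n = 1%nat) by (apply power_sum_5_27_32; lra). subst n.
  assert (E1 : Dc f 0 = g 0%C).
  { apply Dc_unique. apply der_ext with (fun z => (z * g z)%C).
    - intros z. rewrite Eg'. simpl. ring.
    - eapply der_eq; [apply der_mult; [apply (der_emb (fun z : C => z))|now apply Dc_spec]|]. simpl. ring. }
  now rewrite E1.
Qed.

(** With [b = w] the term containing [f b] drops out, and [c] is any point with [f c <> 0]. If [k]
    were 0, the product of two translates of [f] would vanish identically, which [holo_mult_zero]
    excludes. *)
Lemma sigma_like_shift f w : sigma_like f -> f w = 0%C ->
  exists k : C, k <> 0%C /\ forall a, (f (a + w) * f (a - w) = k * (f a * f a))%C.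
Proof.
  intros [Hf [Ho [[c Hc] HW]]] Hw.
  assert (E : forall a, (f (a + w) * f (a - w) = f (w + c) * f (c - w) / (f c * f c) * (f a * f a))%C).
  { intros a. specialize (HW a w c). rewrite Hw in HW.
    transitivity (f (a + w) * f (a - w) * (f c * f c) / (f c * f c))%C; [field; auto|].
    rewrite HW. field. auto. }
  exists (f (w + c) * f (c - w) / (f c * f c))%C. split; [|easy].
  intros Hk.
  assert (Hm : forall a, (f (a + w) * f (a - w) = 0)%C) by (intros a; rewrite E, Hk; ring).
  assert (Z : forall z, f (z - w)%C = 0%C).
  { apply (holo_mult_zero (fun z => f (z + w)%C)).
    - holos.
    - holos.
    - easy.
    - exists (c - w)%C. now replace (c - w + w)%C with c by ring. }
  apply Hc. replace c with (c + w - w)%C by ring. apply Z.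
Qed.

(** The shift equation at [a + w] reads f(a + 2 w) f(a) = k f(a + w)^2 with [k <> 0]. *)
Lemma sigma_like_zeros_add f w a : sigma_like f -> f w = 0%C -> f a = 0%C -> f (a + w)%C = 0%C.
Proof.
  intros Hs Hw Ha. destruct (sigma_like_shift f w Hs Hw) as [k [Hk E]].
  specialize (E (a + w)%C). replace (a + w - w)%C with a in E by ring.
  rewrite Ha, Cmult_0_r in E. symmetry in E.
  apply Cmult_integral in E. destruct E as [E|E]; [easy|].
  apply Cmult_integral in E. tauto.
Qed.

Lemma sigma_like_zeros_opp f w : sigma_like f -> f w = 0%C -> f (- w)%C = 0%C.
Proof. intros [_ [Ho _]] H. rewrite Ho, H. ring. Qed.

(** Dividing the shift equation at [t] by t^2 and letting [t] tend to 0 gives f'(w) f'(-w) = k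
    f'(0)^2, and the right side is nonzero by [sigma_like_D0]. *)
Lemma sigma_like_D_zero f w : sigma_like f -> f w = 0%C -> Dc f w <> 0%C.
Proof.
  intros Hs Hw. assert (Hw' := sigma_like_zeros_opp f w Hs Hw).
  destruct (sigma_like_shift f w Hs Hw) as [k [Hk E]].
  assert (D0 := sigma_like_D0 f Hs). destruct Hs as [Hf [Ho _]].
  assert (f0 := odd_zero f Ho).
  destruct (holo_divide f w Hf Hw) as [p [Hp [Ep Dp]]].
  destruct (holo_divide f (- w)%C Hf Hw') as [q [Hq [Eq Dq]]].
  destruct (holo_divide f 0%C Hf f0) as [g [Hg [Eg Dg]]].
  set (H := fun t => (p (t + w) * q (t - w) - k * (g t * g t))%C).
  assert (H0 : H 0%C = 0%C).
  { apply cont_zero_at0.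
    - unfold H. cts.
    - intros t Ht. specialize (E t). rewrite (Ep (t + w)%C), (Eq (t - w)%C), (Eg t) in E.
      assert (E' : (t * t * H t = 0)%C).
      { unfold H. match type of E with ?l = ?r => transitivity (l - r)%C; [ring|rewrite E; ring] end. }
      apply Cmult_integral in E'. destruct E' as [E'|E']; [|easy].
      apply Cmult_integral in E'. tauto. }
  intros Dw. unfold H in H0. replace (0 + w)%C with w in H0 by ring. rewrite Dp, Dw, Dg in H0.
  assert (E' : (k * (Dc f 0 * Dc f 0) = 0)%C).
  { match type of H0 with ?l = _ => transitivity (- l)%C; [ring|rewrite H0; ring] end. }
  repeat (apply Cmult_integral in E'; destruct E' as [E'|E']; try easy).
Qed.

Lemma sigma_like_zeros_discrete f : sigma_like f ->
  exists d, 0 < d /\ forall w, f w = 0%C -> w <> 0%C -> d <= Cmod w.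
Proof.
  intros Hs. assert (D0 := sigma_like_D0 f Hs). destruct Hs as [Hf [Ho _]].
  destruct (holo_divide f 0%C Hf (odd_zero f Ho)) as [g [Hg [Eg Dg]]].
  rewrite <- Dg in D0. destruct (cont_away0 _ _ _ (holo_cont g Hg 0%C) D0) as [d [Hd H]].
  exists d. split; [easy|]. intros w Hw Hw0. apply Rnot_lt_le. intros Hl.
  specialize (H w). replace (w - 0)%C with w in H by ring. specialize (H Hl).
  rewrite Eg in Hw. apply Cmult_integral in Hw. destruct Hw as [Hw|Hw].
  - apply Hw0. rewrite <- Hw. ring.
  - rewrite Hw, Cmod_0 in H. apply Cmod_gt_0 in D0. lra.
Qed.

Lemma dyadic_bracket x : 0 <= x -> exists k, x <= 2 ^ k <= 2 * (1 + x).
Proof.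
  intros Hx.
  assert (K : forall N, x <= 2 ^ N -> exists k, x <= 2 ^ k <= 2 * (1 + x)).
  { induction N as [|N IH]; intros HN.
    - exists 0%nat. simpl in *. lra.
    - destruct (Rle_dec x (2 ^ N)); [auto|]. exists (S N). simpl in *. lra. }
  destruct (Pow_x_infinity 2) with (b := x) as [N HN].
  - rewrite Rabs_pos_eq; lra.
  - apply (K N). specialize (HN N ltac:(lia)). rewrite Rabs_pos_eq in HN by (apply pow_le; lra). lra.
Qed.

(* The three-term equation bounds [f u] by the fourth power of the maximum of [|f|] on a disc of
   radius [|u|/2 + const], hence [f] has order at most two. *)
Lemma sigma_like_growth f : sigma_like f ->
  exists A, 0 <= A /\ forall z, Cmod (f z) <= exp (A * (1 + Cmod z) ^ 3).
Proof.
  intros [Hf [Ho [[c Hc] HW]]].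
  set (m := Cmod c). assert (m0 : 0 <= m) by apply Cmod_ge_0.
  set (Q := Cmod (f c) * (Cmod (f c) * Cmod (f c))).
  assert (HQ : 0 < Q) by (apply Cmod_gt_0 in Hc; unfold Q; repeat apply Rmult_lt_0_compat; easy).
  set (c0 := 2 / Q). assert (Hc0 : 0 < c0) by (apply Rdiv_lt_0_compat; lra).
  destruct (bounded_disc f (1 + 3 * m) (holo_cont f Hf)) as [M [HM0 HM]].
  set (X := M + c0).
  (* Both offsets make the induction close. Arguments of modulus at most 2^(k+1) + 3 m lead to [a],
     [b] within 2^k + 2 m, and adding [c] reaches 2^k + 3 m. In the exponent, c0 + 4 (4^k X - c0) <=
     4^(k+1) X - c0, where c0 <= exp c0 accounts for the constant factor. *)
  assert (K : forall k z, Cmod z <= 2 ^ k + 3 * m -> Cmod (f z) <= exp (4 ^ k * X - c0)).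
  { induction k as [|k IH]; intros z Hz.
    - simpl in *. eapply Rle_trans; [apply HM; lra|]. unfold X.
      replace (1 * (M + c0) - c0) with M by ring. pose proof (exp_ineq1_le M). lra.
    (* Chosen so that a + b = z and a - b = c: the left side becomes f(z) f(c)^3. *)
    - set (a := ((z + c) / 2)%C). set (b := ((z - c) / 2)%C).
      specialize (HW a b c).
      replace (a + b)%C with z in HW by (unfold a, b; field).
      replace (a - b)%C with c in HW by (unfold a, b; field).
      assert (h2 : forall y : C, Cmod (y / 2) = Cmod y / 2).
      { intros y. rewrite Cmod_div by (apply RtoC_neq0; lra). now rewrite Cmod_RtoC_pos by lra. }
      assert (Ba : Cmod a <= 2 ^ k + 2 * m).
      { unfold a. rewrite h2. pose proof (Cmod_triangle z c). fold m in H. simpl pow in Hz. lra. }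
      assert (Bb : Cmod b <= 2 ^ k + 2 * m).
      { unfold b. rewrite h2. pose proof (Cmod_le_add z c). fold m in H. simpl pow in Hz. lra. }
      set (L := exp (4 ^ k * X - c0)) in *.
      assert (B1 : Cmod (f a) <= L) by (apply IH; lra).
      assert (B2 : Cmod (f b) <= L) by (apply IH; lra).
      assert (B3 : Cmod (f (b + c)%C) <= L) by (apply IH; pose proof (Cmod_triangle b c); fold m in H; lra).
      assert (B4 : Cmod (f (c - b)%C) <= L) by (apply IH; pose proof (Cmod_le_add c b); fold m in H; lra).
      assert (B5 : Cmod (f (a + c)%C) <= L) by (apply IH; pose proof (Cmod_triangle a c); fold m in H; lra).
      assert (B6 : Cmod (f (a - c)%C) <= L) by (apply IH; pose proof (Cmod_le_add a c); fold m in H; lra).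
      assert (HL : 0 <= L) by (apply Rlt_le, exp_pos).
      assert (P : forall w x y v : C, Cmod w <= L -> Cmod x <= L -> Cmod y <= L -> Cmod v <= L ->
        Cmod (w * x * (y * v)) <= L * L * (L * L)).
      { intros w x y v Hw Hx Hy Hv. rewrite !Cmod_mult.
        pose proof (Cmod_ge_0 w). pose proof (Cmod_ge_0 x). pose proof (Cmod_ge_0 y). pose proof (Cmod_ge_0 v).
        apply Rmult_le_compat; try (apply Rmult_le_pos; easy); apply Rmult_le_compat; easy. }
      assert (T : Cmod (f z) * Q <= 2 * (L * L * (L * L))).
      { unfold Q. rewrite <- !Cmod_mult. rewrite Cmult_assoc in HW |- *.
        replace (f z * (f c * (f c * f c)))%C with (f z * f c * f c * f c)%C by ring.
        rewrite Cmult_assoc. rewrite HW. eapply Rle_trans; [apply Cmod_triangle|].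
        pose proof (P _ _ _ _ B1 B1 B3 B4). pose proof (P _ _ _ _ B5 B6 B2 B2). lra. }
      assert (T' : Cmod (f z) <= c0 * (L * L * (L * L))).
      { unfold c0. replace (2 / Q * (L * L * (L * L))) with (2 * (L * L * (L * L)) / Q) by (field; lra).
        apply Rle_div_r; lra. }
      eapply Rle_trans; [exact T'|].
      assert (c0 <= exp c0) by (pose proof (exp_ineq1_le c0); lra).
      apply Rle_trans with (exp c0 * (L * L * (L * L))).
      { apply Rmult_le_compat_r; [repeat apply Rmult_le_pos; easy|easy]. }
      unfold L. rewrite <- !exp_plus. apply Rnot_lt_le. intros Hl. apply exp_lt_inv in Hl.
      simpl pow in Hl. lra. }
  exists (4 * X). assert (HX : 0 <= X) by (unfold X; lra). split; [lra|]. intros z.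
  pose proof (Cmod_ge_0 z) as Z0. destruct (dyadic_bracket (Cmod z) Z0) as [k [Hk1 Hk2]].
  eapply Rle_trans; [apply (K k); lra|].
  apply Rnot_lt_le. intros Hl. apply exp_lt_inv in Hl.
  assert (E4 : 4 ^ k = 2 ^ k * 2 ^ k) by (rewrite <- Rpow_mult_distr; f_equal; lra).
  assert (H2k : 0 < 2 ^ k) by (apply pow_lt; lra).
  assert (S4 : 4 ^ k <= 4 * (1 + Cmod z) ^ 3).
  { rewrite E4. apply Rle_trans with ((2 * (1 + Cmod z)) * (2 * (1 + Cmod z))).
    - apply Rmult_le_compat; lra.
    - simpl. assert (1 <= 1 + Cmod z) by lra. nra. }
  assert (4 ^ k * X <= 4 * (1 + Cmod z) ^ 3 * X) by (apply Rmult_le_compat_r; easy). lra.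
Qed.

Lemma exp_le_compat x y : x <= y -> exp x <= exp y.
Proof. intros [H| ->]; [left; now apply exp_increasing|lra]. Qed.

Lemma le_exp x : x <= exp x.
Proof. pose proof (exp_ineq1_le x). lra. Qed.

Lemma one_le_cube x : 0 <= x -> 1 <= (1 + x) ^ 3.
Proof. intros. apply pow_R1_Rle. lra. Qed.

Lemma rank0_case f : sigma_like f -> (forall z, f z = 0%C -> z = 0%C) ->
  exists alpha beta : C, forall z, f z = (z * cexp (alpha * (z * z) + beta))%C.
Proof.
  intros Hs Hz. destruct (sigma_like_growth f Hs) as [A [HA Gr]].
  assert (D0 := sigma_like_D0 f Hs). destruct Hs as [Hf [Ho _]].
  destruct (holo_divide f 0%C Hf (odd_zero f Ho)) as [g [Hg [Eg Dg]]].
  assert (Eg' : forall z, f z = (z * g z)%C) by (intros z; rewrite Eg; ring).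
  destruct (bounded_disc g 1 (holo_cont g Hg)) as [M [HM0 HM]].
  assert (g0 : forall z, g z <> 0%C).
  { intros z H. destruct (classic (z = 0%C)) as [-> | Hz0]; [congruence|].
    apply Hz0, Hz. rewrite Eg', H. ring. }
  destruct (even_zero_free_cubic_growth g (A + M) Hg g0) as [al [be E]].
  - intros z. destruct (classic (z = 0%C)) as [-> | Hz0]; [f_equal; ring|].
    specialize (Ho z). rewrite !Eg' in Ho.
    assert (Q : (z * (g (- z) - g z) = 0)%C).
    { match type of Ho with ?l = ?r => transitivity (r - l)%C; [ring|rewrite Ho; ring] end. }
    apply Cmult_integral in Q. destruct Q as [Q|Q]; [easy|]. now apply Cminus_eq0.
  - lra.
  - intros z. pose proof (Cmod_ge_0 z) as Z0. pose proof (one_le_cube _ Z0).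
    (* In the unit disc [g] is bounded by [M]; outside it |g z| <= |f z|. *)
    destruct (Rle_dec (Cmod z) 1) as [H1|H1].
    + eapply Rle_trans; [now apply HM|]. eapply Rle_trans; [apply le_exp|]. apply exp_le_compat. nra.
    + apply Rle_trans with (Cmod (f z)).
      * rewrite Eg', Cmod_mult. pose proof (Cmod_ge_0 (g z)). nra.
      * eapply Rle_trans; [apply Gr|]. apply exp_le_compat. nra.
  - exists al, be. intros z. rewrite Eg', E. ring.
Qed.

(** * Solutions with a cyclic zero set *)

Lemma nearest_integer (x : R) : exists n : Z, Rabs (x - IZR n) <= 1 / 2.
Proof.
  exists (up (x - 1 / 2)). destruct (archimed (x - 1 / 2)). apply Rabs_le. lra.
Qed.

(** Here x <= pi / 2 <= 2, so the Taylor bound x - x^3 / 6 is at least x (1 - 4/6). *)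
Lemma sin_ge_third x : 0 <= x <= PI / 2 -> x / 3 <= sin x.
Proof.
  intros Hx. pose proof PI_4 as P4. pose proof PI_RGT_0 as P0.
  destruct (sin_bound x 0 ltac:(lra) ltac:(lra)) as [H _].
  unfold sin_approx, sin_term in H. simpl in H.
  eapply Rle_trans; [|exact H].
  assert (x * x <= 4) by nra. nra.
Qed.

Lemma sin_abs_ge x n : Rabs (x - IZR n * PI) <= PI / 2 -> Rabs (x - IZR n * PI) / 3 <= Rabs (sin x).
Proof.
  intros H. set (y := x - IZR n * PI) in *.
  assert (E : sin y * sin y = sin x * sin x).
  { unfold y. rewrite sin_minus.
    assert (S : sin (IZR n * PI) = 0) by (apply sin_eq_0_1; now exists n).
    pose proof (sin2_cos2 (IZR n * PI)) as C. unfold Rsqr in C. rewrite S in *.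
    transitivity (sin x * sin x * (cos (IZR n * PI) * cos (IZR n * PI))); [ring|].
    replace (cos (IZR n * PI) * cos (IZR n * PI)) with 1 by lra. ring. }
  assert (E' : Rabs (sin x) = Rabs (sin y)).
  { apply Rsqr_eq_abs_0. unfold Rsqr. lra. }
  rewrite E'. destruct (Rle_dec 0 y) as [Hy|Hy].
  - rewrite Rabs_pos_eq in * by easy. eapply Rle_trans; [now apply sin_ge_third|apply Rle_abs].
  - rewrite Rabs_left in * by lra. rewrite <- Rabs_Ropp, <- sin_neg.
    eapply Rle_trans; [apply sin_ge_third; lra|apply Rle_abs].
Qed.

Lemma csin_components (x y : R) :
  (cexp (Ci * (x, y)) - cexp (- (Ci * (x, y))))%C =
  ((exp (- y) - exp y) * cos x, (exp (- y) + exp y) * sin x).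
Proof.
  unfold cexp. simpl.
  replace (0 * x - 1 * y) with (- y) by ring. replace (0 * y + 1 * x) with x by ring.
  rewrite Ropp_involutive, cos_neg, sin_neg. apply injective_projections; simpl; ring.
Qed.

Lemma Cmod_csin (w : C) : Cmod (csin w) = Cmod (cexp (Ci * w) - cexp (- (Ci * w))) / 2.
Proof.
  unfold csin. assert (H2 : RtoC 2 <> 0%C) by (apply RtoC_neq0; lra).
  assert (HI : (2 * Ci <> 0)%C).
  { intros E. apply (f_equal Cmod) in E. rewrite Cmod_mult, Cmod_Ci, Cmod_RtoC_pos, Cmod_0 in E; lra. }
  rewrite Cmod_div, Cmod_mult, Cmod_Ci, Cmod_RtoC_pos by (easy || lra).
  f_equal. ring.
Qed.

(** With w = x + i y, |2 sin w|^2 = (e^y - e^(-y))^2 + 4 sin^2 x controls both coordinates of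
    [w - n pi]. This one estimate will locate the zeros of the sine, show that they are simple, and
    bound the sine from below away from them. *)
Lemma csin_lower_bound (w : C) n : Rabs (fst w - IZR n * PI) <= PI / 2 ->
  Cmod (w - RtoC (IZR n * PI)) / 6 <= Cmod (csin w).
Proof.
  destruct w as [x y]. intros H. simpl in H. rewrite Cmod_csin, csin_components.
  set (d := ((exp (- y) - exp y) * cos x, (exp (- y) + exp y) * sin x) : C).
  assert (Ed : Cmod d * Cmod d = (exp y - exp (- y)) * (exp y - exp (- y)) + 4 * (sin x * sin x)).
  { unfold Cmod. rewrite sqrt_sqrt by (apply Rplus_le_le_0_compat; apply pow2_ge_0). simpl.
    pose proof (sin2_cos2 x) as C. unfold Rsqr in C.
    assert (E1 : exp y * exp (- y) = 1) by (rewrite <- exp_plus, Rplus_opp_r; apply exp_0).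
    set (p := exp y) in *. set (q := exp (- y)) in *.
    transitivity ((p - q) * (p - q) * (sin x * sin x + cos x * cos x) + 4 * (p * q) * (sin x * sin x)); [ring|].
    rewrite C, E1. ring. }
  pose proof (Cmod_ge_0 d) as D0.
  assert (Kx : 2 * Rabs (sin x) <= Cmod d).
  { apply Rsqr_incr_0_var; [|easy]. unfold Rsqr. rewrite Ed.
    replace (2 * Rabs (sin x) * (2 * Rabs (sin x))) with (4 * (Rabs (sin x) * Rabs (sin x))) by ring.
    rewrite <- Rabs_mult, Rabs_pos_eq by apply Rle_0_sqr.
    pose proof (Rle_0_sqr (exp y - exp (- y))) as Q. unfold Rsqr in Q. lra. }
  assert (Ky : Rabs y <= Cmod d).
  { apply Rsqr_incr_0_var; [|easy]. unfold Rsqr. rewrite Ed, <- Rabs_mult, Rabs_pos_eq by apply Rle_0_sqr.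
    pose proof (Rle_0_sqr (sin x)) as Q. unfold Rsqr in Q.
    assert (A : forall t, 0 <= t -> t <= exp t - exp (- t)).
    { intros t Ht. pose proof (exp_ineq1_le t). pose proof (exp_le_compat (- t) 0 ltac:(lra)) as Q1.
      rewrite exp_0 in Q1. lra. }
    destruct (Rle_dec 0 y) as [Hy|Hy].
    - specialize (A y Hy). nra.
    - specialize (A (- y) ltac:(lra)). rewrite Ropp_involutive in A. nra. }
  pose proof (sin_abs_ge x n H) as Kn.
  apply Rle_trans with (2 * Rmax (Rabs (x - IZR n * PI)) (Rabs y) / 6).
  - apply Rmult_le_compat_r; [lra|]. apply Cmod_le_2max; simpl.
    + apply Rmax_l.
    + rewrite Ropp_0, Rplus_0_r. apply Rmax_r.
  - apply Rmax_case; lra.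
Qed.

Lemma csin_zero n : csin (RtoC (IZR n * PI)) = 0%C.
Proof.
  apply Cmod_eq_0. rewrite Cmod_csin. unfold RtoC at 1 2. rewrite csin_components.
  assert (S : sin (IZR n * PI) = 0) by (apply sin_eq_0_1; now exists n).
  rewrite S, Ropp_0. replace ((exp 0 - exp 0) * cos (IZR n * PI), (exp 0 + exp 0) * 0) with (RtoC 0).
  - rewrite Cmod_0. lra.
  - apply injective_projections; simpl; ring.
Qed.

Lemma holo_csin : holo csin.
Proof.
  unfold csin. holos.
Qed.

Lemma csin_odd z : csin (- z) = (- csin z)%C.
Proof.
  unfold csin. replace (Ci * - z)%C with (- (Ci * z))%C by ring.
  replace (- - (Ci * z))%C with (Ci * z)%C by ring. unfold Cdiv. ring.
Qed.

Lemma derC_neq0 s z (l : C) c r : derC s z l -> s z = 0%C -> 0 < c -> 0 < r ->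
  (forall y, Cmod (y - z) < r -> c * Cmod (y - z) <= Cmod (s y)) -> l <> 0%C.
Proof.
  intros Hd Hz Hc Hr H El. destruct (derC_eps s z l Hd (c / 2) ltac:(lra)) as [d [Hd0 K]].
  set (e := Rmin r d / 2). assert (He : 0 < Rmin r d) by now apply Rmin_pos.
  pose proof (Rmin_l r d). pose proof (Rmin_r r d).
  assert (Hy : Cmod (z + RtoC e - z) = e).
  { replace (z + e - z)%C with (RtoC e) by ring. apply Cmod_RtoC_pos. unfold e; lra. }
  specialize (H (z + RtoC e)%C ltac:(rewrite Hy; unfold e; lra)).
  specialize (K (z + RtoC e)%C ltac:(rewrite Hy; unfold e; lra)).
  rewrite El, Hz in K. replace (s (z + e) - 0 - 0 * (z + e - z))%C with (s (z + e))%C in K by ring.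
  rewrite Hy in *. assert (0 < e) by (unfold e; lra). nra.
Qed.

(** At a zero [z] of [s] the quotient takes the value f'(z) / s'(z). Near it, dividing numerator and
    denominator by [y - z] leaves entire functions [p] and [q] with [q z <> 0]. *)
Lemma holo_quotient f s : holo f -> holo s ->
  (forall z, s z = 0%C -> f z = 0%C /\ Dc s z <> 0%C) ->
  exists E, holo E /\ forall z, f z = (s z * E z)%C.
Proof.
  intros Hf Hs H.
  exists (fun z => if excluded_middle_informative (s z = 0%C) then (Dc f z / Dc s z)%C else (f z / s z)%C).
  split.
  - intros z. destruct (classic (s z = 0%C)) as [Hz|Hz].
    + destruct (H z Hz) as [Fz Dz].
      destruct (holo_divide f z Hf Fz) as [p [Hp [Ep Dp]]].
      destruct (holo_divide s z Hs Hz) as [q [Hq [Eq Dq]]].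
      rewrite <- Dq in Dz.
      destruct (cont_away0 _ _ _ (holo_cont q Hq z) Dz) as [d [Hd Kd]].
      destruct (Hp z) as [lp Hlp]. destruct (Hq z) as [lq Hlq]. eexists.
      apply derC_local with (f := fun y => (p y * / q y)%C) (d := d); [easy| |].
      * intros y Hy. specialize (Kd y Hy). apply Cmod_gt_0 in Dz as Dz'.
        assert (qy : q y <> 0%C) by (apply Cmod_gt_0; lra).
        destruct (excluded_middle_informative (s y = 0%C)) as [Sy|Sy].
        -- rewrite Eq in Sy. apply Cmult_integral in Sy. destruct Sy as [Sy|Sy]; [|easy].
           apply Cminus_eq0 in Sy. subst y. rewrite Dp, Dq. reflexivity.
        -- rewrite Ep, Eq. rewrite Eq in Sy.
           assert ((y - z)%C <> 0%C) by (intros E; apply Sy; rewrite E; ring).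
           field. auto.
      * apply der_mult; [exact Hlp|]. apply der_inv; [exact Hlq|easy].
    + destruct (cont_away0 _ _ _ (holo_cont s Hs z) Hz) as [d [Hd Kd]].
      destruct (Hf z) as [lp Hlp]. destruct (Hs z) as [lq Hlq]. eexists.
      apply derC_local with (f := fun y => (f y * / s y)%C) (d := d); [easy| |].
      * intros y Hy. specialize (Kd y Hy). apply Cmod_gt_0 in Hz as Hz'.
        destruct (excluded_middle_informative (s y = 0%C)) as [Sy|Sy]; [|easy].
        rewrite Sy, Cmod_0 in Kd. lra.
      * apply der_mult; [exact Hlp|]. apply der_inv; [exact Hlq|easy].
  - intros z. destruct (excluded_middle_informative (s z = 0%C)) as [Sz|Sz].
    + destruct (H z Sz) as [Fz _]. rewrite Fz, Sz. ring.
    + field. easy.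
Qed.

(** A common zero of [s] and [E] would be a multiple zero of [f]. *)
Lemma quotient_zero_free f s E : holo s -> holo E -> (forall z, f z = (s z * E z)%C) ->
  (forall z, f z = 0%C -> Dc f z <> 0%C) -> forall z, f z = 0%C -> s z = 0%C -> E z <> 0%C.
Proof.
  intros Hs HE Ef HD z Fz Sz Ez. apply (HD z Fz). apply Dc_unique.
  apply der_ext with (fun z => (s z * E z)%C); [intros; now rewrite Ef|].
  eapply der_eq; [apply der_mult; now apply Dc_spec|]. rewrite Sz, Ez. ring.
Qed.

Lemma quotient_even f s E : holo s -> holo E -> (forall z, f z = (s z * E z)%C) ->
  (forall z, f (- z)%C = (- f z)%C) -> (forall z, s (- z)%C = (- s z)%C) ->
  (exists z, s z <> 0%C) -> forall z, E (- z)%C = E z.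
Proof.
  intros Hs HE Ef Of Os Nz z. apply Cminus_eq0.
  apply (holo_mult_zero s (fun z => (E (- z) - E z)%C)); auto.
  - holos.
  - intros y. specialize (Of y). rewrite !Ef, Os in Of.
    match type of Of with ?l = ?r => transitivity (r - l)%C; [ring|rewrite Of; ring] end.
Qed.

(** The comparison function is sin(pi z / w), which vanishes exactly on the multiples of [w]. The
    quotient inherits the growth of [f] where the sine is bounded below; near a zero it is bounded
    through its values on a surrounding circle. *)
Lemma rank1_case f (w : C) : sigma_like f -> w <> 0%C ->
  (forall z, f z = 0%C <-> exists n : Z, z = (RtoC (IZR n) * w)%C) ->
  exists a alpha beta : C, a <> 0%C /\
    forall z, f z = (csin (a * z) * cexp (alpha * (z * z) + beta))%C.
Proof.
  intros Hs Hw Hz. destruct (sigma_like_growth f Hs) as [A [HA Gr]].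
  assert (HD := fun z => sigma_like_D_zero f z Hs). destruct Hs as [Hf [Ho _]].
  pose proof PI_RGT_0 as P0.
  assert (PC : RtoC PI <> 0%C) by (apply RtoC_neq0; lra).
  set (a := (RtoC PI / w)%C).
  assert (a0 : a <> 0%C).
  { intros E. apply PC. transitivity (a * w)%C; [unfold a; field; auto|rewrite E; ring]. }
  assert (Hwm := Hw). apply Cmod_gt_0 in Hwm.
  assert (ma : Cmod a = PI / Cmod w) by (unfold a; rewrite Cmod_div, Cmod_RtoC_pos by (auto; lra); easy).
  set (s := fun z => csin (a * z)).
  assert (Hsin : holo s).
  { unfold s. pose proof holo_csin. holos. }
  assert (LB : forall z n, Rabs (fst (a * z)%C - IZR n * PI) <= PI / 2 ->
    Cmod a / 6 * Cmod (z - RtoC (IZR n) * w) <= Cmod (s z)).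
  { intros z n H. eapply Rle_trans; [|now apply (csin_lower_bound _ n)]. right.
    replace (a * z - RtoC (IZR n * PI))%C with (a * (z - IZR n * w))%C.
    - rewrite Cmod_mult. field.
    - rewrite RtoC_mult. unfold a. field. auto. }
  assert (NI : forall z, exists n, Rabs (fst (a * z)%C - IZR n * PI) <= PI / 2).
  { intros z. destruct (nearest_integer (fst (a * z)%C / PI)) as [n Hn]. exists n.
    replace (fst (a * z)%C - IZR n * PI) with ((fst (a * z)%C / PI - IZR n) * PI) by (field; lra).
    rewrite Rabs_mult, (Rabs_pos_eq PI) by lra. nra. }
  assert (ma0 : 0 < Cmod a) by (apply Cmod_gt_0; easy).
  assert (s_zero : forall z, s z = 0%C -> exists n : Z, z = (RtoC (IZR n) * w)%C).
  { intros z Sz. destruct (NI z) as [n Hn]. exists n. apply Cminus_eq0, Cmod_eq_0.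
    specialize (LB z n Hn). rewrite Sz, Cmod_0 in LB. pose proof (Cmod_ge_0 (z - IZR n * w)). nra. }
  (* Within half a period of [n w] the index [n] meets the condition of [LB], so the lower bound
     holds on the closed disc around that zero. *)
  assert (near : forall n y, Cmod (y - RtoC (IZR n) * w) <= Cmod w / 2 -> Rabs (fst (a * y)%C - IZR n * PI) <= PI / 2).
  { intros n y Hy. apply Rle_trans with (Cmod (a * y - RtoC (IZR n * PI))).
    - apply (fst_le_Cmod (a * y - RtoC (IZR n * PI))%C).
    - replace (a * y - RtoC (IZR n * PI))%C with (a * (y - IZR n * w))%C by (rewrite RtoC_mult; unfold a; field; auto).
      rewrite Cmod_mult, ma. replace (PI / 2) with (PI / Cmod w * (Cmod w / 2)) by (field; lra).
      apply Rmult_le_compat_l; [|easy]. apply Rlt_le, Rdiv_lt_0_compat; lra. }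
  destruct (holo_quotient f s Hf Hsin) as [E [HE Ef]].
  { intros z Sz. destruct (s_zero z Sz) as [n En]. split; [apply Hz; eauto|].
    apply (derC_neq0 s z _ (Cmod a / 6) (Cmod w / 2)); auto; try lra.
    - now apply Dc_spec.
    - intros y Hy. rewrite En in Hy |- *. apply LB, near. lra. }
  assert (E0 : forall z, E z <> 0%C).
  { intros z Ez. assert (Fz : f z = 0%C) by (rewrite Ef, Ez; ring).
    apply (quotient_zero_free f s E Hsin HE Ef HD z Fz); [|easy].
    apply Hz in Fz. destruct Fz as [n ->]. unfold s.
    replace (a * (IZR n * w))%C with (RtoC (IZR n * PI)); [apply csin_zero|].
    rewrite RtoC_mult. unfold a. field. easy. }
  assert (Nz : exists z, s z <> 0%C).
  { exists (w / 2)%C. intros Sz. destruct (s_zero _ Sz) as [n En].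
    assert (Q : (w * RtoC (1 / 2 - IZR n) = 0)%C).
    { rewrite RtoC_minus, RtoC_div by lra. transitivity (w / 2 - IZR n * w)%C; [field|rewrite <- En; ring]. }
    apply Cmult_integral in Q. destruct Q as [Q|Q]; [easy|]. apply RtoC_inj in Q.
    assert (Q2 : IZR (2 * n) = IZR 1) by (rewrite mult_IZR; simpl; lra). apply eq_IZR in Q2. lia. }
  (* The 64 pays for the lower bound 1/64 of |s| far from the zeros, and near a zero for the factor
     8 of [cauchy_circle_bound] times the 8 from |s| >= 1/8. The cube allows for arguments displaced
     by at most |w|. *)
  set (K := 64 + A * (1 + Cmod w) ^ 3).
  assert (w3 : 0 <= (1 + Cmod w) ^ 3) by (apply pow_le; lra).
  assert (HK : 0 <= K) by (unfold K; nra).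
  destruct (even_zero_free_cubic_growth E K HE E0) as [al [be Eab]]; auto.
  - apply (quotient_even f s E); auto. intros z. unfold s.
    replace (a * - z)%C with (- (a * z))%C by ring. apply csin_odd.
  - intros z. destruct (NI z) as [n Hn].
    assert (Big : forall y, Cmod y <= Cmod z + Cmod w -> 64 * Cmod (f y) <= exp (K * (1 + Cmod z) ^ 3)).
    { intros y Hy. pose proof (Cmod_ge_0 z) as Z0. pose proof (Cmod_ge_0 y) as Y0. pose proof (one_le_cube _ Z0).
      apply Rle_trans with (exp 64 * exp (A * (1 + Cmod y) ^ 3)).
      - apply Rmult_le_compat; [lra|apply Cmod_ge_0|apply le_exp|apply Gr].
      - rewrite <- exp_plus. apply exp_le_compat. unfold K.
        assert (Q : (1 + Cmod y) ^ 3 <= (1 + Cmod w) ^ 3 * (1 + Cmod z) ^ 3).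
        { rewrite <- Rpow_mult_distr. apply pow_incr. nra. }
        assert (A * (1 + Cmod y) ^ 3 <= A * ((1 + Cmod w) ^ 3 * (1 + Cmod z) ^ 3)) by (apply Rmult_le_compat_l; easy).
        nra. }
    set (c := (RtoC (IZR n) * w)%C).
    assert (Ew : Cmod a * Cmod w = PI) by (rewrite ma; field; lra).
    pose proof PI2_3_2 as P3. pose proof (Cmod_ge_0 (E z)) as Ez0.
    (* The threshold is a quarter of the radius |w| / 2, as [cauchy_circle_bound] demands. *)
    destruct (Rle_dec (Cmod w / 2 / 4) (Cmod (z - c))) as [Hc|Hc].
    + apply Rle_trans with (64 * Cmod (f z)); [|apply Big; lra].
      rewrite Ef, Cmod_mult. specialize (LB z n Hn). fold c in LB.
      assert (1 / 64 <= Cmod (s z)).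
      { eapply Rle_trans; [|exact LB]. apply Rle_trans with (Cmod a / 6 * (Cmod w / 2 / 4)); [|apply Rmult_le_compat_l; lra].
        replace (Cmod a / 6 * (Cmod w / 2 / 4)) with (Cmod a * Cmod w / 48) by field. rewrite Ew. lra. }
      nra.
    + apply Rle_trans with (8 * (exp (K * (1 + Cmod z) ^ 3) / 8)); [|lra].
      apply (cauchy_circle_bound E c z (Cmod w / 2)); auto; [lra|lra|].
      intros t. set (y := (c + (Cmod w / 2)%R * circ t)%C).
      assert (Hyc : Cmod (y - c) = Cmod w / 2).
      { unfold y. replace (c + (Cmod w / 2)%R * circ t - c)%C with (RtoC (Cmod w / 2) * circ t)%C by ring.
        rewrite Cmod_mult, Cmod_circ, Cmod_RtoC_pos; lra. }
      assert (By : Cmod y <= Cmod z + Cmod w).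
      { pose proof (Cmod_triangle3 y c 0) as Q1. pose proof (Cmod_triangle3 c z 0) as Q2.
        replace (y - 0)%C with y in Q1 by ring. replace (c - 0)%C with c in * by ring.
        replace (z - 0)%C with z in Q2 by ring. rewrite (Cmod_minus_sym c z) in Q2. lra. }
      specialize (Big y By). assert (LBy := LB y n ltac:(apply near; fold c; lra)). fold c in LBy.
      rewrite Hyc in LBy. rewrite Ef, Cmod_mult in Big.
      assert (1 / 8 <= Cmod (s y)).
      { eapply Rle_trans; [|exact LBy]. replace (Cmod a / 6 * (Cmod w / 2)) with (Cmod a * Cmod w / 12) by field.
        rewrite Ew. lra. }
      pose proof (Cmod_ge_0 (E y)). nra.
  - exists a, al, be. split; [easy|]. intros z. rewrite Ef, Eab. reflexivity.
Qed.

(** * Discrete subgroups of the plane *)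

Lemma in_zrange k N : In k (zrange N) <-> (- Z.of_nat N <= k <= Z.of_nat N)%Z.
Proof.
  unfold zrange. rewrite in_map_iff. split.
  - intros [i [<- Hi]]. apply in_seq in Hi. lia.
  - intros H. exists (Z.to_nat (k + Z.of_nat N)). rewrite in_seq. lia.
Qed.

Definition norm2 (z : C) : R := fst z * fst z + snd z * snd z.

Lemma Cmod_sqr z : Cmod z * Cmod z = norm2 z.
Proof.
  unfold Cmod, norm2. rewrite sqrt_sqrt by (apply Rplus_le_le_0_compat; apply pow2_ge_0). simpl. ring.
Qed.

Lemma Cmod_le_norm2 z w : Cmod z <= Cmod w -> norm2 z <= norm2 w.
Proof. rewrite <- !Cmod_sqr. pose proof (Cmod_ge_0 z). nra. Qed.

Definition discrete_subgroup (L : C -> Prop) : Prop :=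
  L 0%C /\ (forall z w, L z -> L w -> L (z + w)%C) /\ (forall z, L z -> L (- z)%C) /\
  exists d, 0 < d /\ forall z, L z -> z <> 0%C -> d <= Cmod z.

(** Square cells of side [d / 2] contain at most one point of [L] each, since two points of a cell
    differ by less than [d]. The list takes a chosen point from every cell meeting the ball; cells
    without points of [L] contribute arbitrary entries. *)
Lemma discrete_ball_finite L B : discrete_subgroup L ->
  exists l : list C, forall z, L z -> Cmod z <= B -> In z l.
Proof.
  intros [_ [Ladd [Lopp [d [Hd Ld]]]]].
  set (h := d / 2). assert (Hh : 0 < h) by (unfold h; lra).
  set (cell := fun z : C => (up (fst z / h), up (snd z / h))).
  set (p := fun k : Z * Z => @epsilon C (inhabits (RtoC 0)) (fun z => L z /\ cell z = k)).
  assert (Up : forall x y, up (x / h) = up (y / h) -> Rabs (x - y) < h).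
  { intros x y E. destruct (archimed (x / h)) as [A1 A2]. destruct (archimed (y / h)) as [B1 B2]. rewrite E in *.
    assert (Rabs (x / h - y / h) < 1) by (apply Rabs_def1; lra).
    replace (x - y) with ((x / h - y / h) * h) by (field; lra).
    rewrite Rabs_mult, (Rabs_pos_eq h) by lra. nra. }
  destruct (INR_unbounded (B / h + 2)) as [N HN].
  exists (map p (list_prod (zrange N) (zrange N))).
  intros z Lz Bz.
  assert (Hp : L (p (cell z)) /\ cell (p (cell z)) = cell z).
  { apply (@epsilon_spec C (inhabits (RtoC 0)) (fun y => L y /\ cell y = cell z)). now exists z. }
  destruct Hp as [Lp Ep].
  assert (Eq : p (cell z) = z).
  { apply NNPP. intros Hn. unfold cell in Ep. injection Ep. intros E2 E1.
    apply Up in E1. apply Up in E2.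
    assert (Dn := Ld (p (cell z) + - z)%C (Ladd _ _ Lp (Lopp _ Lz)) (Cminus_neq0 _ _ Hn)).
    assert (Q : exists e, e < d /\ Cmod (p (cell z) + - z) <= e).
    { exists (2 * Rmax (Rabs (fst (p (cell z)) - fst z)) (Rabs (snd (p (cell z)) - snd z))). split.
      - apply Rmax_case; unfold h in *; unfold cell in *; lra.
      - apply Cmod_le_2max; [apply (Rmax_l (Rabs (fst (p (cell z)) - fst z)))|apply (Rmax_r _ (Rabs (snd (p (cell z)) - snd z)))]. }
    destruct Q as [e [Q1 Q2]]. lra. }
  rewrite <- Eq. apply in_map. unfold cell.
  assert (Rg : forall x, Rabs x <= B -> In (up (x / h)) (zrange N)).
  { intros x Hx. apply in_zrange. destruct (archimed (x / h)) as [A1 A2].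
    apply Rabs_le_between in Hx.
    assert (x / h <= B / h) by (apply Rmult_le_compat_r; [left; now apply Rinv_0_lt_compat|lra]).
    assert (- (B / h) <= x / h).
    { replace (- (B / h)) with ((- B) / h) by (field; lra). apply Rmult_le_compat_r; [left; now apply Rinv_0_lt_compat|lra]. }
    split; apply le_IZR; [rewrite opp_IZR|]; rewrite <- INR_IZR_INZ; lra. }
  apply in_prod; apply Rg; eapply Rle_trans; [apply fst_le_Cmod|easy|apply snd_le_Cmod|easy].
Qed.

Lemma discrete_min_norm L (P : C -> Prop) : discrete_subgroup L -> (forall z, P z -> L z) ->
  (exists z, P z) -> exists z, P z /\ forall y, P y -> Cmod z <= Cmod y.
Proof.
  intros HL HP [z0 Hz0]. destruct (discrete_ball_finite L (Cmod z0) HL) as [l Hl].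
  assert (K : forall l : list C, (exists z, In z l /\ P z) ->
    exists z, P z /\ forall y, In y l -> P y -> Cmod z <= Cmod y).
  { clear. induction l as [|a l IH]; intros [z [Hz Pz]]; [destruct Hz|].
    destruct (classic (exists z, In z l /\ P z)) as [Hl|Hl].
    - destruct (IH Hl) as [m [Pm Hm]].
      destruct (classic (P a /\ Cmod a <= Cmod m)) as [[Pa Ha]|Ha].
      + exists a. split; [easy|]. intros y [<-|Hy] Py; [lra|]. specialize (Hm y Hy Py). lra.
      + exists m. split; [easy|]. intros y [<-|Hy] Py; [|auto].
        destruct (Rle_dec (Cmod m) (Cmod a)); [easy|]. exfalso. apply Ha. split; [easy|lra].
    - destruct Hz as [-> |Hz]; [|exfalso; eauto].
      exists z. split; [easy|]. intros y [<-|Hy] Py; [lra|]. exfalso; eauto. }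
  destruct (K l) as [m [Pm Hm]]; [exists z0; split; [apply Hl; [auto|lra]|easy]|].
  exists m. split; [easy|]. intros y Py. pose proof (Hm z0 (Hl z0 (HP _ Hz0) (Rle_refl _)) Hz0).
  destruct (Rle_dec (Cmod y) (Cmod z0)); [|lra]. apply Hm; auto.
Qed.

Lemma subgroup_Zmult L z n : discrete_subgroup L -> L z -> L (RtoC (IZR n) * z)%C.
Proof.
  intros [L0 [Ladd [Lopp _]]] Lz.
  assert (N : forall k : nat, L (RtoC (INR k) * z)%C).
  { induction k as [|k IH].
    - simpl. replace (RtoC 0 * z)%C with (RtoC 0) by ring. easy.
    - rewrite S_INR, RtoC_plus. replace ((RtoC (INR k) + RtoC 1) * z)%C with (RtoC (INR k) * z + z)%C by ring. auto. }
  destruct (Z.le_gt_cases 0 n) as [Hn|Hn].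
  - rewrite <- (Z2Nat.id n Hn), <- INR_IZR_INZ. apply N.
  - replace n with (- Z.of_nat (Z.to_nat (- n)))%Z by lia. rewrite opp_IZR, <- INR_IZR_INZ, RtoC_opp.
    replace (- RtoC (INR (Z.to_nat (- n))) * z)%C with (- (RtoC (INR (Z.to_nat (- n))) * z))%C by ring. auto.
Qed.

Lemma R_lin_indep_det w1 w2 : R_lin_indep w1 w2 -> fst w1 * snd w2 - snd w1 * fst w2 <> 0.
Proof.
  (* The combination |w2|^2 w1 - <w1, w2> w2 is |w2|^2 times the part of [w1] orthogonal to [w2]; it
     vanishes with the determinant, which forces [w2 = 0]. *)
  intros H E. destruct (H (norm2 w2) (- (fst w1 * fst w2 + snd w1 * snd w2))) as [A B].
  { unfold norm2. apply injective_projections; simpl.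
    - transitivity (snd w2 * (fst w1 * snd w2 - snd w1 * fst w2)); [ring|rewrite E; ring].
    - transitivity (- fst w2 * (fst w1 * snd w2 - snd w1 * fst w2)); [ring|rewrite E; ring]. }
  unfold norm2 in A. assert (A1 : fst w2 = 0) by nra. assert (A2 : snd w2 = 0) by nra.
  destruct (H 0 1) as [_ X]; [|lra]. apply injective_projections; simpl; rewrite A1, A2; ring.
Qed.

Lemma R_basis_coords w1 w2 (z : C) : R_lin_indep w1 w2 ->
  exists x y : R, z = (RtoC x * w1 + RtoC y * w2)%C.
Proof.
  intros H. apply R_lin_indep_det in H.
  exists ((fst z * snd w2 - snd z * fst w2) / (fst w1 * snd w2 - snd w1 * fst w2)),
    ((fst w1 * snd z - snd w1 * fst z) / (fst w1 * snd w2 - snd w1 * fst w2)).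
  apply injective_projections; simpl; field; easy.
Qed.

(** Lagrange-Gauss reduction: [w1] is a shortest nonzero element, [w2] a shortest one off the line
    through [w1]. Subtracting the nearest lattice point from an element of [L] leaves a remainder
    too short to lie off that line. *)
Lemma discrete_subgroup_classification L : discrete_subgroup L ->
  (forall z, L z -> z = 0%C) \/
  (exists w : C, w <> 0%C /\ forall z, L z <-> exists n : Z, z = (RtoC (IZR n) * w)%C) \/
  (exists w1 w2 : C, R_lin_indep w1 w2 /\ forall z, L z <-> exists m n : Z, z = lat_pt w1 w2 m n).
Proof.
  intros HL. destruct (classic (forall z, L z -> z = 0%C)) as [H|H]; [now left|right].
  apply not_all_ex_not in H. destruct H as [z0 Hz0]. apply imply_to_and in Hz0.
  destruct (discrete_min_norm L (fun z => L z /\ z <> 0%C) HL) as [w1 [[L1 W1] M1]]; [tauto|eauto|].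
  assert (HL' := HL). destruct HL' as [L0 [Ladd [Lopp _]]].
  assert (m1 : 0 < Cmod w1) by now apply Cmod_gt_0.
  assert (small : forall r, Rabs r <= 1 / 2 -> L (RtoC r * w1)%C -> r = 0).
  { intros r Hr Lr. apply NNPP. intros Hn.
    assert (Q : (RtoC r * w1 <> 0)%C).
    { intros E. apply Cmult_integral in E. destruct E as [E|E]; [|easy]. now apply RtoC_inj in E. }
    specialize (M1 _ (conj Lr Q)). rewrite Cmod_mult, Cmod_R in M1. nra. }
  destruct (classic (forall z, L z -> exists r : R, z = (RtoC r * w1)%C)) as [HR|HR].
  - left. exists w1. split; [easy|]. intros z. split.
    + intros Lz. destruct (HR z Lz) as [r ->]. destruct (nearest_integer r) as [n Hn]. exists n.
      assert (Q : r - IZR n = 0).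
      { apply small; [easy|]. rewrite RtoC_minus.
        replace ((r - IZR n) * w1)%C with (RtoC r * w1 + - (RtoC (IZR n) * w1))%C by ring.
        apply Ladd; [easy|]. apply Lopp. now apply subgroup_Zmult. }
      replace (IZR n) with r by lra. easy.
    + intros [n ->]. now apply subgroup_Zmult.
  - right. apply not_all_ex_not in HR. destruct HR as [z1 Hz1]. apply imply_to_and in Hz1.
    destruct (discrete_min_norm L (fun z => L z /\ ~ exists r : R, z = (RtoC r * w1)%C) HL) as [w2 [[L2 W2] M2]]; [tauto|eauto|].
    assert (W20 : w2 <> 0%C).
    { intros E. apply W2. exists 0. rewrite E. ring. }
    assert (M12 := M1 w2 (conj L2 W20)). apply Cmod_le_norm2 in M12.
    assert (Ind : R_lin_indep w1 w2).
    { intros a b E. assert (b0 : b = 0).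
      { apply NNPP. intros Hb. apply W2. exists (- (a / b)). rewrite RtoC_opp, RtoC_div by easy.
        assert (RtoC b <> 0%C) by now apply RtoC_neq0.
        transitivity ((RtoC a * w1 + RtoC b * w2) / RtoC b - RtoC a / RtoC b * w1)%C; [field; easy|].
        rewrite E. field. easy. }
      split; [|easy]. subst b. assert (E' : (RtoC a * w1 = 0)%C) by (rewrite <- E; ring).
      apply Cmult_integral in E'. destruct E' as [E'|E']; [now apply RtoC_inj in E'|easy]. }
    exists w1, w2. split; [easy|]. intros z. split.
    2:{ intros [m [n ->]]. apply Ladd; now apply subgroup_Zmult. }
    intros Lz. destruct (R_basis_coords w1 w2 z Ind) as [x [y Ez]].
    destruct (nearest_integer x) as [m Hm]. destruct (nearest_integer y) as [n Hn]. exists m, n.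
    set (x' := x - IZR m) in *. set (y' := y - IZR n) in *.
    set (u := (RtoC x' * w1 + RtoC y' * w2)%C).
    assert (Eu : u = (z + - lat_pt w1 w2 m n)%C).
    { rewrite Ez. unfold u, x', y', lat_pt. rewrite !RtoC_minus. ring. }
    assert (Lu : L u).
    { rewrite Eu. apply Ladd; [easy|]. apply Lopp, Ladd; now apply subgroup_Zmult. }
    (* Minimality of [w2] against [w2 + w1] and [w2 - w1] yields |2 <w1, w2>| <= |w1|^2. *)
    assert (pm : forall e, e = 1 \/ e = -1 -> norm2 w2 <= norm2 (w2 + RtoC e * w1)%C).
    { intros e He. apply Cmod_le_norm2, M2. split.
      - apply Ladd; [easy|]. destruct He as [-> | ->]; now apply subgroup_Zmult.
      - intros [r Er]. apply W2. exists (r - e). rewrite RtoC_minus.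
        transitivity (w2 + RtoC e * w1 - RtoC e * w1)%C; [ring|rewrite Er; ring]. }
    pose proof (pm 1 (or_introl eq_refl)) as P1. pose proof (pm (-1) (or_intror eq_refl)) as P2.
    (* Each coordinate of [u] is at most 1/2, so the two squares and the mixed term contribute at
       most a quarter of |w2|^2 each. *)
    assert (Nu : norm2 u <= 3 / 4 * norm2 w2).
    { apply Rabs_le_between in Hm. apply Rabs_le_between in Hn.
      set (t := fst w1 * fst w2 + snd w1 * snd w2).
      assert (T : - norm2 w1 <= 2 * t <= norm2 w1).
      { unfold norm2, t in *. simpl in P1, P2. nra. }
      replace (norm2 u) with (x' * x' * norm2 w1 + y' * y' * norm2 w2 + x' * y' * (2 * t))
        by (unfold norm2, u, t; simpl; ring).
      assert (0 <= norm2 w1) by (unfold norm2; nra).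
      assert (x' * x' <= / 4) by nra. assert (y' * y' <= / 4) by nra.
      assert (- / 4 <= x' * y' <= / 4) by nra.
      assert (x' * y' * (2 * t) <= / 4 * norm2 w1).
      { apply Rabs_le_between in T. eapply Rle_trans; [apply Rle_abs|]. rewrite Rabs_mult.
        apply Rmult_le_compat; try apply Rabs_pos; [apply Rabs_le; lra|easy]. }
      nra. }
    assert (Hr : exists r : R, u = (RtoC r * w1)%C).
    { apply NNPP. intros Hn'. specialize (M2 u (conj Lu Hn')). apply Cmod_le_norm2 in M2.
      assert (0 < norm2 w2) by (rewrite <- Cmod_sqr; apply Cmod_gt_0 in W20; nra). lra. }
    destruct Hr as [r Er].
    destruct (Ind (x' - r) y') as [A B].
    { rewrite RtoC_minus. transitivity (u - RtoC r * w1)%C; [unfold u; ring|rewrite Er; ring]. }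
    assert (x0 : x' = 0).
    { apply small; [easy|]. replace (RtoC x' * w1)%C with u; [easy|]. unfold u. rewrite B. ring. }
    apply Cminus_eq0. transitivity u; [rewrite Eu; ring|]. unfold u. rewrite x0, B. ring.
Qed.

(** * Products over lattice boxes *)

(** Shaped like the fold in [sigma_partial], so that [sigma_partial_prodl] holds by conversion. *)
Definition prodl {A : Type} (F : A -> C) (l : list A) : C := fold_right Cmult (RtoC 1) (map F l).

Lemma prodl_cons {A} (F : A -> C) a l : prodl F (a :: l) = (F a * prodl F l)%C.
Proof. reflexivity. Qed.

Lemma prodl_ext {A} (F G : A -> C) l : (forall a, In a l -> F a = G a) -> prodl F l = prodl G l.
Proof.
  induction l as [|a l IH]; intros H; [reflexivity|]. rewrite !prodl_cons.
  f_equal; [apply H; now left|apply IH; intros; apply H; now right].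
Qed.

Lemma prodl_app {A} (F : A -> C) l1 l2 : prodl F (l1 ++ l2) = (prodl F l1 * prodl F l2)%C.
Proof.
  induction l1 as [|a l1 IH]; [unfold prodl; simpl; ring|]. simpl app. rewrite !prodl_cons, IH. ring.
Qed.

Lemma prodl_map {A B} (g : A -> B) (F : B -> C) l : prodl F (map g l) = prodl (fun a => F (g a)) l.
Proof. unfold prodl. now rewrite map_map. Qed.

Lemma prodl_mult {A} (F G : A -> C) l : prodl (fun a => F a * G a)%C l = (prodl F l * prodl G l)%C.
Proof.
  induction l as [|a l IH]; [unfold prodl; simpl; ring|]. rewrite !prodl_cons, IH. ring.
Qed.

Lemma prodl_perm {A} (F : A -> C) l1 l2 : Permutation l1 l2 -> prodl F l1 = prodl F l2.
Proof.
  induction 1; [reflexivity|now rewrite !prodl_cons, IHPermutation| |congruence].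
  rewrite !prodl_cons. ring.
Qed.

Lemma prodl_neq0 {A} (F : A -> C) l : (forall a, In a l -> F a <> 0%C) -> prodl F l <> 0%C.
Proof.
  induction l as [|a l IH]; intros H E; [now apply C1_nz|]. rewrite prodl_cons in E.
  apply Cmult_integral in E. destruct E as [E|E]; [apply (H a); simpl; auto|].
  apply IH; auto. intros; apply H; simpl; auto.
Qed.

Lemma prodl_eq0 {A} (F : A -> C) l a : In a l -> F a = 0%C -> prodl F l = 0%C.
Proof.
  intros Ha Fa. induction l as [|b l IH]; [destruct Ha|]. rewrite prodl_cons.
  destruct Ha as [-> |Ha]; [rewrite Fa; ring|]. rewrite IH by easy. ring.
Qed.

Lemma prodl_list_prod {A B} (F : A * B -> C) l1 l2 :
  prodl F (list_prod l1 l2) = prodl (fun a => prodl (fun b => F (a, b)) l2) l1.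
Proof.
  induction l1 as [|a l1 IH]; [reflexivity|]. simpl list_prod.
  rewrite prodl_app, prodl_map, IH. reflexivity.
Qed.

Lemma holo_prodl {A} (F : C -> A -> C) l : (forall a, holo (fun z => F z a)) -> holo (fun z => prodl (F z) l).
Proof.
  intros H. induction l as [|a l IH]; [apply (holo_const 1)|].
  apply (holo_mult (fun z => F z a) (fun z => prodl (F z) l)); auto.
Qed.

Lemma prodl_near1 {A} (F : A -> C) l e : 0 <= e -> (forall a, In a l -> Cmod (F a - 1) <= e) ->
  Cmod (prodl F l - 1) <= (1 + e) ^ length l - 1.
Proof.
  intros He H. induction l as [|a l IH].
  - unfold prodl. simpl. rewrite Cmod_zero by ring. lra.
  - rewrite prodl_cons. simpl length. simpl pow.
    assert (IH' := IH (fun b Hb => H b (or_intror Hb))). assert (Ha := H a (or_introl eq_refl)).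
    replace (F a * prodl F l - 1)%C with (F a * (prodl F l - 1) + (F a - 1))%C by ring.
    eapply Rle_trans; [apply Cmod_triangle|]. rewrite Cmod_mult.
    assert (Cmod (F a) <= 1 + e).
    { pose proof (Cmod_ge_sub (F a) 1). rewrite Cmod_1 in *. lra. }
    pose proof (Cmod_ge_0 (F a)). pose proof (Cmod_ge_0 (prodl F l - 1)).
    assert (1 <= (1 + e) ^ length l) by (apply pow_R1_Rle; lra). nra.
Qed.

(** (1 + e)^n <= exp(n e), and exp x <= 1 + 2 x for 0 <= x <= 1/2 because exp(- x) >= 1 - x. *)
Lemma prodl_near1_small {A} (F : A -> C) l e : 0 <= e -> INR (length l) * e <= 1 / 2 ->
  (forall a, In a l -> Cmod (F a - 1) <= e) -> Cmod (prodl F l - 1) <= 2 * (INR (length l) * e).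
Proof.
  intros He Hs H. eapply Rle_trans; [now apply prodl_near1 with (e := e)|].
  set (x := INR (length l) * e) in *. assert (x0 : 0 <= x) by (unfold x; apply Rmult_le_pos; [apply pos_INR|easy]).
  assert (P : (1 + e) ^ length l <= exp x).
  { unfold x. generalize (length l). induction n as [|n IH]; [simpl; rewrite Rmult_0_l, exp_0; lra|].
    rewrite S_INR. replace ((INR n + 1) * e) with (e + INR n * e) by ring. rewrite exp_plus.
    simpl pow. apply Rmult_le_compat; [lra|apply pow_le; lra|apply exp_ineq1_le|easy]. }
  assert (Q : exp x <= 1 + 2 * x).
  { pose proof (exp_ineq1_le (- x)) as Q. pose proof (exp_pos x).
    assert (E : exp x * exp (- x) = 1) by (rewrite <- exp_plus, Rplus_opp_r; apply exp_0). nra. }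
  lra.
Qed.

Lemma NoDup_prod {A B} (l1 : list A) (l2 : list B) : NoDup l1 -> NoDup l2 -> NoDup (list_prod l1 l2).
Proof.
  intros H1 H2. induction H1 as [|a l1 Ha H1 IH]; simpl; [constructor|].
  apply NoDup_app; [|easy|].
  - apply FinFun.Injective_map_NoDup; [|easy]. intros x y E. now injection E.
  - intros [x y] Hm Hp. apply in_map_iff in Hm. destruct Hm as [b [E _]]. injection E as <- <-.
    apply in_prod_iff in Hp. tauto.
Qed.

Lemma NoDup_zrange N : NoDup (zrange N).
Proof.
  unfold zrange. apply FinFun.Injective_map_NoDup; [|apply seq_NoDup]. intros x y E. lia.
Qed.

Lemma length_zrange N : length (zrange N) = (2 * N + 1)%nat.
Proof. unfold zrange. now rewrite length_map, length_seq. Qed.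

(** * Square boxes of lattice indices and the layers between them *)

Definition nonorigin (mn : Z * Z) : bool := negb (Z.eqb (fst mn) 0 && Z.eqb (snd mn) 0).

Lemma nonorigin_iff mn : nonorigin mn = true <-> mn <> (0%Z, 0%Z).
Proof.
  destruct mn as [m n]. unfold nonorigin. simpl. rewrite Bool.negb_true_iff, Bool.andb_false_iff, !Z.eqb_neq.
  split; [intros [H|H] E; injection E; auto|]. intros H.
  destruct (Z.eq_dec m 0) as [-> |]; [right|now left]. intros ->. now apply H.
Qed.

Definition full_box (N : nat) : list (Z * Z) := list_prod (zrange N) (zrange N).
Definition box (N : nat) : list (Z * Z) := filter nonorigin (full_box N).
(** The layer between [box N] and [box (S N)]: indices of sup norm exactly N + 1, not N. *)
Definition shell (N : nat) : list (Z * Z) :=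
  filter (fun mn => negb (Z.leb (Z.abs (fst mn)) (Z.of_nat N) && Z.leb (Z.abs (snd mn)) (Z.of_nat N)))
    (full_box (S N)).

Lemma in_full_box m n N : In (m, n) (full_box N) <-> (Z.abs m <= Z.of_nat N /\ Z.abs n <= Z.of_nat N)%Z.
Proof. unfold full_box. rewrite in_prod_iff, !in_zrange. lia. Qed.

Lemma in_box m n N : In (m, n) (box N) <->
  (Z.abs m <= Z.of_nat N /\ Z.abs n <= Z.of_nat N)%Z /\ (m, n) <> (0%Z, 0%Z).
Proof. unfold box. rewrite filter_In, in_full_box, nonorigin_iff. tauto. Qed.

Lemma in_shell m n N : In (m, n) (shell N) <->
  (Z.abs m <= Z.of_nat (S N) /\ Z.abs n <= Z.of_nat (S N))%Z /\
  (Z.of_nat N < Z.abs m \/ Z.of_nat N < Z.abs n)%Z.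
Proof.
  unfold shell. rewrite filter_In, in_full_box. simpl fst. simpl snd.
  rewrite Bool.negb_true_iff, Bool.andb_false_iff, !Z.leb_gt. tauto.
Qed.

Lemma NoDup_full_box N : NoDup (full_box N).
Proof. apply NoDup_prod; apply NoDup_zrange. Qed.
Lemma NoDup_box N : NoDup (box N).
Proof. apply NoDup_filter, NoDup_full_box. Qed.
Lemma NoDup_shell N : NoDup (shell N).
Proof. apply NoDup_filter, NoDup_full_box. Qed.

Lemma full_box_perm N : Permutation (full_box N) ((0%Z, 0%Z) :: box N).
Proof.
  apply NoDup_Permutation; [apply NoDup_full_box| |].
  - constructor; [rewrite in_box; tauto|apply NoDup_box].
  - intros [m n]. simpl. rewrite in_box, in_full_box.
    destruct (classic ((m, n) = (0%Z, 0%Z))) as [E|E].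
    + rewrite E. injection E as -> ->. simpl. split; [auto|lia].
    + split; [tauto|]. intros [H|H]; [congruence|tauto].
Qed.

Lemma box_succ_perm N : Permutation (box (S N)) (box N ++ shell N).
Proof.
  apply NoDup_Permutation; [apply NoDup_box| |].
  - apply NoDup_app; [apply NoDup_box|apply NoDup_shell|].
    intros [m n]. rewrite in_box, in_shell. lia.
  - intros [m n]. rewrite in_app_iff, !in_box, in_shell.
    assert (E : (m, n) = (0%Z, 0%Z) -> m = 0%Z /\ n = 0%Z) by (intros E; injection E; auto).
    destruct (classic ((m, n) = (0%Z, 0%Z))) as [E0|E0].
    + destruct (E E0) as [-> ->]. split; [tauto|]. intros [H|H]; [tauto|lia].
    + split.
      * intros [H _]. destruct (Z.le_gt_cases (Z.abs m) (Z.of_nat N)), (Z.le_gt_cases (Z.abs n) (Z.of_nat N)); try (right; lia). left; tauto.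
      * intros [H|H]; (split; [lia|easy]).
Qed.

(** Linear growth of the layers, against the cubic decay of [wfactor z l - 1] in 1/|l|, is what
    makes the product converge. *)
Lemma length_shell N : length (shell N) = (8 * N + 8)%nat.
Proof.
  assert (L : forall M, S (length (box M)) = ((2 * M + 1) * (2 * M + 1))%nat).
  { intros M. change (S (length (box M))) with (length ((0%Z, 0%Z) :: box M)).
    rewrite <- (Permutation_length (full_box_perm M)). unfold full_box. now rewrite length_prod, length_zrange. }
  pose proof (Permutation_length (box_succ_perm N)) as H. rewrite length_app in H.
  pose proof (L N). pose proof (L (S N)). nia.
Qed.

Definition swapZ (mn : Z * Z) : Z * Z := (snd mn, fst mn).
Definition negZ (mn : Z * Z) : Z * Z := (- fst mn, - snd mn)%Z.

Lemma box_swap_perm N : Permutation (box N) (map swapZ (box N)).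
Proof.
  apply NoDup_Permutation; [apply NoDup_box| |].
  - apply FinFun.Injective_map_NoDup; [|apply NoDup_box]. intros [a b] [c d] E. now injection E as <- <-.
  - intros [m n]. rewrite in_map_iff. split.
    + intros H. exists (n, m). split; [easy|]. apply in_box. apply in_box in H.
      destruct H as [H1 H2]. split; [tauto|]. intros E. injection E as -> ->. tauto.
    + intros [[a b] [E H]]. injection E as <- <-. apply in_box. apply in_box in H.
      destruct H as [H1 H2]. split; [simpl; tauto|]. intros E. injection E as -> ->. tauto.
Qed.

Lemma box_neg_perm N : Permutation (box N) (map negZ (box N)).
Proof.
  apply NoDup_Permutation; [apply NoDup_box| |].
  - apply FinFun.Injective_map_NoDup; [|apply NoDup_box]. intros [a b] [c d] E. injection E as E1 E2. f_equal; lia.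
  - intros [m n]. rewrite in_map_iff. split.
    + intros H. exists (- m, - n)%Z. unfold negZ. simpl. rewrite !Z.opp_involutive. split; [easy|]. apply in_box. apply in_box in H.
      destruct H as [H1 H2]. split; [lia|]. intros E. injection E as E1 E2. apply H2. f_equal; lia.
    + intros [[a b] [E H]]. injection E as <- <-. apply in_box. apply in_box in H.
      destruct H as [H1 H2]. simpl. split; [lia|]. intros E. injection E as E1 E2. apply H2. f_equal; lia.
Qed.

Definition lat (w1 w2 : C) (mn : Z * Z) : C := lat_pt w1 w2 (fst mn) (snd mn).

Lemma sigma_partial_prodl w1 w2 z N :
  sigma_partial w1 w2 z N = prodl (fun mn => wfactor z (lat w1 w2 mn)) (box N).
Proof. reflexivity. Qed.

(** Because boxes are symmetric, the translation argument can be carried out for [w1] and reused for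
    [w2] with the same quotients. *)
Lemma sigma_partial_swap w1 w2 z N : sigma_partial w1 w2 z N = sigma_partial w2 w1 z N.
Proof.
  rewrite !sigma_partial_prodl. rewrite (prodl_perm _ _ _ (box_swap_perm N)), prodl_map.
  apply prodl_ext. intros [m n] _. f_equal. unfold lat, lat_pt. simpl. ring.
Qed.

Lemma wfactor_opp z l : wfactor (- z) (- l) = wfactor z l.
Proof.
  unfold wfactor. assert (E : (- z / - l = z / l)%C).
  { destruct (classic (l = 0%C)) as [-> |H].
    (* The inverse of 0 computes to 0 in components, so both quotients are 0. *)
    - replace (- 0)%C with (RtoC 0) by ring. unfold Cdiv.
      replace (/ 0)%C with (RtoC 0); [ring|]. apply injective_projections; unfold Cinv; simpl; unfold Rdiv; ring.
    - field. exact H. }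
  now rewrite E.
Qed.

Lemma sigma_partial_even w1 w2 z N : sigma_partial w1 w2 (- z) N = sigma_partial w1 w2 z N.
Proof.
  rewrite !sigma_partial_prodl. rewrite (prodl_perm _ _ _ (box_neg_perm N)), prodl_map.
  apply prodl_ext. intros [m n] _. rewrite <- wfactor_opp. f_equal; [ring|].
  unfold lat, lat_pt, negZ. simpl. rewrite !opp_IZR, !RtoC_opp. ring.
Qed.

Lemma sigma_partial_succ w1 w2 z N :
  sigma_partial w1 w2 z (S N) =
  (sigma_partial w1 w2 z N * prodl (fun mn => wfactor z (lat w1 w2 mn)) (shell N))%C.
Proof.
  rewrite !sigma_partial_prodl, (prodl_perm _ _ _ (box_succ_perm N)). apply prodl_app.
Qed.

Lemma holo_wfactor l : holo (fun z => wfactor z l).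
Proof.
  unfold wfactor. cbv zeta. holos.
Qed.

Lemma holo_sigma_partial w1 w2 N : holo (fun z => sigma_partial w1 w2 z N).
Proof.
  apply (holo_prodl (fun z mn => wfactor z (lat w1 w2 mn))). intros; apply holo_wfactor.
Qed.

#[export] Hint Resolve holo_sigma_partial : holo.

Lemma wfactor_zero (l : C) : l <> 0%C -> wfactor l l = 0%C.
Proof. intros H. unfold wfactor. replace (l / l)%C with (RtoC 1) by (field; easy). ring. Qed.

Lemma wfactor_neq0 (z l : C) : l <> 0%C -> z <> l -> wfactor z l <> 0%C.
Proof.
  intros Hl Hz E. unfold wfactor in E. apply Cmult_integral in E. destruct E as [E|E]; [|now apply cexp_neq0 in E].
  apply Hz. symmetry. apply Cminus_eq0. transitivity (l * (1 - z / l))%C; [field; easy|]. rewrite E. ring.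
Qed.

(* The cubic bound holds because [(1 - u) exp (u + u^2/2)] has derivative [- u^2 exp (u + u^2/2)]. *)
Lemma wfactor_near1 (z l : C) : l <> 0%C -> Cmod z <= Cmod l ->
  Cmod (wfactor z l - 1) <= 2 * exp 2 * (Cmod z / Cmod l) ^ 3.
Proof.
  intros Hl Hz. set (u := (z / l)%C).
  assert (Hu : Cmod u = Cmod z / Cmod l) by (unfold u; now rewrite Cmod_div).
  apply Cmod_gt_0 in Hl as ml.
  assert (Hu1 : Cmod u <= 1) by (rewrite Hu; apply Rle_div_l; lra).
  set (F := fun u => ((1 - u) * cexp (u + RtoC (/ 2) * (u * u)))%C).
  set (G := fun u => (- (u * u) * cexp (u + RtoC (/ 2) * (u * u)))%C).
  assert (hG : holo G) by (unfold G; holos).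
  assert (dz : forall z, derC (fun z : C => z) z 1) by (apply (der_emb (fun z : C => z))).
  assert (dF : forall z, derC F z (G z)).
  { intros y. unfold F. eapply der_eq.
    - apply der_mult; [apply der_minus; [apply der_const|apply dz]|].
      apply (der_comp (fun z : C => z) cexp (fun u => (u + RtoC (/ 2) * (u * u))%C)); [apply derC_cexp|].
      apply der_plus; [apply dz|]. apply der_scal. apply der_mult; apply dz.
    - cbv beta. unfold G. rewrite RtoC_inv by lra. field. }
  change (wfactor z l) with (F u).
  assert (F0 : F 0%C = 1%C).
  { unfold F. replace (0 + RtoC (/ 2) * (0 * 0))%C with (RtoC 0) by ring. rewrite cexp_0. ring. }
  assert (G0 : G 0%C = 0%C) by (unfold G; ring).
  pose proof (der_increment_bound F G 0 u (exp 2 * (Cmod u * Cmod u)) dF (holo_cont G hG)) as B.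
  rewrite F0, G0 in B. replace (F u - 1 - 0 * (u - 0))%C with (F u - 1)%C in B by ring.
  replace (u - 0)%C with u in B by ring. rewrite <- Hu.
  replace (2 * exp 2 * Cmod u ^ 3) with (2 * (exp 2 * (Cmod u * Cmod u)) * Cmod u) by ring.
  apply B. intros t Ht. replace (0 + t * u)%C with (RtoC t * u)%C by ring.
  set (v := (RtoC t * u)%C).
  assert (Hv : Cmod v <= Cmod u).
  { unfold v. rewrite Cmod_mult, Cmod_RtoC_pos by lra. pose proof (Cmod_ge_0 u). nra. }
  replace (G v - 0)%C with (G v) by ring. unfold G.
  pose proof (Cmod_ge_0 v) as v0.
  rewrite Cmod_mult, Cmod_opp, Cmod_mult, Cmod_cexp, Rmult_comm.
  apply Rmult_le_compat; [apply Rlt_le, exp_pos|nra| |nra].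
  apply exp_le_compat. eapply Rle_trans; [apply Rle_abs|]. eapply Rle_trans; [apply fst_le_Cmod|].
  eapply Rle_trans; [apply Cmod_triangle|]. rewrite !Cmod_mult, Cmod_RtoC_pos by lra. nra.
Qed.

(** Cramer's rule: the determinant times [m] or [n] is linear in the lattice point, with
    coefficients bounded by |w1| and |w2|. *)
Lemma lat_lower_bound w1 w2 : R_lin_indep w1 w2 -> exists k, 0 < k /\
  forall m n, k * Rabs (IZR m) <= Cmod (lat_pt w1 w2 m n) /\ k * Rabs (IZR n) <= Cmod (lat_pt w1 w2 m n).
Proof.
  intros H. apply R_lin_indep_det in H. set (d := fst w1 * snd w2 - snd w1 * fst w2) in *.
  set (W := 2 * (Cmod w1 + Cmod w2 + 1)).
  pose proof (Cmod_ge_0 w1) as P1. pose proof (Cmod_ge_0 w2) as P2.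
  assert (HW : 0 < W) by (unfold W; lra).
  assert (Hd : 0 < Rabs d) by now apply Rabs_pos_lt.
  exists (Rabs d / W). split; [now apply Rdiv_lt_0_compat|]. intros m n. set (z := lat_pt w1 w2 m n).
  assert (E1 : d * IZR m = fst z * snd w2 - snd z * fst w2) by (unfold z, lat_pt, d; simpl; ring).
  assert (E2 : d * IZR n = snd z * fst w1 - fst z * snd w1) by (unfold z, lat_pt, d; simpl; ring).
  pose proof (Cmod_ge_0 z) as Pz.
  assert (K : forall v, 2 * Cmod v <= W -> Rabs (fst z * snd v - snd z * fst v) <= W * Cmod z).
  { intros v Hv. eapply Rle_trans; [apply Rabs_triang|]. rewrite Rabs_Ropp, !Rabs_mult.
    pose proof (fst_le_Cmod z). pose proof (snd_le_Cmod z). pose proof (fst_le_Cmod v). pose proof (snd_le_Cmod v).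
    pose proof (Rabs_pos (fst z)). pose proof (Rabs_pos (snd z)). pose proof (Rabs_pos (fst v)). pose proof (Rabs_pos (snd v)).
    assert (Rabs (fst z) * Rabs (snd v) <= Cmod z * Cmod v) by (apply Rmult_le_compat; easy).
    assert (Rabs (snd z) * Rabs (fst v) <= Cmod z * Cmod v) by (apply Rmult_le_compat; easy). nra. }
  split.
  - pose proof (K w2 ltac:(unfold W; lra)) as Q. rewrite <- E1, Rabs_mult in Q.
    replace (Rabs d / W * Rabs (IZR m)) with (Rabs d * Rabs (IZR m) / W) by (field; lra). apply Rle_div_l; lra.
  - pose proof (K w1 ltac:(unfold W; lra)) as Q. rewrite Rabs_minus_sym, <- E2, Rabs_mult in Q.
    replace (Rabs d / W * Rabs (IZR n)) with (Rabs d * Rabs (IZR n) / W) by (field; lra). apply Rle_div_l; lra.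
Qed.

(** * Limit of the sigma quotients *)

Definition tends (u : nat -> C) (l : C) : Prop :=
  forall eps, 0 < eps -> exists N0, forall N, (N0 <= N)%nat -> Cmod (u N - l) < eps.

Lemma tends_unique u l m : tends u l -> tends u m -> l = m.
Proof.
  intros H1 H2. apply NNPP. intros Hn. apply Cminus_neq0, Cmod_gt_0 in Hn.
  destruct (H1 (Cmod (l - m) / 2) ltac:(lra)) as [N1 K1]. destruct (H2 (Cmod (l - m) / 2) ltac:(lra)) as [N2 K2].
  specialize (K1 (max N1 N2) ltac:(lia)). specialize (K2 (max N1 N2) ltac:(lia)).
  rewrite Cmod_minus_sym in K1. pose proof (Cmod_triangle3 l (u (max N1 N2)) m). lra.
Qed.

Lemma tends_const c : tends (fun _ => c) c.
Proof. intros eps He. exists 0%nat. intros. rewrite Cmod_zero by ring. easy. Qed.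

Lemma tends_mult u v l m : tends u l -> tends v m -> tends (fun N => u N * v N)%C (l * m)%C.
Proof.
  intros Hu Hv eps He. pose proof (Cmod_ge_0 l) as L0. pose proof (Cmod_ge_0 m) as M0.
  set (e := Rmin 1 (eps / (2 * (Cmod l + Cmod m + 1)))).
  assert (Hd : 0 < 2 * (Cmod l + Cmod m + 1)) by lra.
  assert (He' : 0 < e) by (apply Rmin_pos; [lra|now apply Rdiv_lt_0_compat]).
  assert (e1 : e <= 1) by apply Rmin_l.
  assert (e2 : e * (2 * (Cmod l + Cmod m + 1)) <= eps).
  { apply Rle_div_r; [easy|]. apply Rmin_r. }
  destruct (Hu e He') as [N1 K1]. destruct (Hv e He') as [N2 K2]. exists (max N1 N2). intros N HN.
  specialize (K1 N ltac:(lia)). specialize (K2 N ltac:(lia)).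
  replace (u N * v N - l * m)%C with ((u N - l) * (v N - m) + (u N - l) * m + l * (v N - m))%C by ring.
  eapply Rle_lt_trans; [apply Cmod_triangle|].
  pose proof (Cmod_triangle ((u N - l) * (v N - m)) ((u N - l) * m)) as T. rewrite !Cmod_mult in *.
  pose proof (Cmod_ge_0 (u N - l)). pose proof (Cmod_ge_0 (v N - m)).
  assert (Cmod (u N - l) * Cmod (v N - m) <= e * 1) by (apply Rmult_le_compat; lra).
  assert (Cmod (u N - l) * Cmod m <= e * Cmod m) by (apply Rmult_le_compat_r; lra).
  assert (Cmod l * Cmod (v N - m) <= e * Cmod l) by (rewrite Rmult_comm; apply Rmult_le_compat_r; lra).
  nra.
Qed.

Lemma tends_eventually u v l N1 : (forall N, (N1 <= N)%nat -> u N = v N) -> tends u l -> tends v l.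
Proof.
  intros E H eps He. destruct (H eps He) as [N0 K]. exists (max N0 N1). intros N HN.
  rewrite <- E by lia. apply K. lia.
Qed.

Lemma tends_of_bound u l K N0 : 0 <= K -> (forall N, (N0 <= N)%nat -> Cmod (u N - l) <= K / INR N) -> tends u l.
Proof.
  intros HK H eps He. destruct (INR_unbounded ((K + 1) / eps)) as [M HM].
  exists (max N0 M). intros N HN. specialize (H N ltac:(lia)).
  assert (INR M <= INR N) by (apply le_INR; lia).
  assert (0 < (K + 1) / eps) by (apply Rdiv_lt_0_compat; lra).
  eapply Rle_lt_trans; [exact H|]. apply Rlt_div_l; [lra|].
  apply Rlt_div_l in HM; [|easy]. nra.
Qed.

(** Zeros are split off one at a time. The factors already removed do not vanish at the next point,
    since the points are distinct, so the zero there passes to the cofactor. *)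
Lemma holo_divide_wfactors {A} (lam : A -> C) f l : (forall a b, lam a = lam b -> a = b) ->
  holo f -> NoDup l -> (forall a, In a l -> lam a <> 0%C /\ f (lam a) = 0%C) ->
  exists g, holo g /\ forall z, f z = (prodl (fun a => wfactor z (lam a)) l * g z)%C.
Proof.
  intros Inj Hf Hl. induction Hl as [|a l Ha Hl IH]; intros H.
  - exists f. split; [easy|]. intros; unfold prodl; simpl; ring.
  - destruct IH as [g [Hg Eg]]; [intros; apply H; now right|].
    destruct (H a (or_introl eq_refl)) as [a0 fa].
    assert (ga : g (lam a) = 0%C).
    { rewrite Eg in fa. apply Cmult_integral in fa. destruct fa as [fa|fa]; [|easy].
      exfalso. revert fa. apply prodl_neq0. intros b Hb. apply wfactor_neq0; [apply H; now right|].
      intros E. apply Inj in E. now subst b. }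
    destruct (holo_divide g (lam a) Hg ga) as [h [Hh [Eh _]]].
    (* The zero-free factor by which [z - lam a] differs from [wfactor z (lam a)]. *)
    exists (fun z => (- lam a * cexp (- (z / lam a + RtoC (/ 2) * (z / lam a * (z / lam a)))) * h z)%C). split.
    + holos.
    + intros z. rewrite Eg, Eh, prodl_cons. unfold wfactor at 2. cbv zeta.
      set (u := (z / lam a + RtoC (/ 2) * (z / lam a * (z / lam a)))%C).
      transitivity (prodl (fun a => wfactor z (lam a)) l * ((1 - z / lam a) * - lam a * h z) * (cexp u * cexp (- u)))%C; [|ring].
      rewrite cexp_opp. field. easy.
Qed.

Lemma lat_inj w1 w2 : R_lin_indep w1 w2 -> forall a b, lat w1 w2 a = lat w1 w2 b -> a = b.
Proof.
  intros H [m n] [m' n'] E. unfold lat, lat_pt in E. simpl in E.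
  destruct (H (IZR m - IZR m') (IZR n - IZR n')) as [A B].
  - rewrite !RtoC_minus.
    transitivity (IZR m * w1 + IZR n * w2 - (IZR m' * w1 + IZR n' * w2))%C; [ring|rewrite E; ring].
  - f_equal; apply eq_IZR; lra.
Qed.

Lemma lat_neq0 w1 w2 a : R_lin_indep w1 w2 -> a <> (0%Z, 0%Z) -> lat w1 w2 a <> 0%C.
Proof.
  intros H Ha E. apply Ha. apply (lat_inj w1 w2 H). rewrite E. unfold lat, lat_pt. simpl. ring.
Qed.

Definition zeros_lattice (f : C -> C) (w1 w2 : C) : Prop :=
  sigma_like f /\ R_lin_indep w1 w2 /\ forall z, f z = 0%C <-> exists m n : Z, z = lat_pt w1 w2 m n.

(** [f] divided by the partial sigma products, expressed multiplicatively so that the identity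
    covers the zeros of these products. *)
Definition sigma_quotients (f : C -> C) (w1 w2 : C) (E : nat -> C -> C) : Prop :=
  (forall N, holo (E N)) /\ forall N z, f z = (z * sigma_partial w1 w2 z N * E N z)%C.

Lemma zeros_lattice_zero f w1 w2 a : zeros_lattice f w1 w2 -> f (lat w1 w2 a) = 0%C.
Proof. intros [_ [_ H]]. apply H. now exists (fst a), (snd a). Qed.

Lemma sigma_quotients_exist f w1 w2 : zeros_lattice f w1 w2 -> exists E, sigma_quotients f w1 w2 E.
Proof.
  intros HZ. assert (HZ' := HZ). destruct HZ' as [[Hf [Ho _]] [Hi Hz]].
  assert (K : forall N, exists g, holo g /\ forall z, f z = (z * sigma_partial w1 w2 z N * g z)%C).
  { intros N. destruct (holo_divide f 0%C Hf (odd_zero f Ho)) as [g [Hg [Eg _]]].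
    destruct (holo_divide_wfactors (lat w1 w2) g (box N) (lat_inj w1 w2 Hi) Hg (NoDup_box N)) as [h [Hh Eh]].
    - intros [m n] Ha. apply in_box in Ha. assert (L0 := lat_neq0 w1 w2 (m, n) Hi (proj2 Ha)).
      split; [easy|]. pose proof (zeros_lattice_zero f w1 w2 (m, n) HZ) as F. rewrite Eg in F.
      apply Cmult_integral in F. destruct F as [F|F]; [|easy]. exfalso. apply L0. rewrite <- F. ring.
    - exists h. split; [easy|]. intros z. rewrite Eg, Eh, sigma_partial_prodl. ring. }
  apply choice in K. destruct K as [E HE]. exists E. split; intros; apply HE.
Qed.

Lemma sigma_quotients_even f w1 w2 E : zeros_lattice f w1 w2 -> sigma_quotients f w1 w2 E ->
  forall N z, E N (- z)%C = E N z.
Proof.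
  intros [[Hf [Ho [[c Hc] _]]] _] [HE Ef] N.
  apply (quotient_even f (fun z => (z * sigma_partial w1 w2 z N)%C)); auto.
  - holos.
  - intros z. rewrite sigma_partial_even. ring.
  - exists c. intros E0. apply Hc. rewrite (Ef N), E0. ring.
Qed.

Lemma sigma_quotients_step f w1 w2 E : zeros_lattice f w1 w2 -> sigma_quotients f w1 w2 E ->
  forall N z, E N z = (prodl (fun mn => wfactor z (lat w1 w2 mn)) (shell N) * E (S N) z)%C.
Proof.
  intros [[_ [_ [[c Hc] _]]] _] [HE Ef] N z. apply Cminus_eq0.
  apply (holo_mult_zero (fun z => (z * sigma_partial w1 w2 z N)%C)
    (fun z => (E N z - prodl (fun mn => wfactor z (lat w1 w2 mn)) (shell N) * E (S N) z)%C)).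
  - holos.
  - pose proof (fun N => holo_prodl (fun z mn => wfactor z (lat w1 w2 mn)) (shell N) (fun _ => holo_wfactor _)).
    holos.
  - intros y. pose proof (Ef N y) as E1. pose proof (Ef (S N) y) as E2. rewrite sigma_partial_succ in E2.
    transitivity (f y - f y)%C; [rewrite E1 at 1; rewrite E2; ring|ring].
  - exists c. intros E0. apply Hc. rewrite (Ef N), E0. ring.
Qed.

(** In the disc of radius [k * N] every zero of [f] is already a zero of the partial product over
    [box N], and the zeros of [f] are simple. *)
Lemma sigma_quotients_neq0 f w1 w2 E : zeros_lattice f w1 w2 -> sigma_quotients f w1 w2 E ->
  exists k, 0 < k /\ forall N z, Cmod z <= k * INR N -> E N z <> 0%C.
Proof.
  intros HZ [HE Ef]. assert (HZ' := HZ). destruct HZ' as [Hs [Hi Hz]].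
  destruct (lat_lower_bound w1 w2 Hi) as [k [Hk LB]]. exists k. split; [easy|]. intros N z Hb Ez.
  assert (Fz : f z = 0%C) by (rewrite (Ef N), Ez; ring).
  apply (quotient_zero_free f (fun z => (z * sigma_partial w1 w2 z N)%C) (E N)) with z; auto.
  - holos.
  - intros y Fy. now apply sigma_like_D_zero.
  - apply Hz in Fz. destruct Fz as [m [n Emn]].
    destruct (classic ((m, n) = (0%Z, 0%Z))) as [E0|E0].
    + injection E0 as -> ->. rewrite Emn. unfold lat_pt at 1. simpl. ring.
    + rewrite sigma_partial_prodl, (prodl_eq0 _ _ (m, n)); [ring| |].
      * apply in_box. split; [|easy]. destruct (LB m n) as [L1 L2]. rewrite <- Emn in L1, L2.
        assert (Q : forall j, k * Rabs (IZR j) <= Cmod z -> (Z.abs j <= Z.of_nat N)%Z).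
        { intros j Hj. apply le_IZR. rewrite abs_IZR, <- INR_IZR_INZ.
          apply Rmult_le_reg_l with k; lra. }
        split; apply Q; easy.
      * change (wfactor z (lat_pt w1 w2 m n) = 0%C). rewrite <- Emn. apply wfactor_zero.
        rewrite Emn. now apply (lat_neq0 w1 w2 (m, n)).
Qed.

(** A layer has 8 (N + 1) factors, each within O(N^(-3)) of 1, so its product is within O(N^(-2)) of
    1. The bound is written as a difference of reciprocals to feed [telescoping_cauchy]; the bound
    1/2 will make the factors invertible with control. *)
Lemma shell_near1 w1 w2 B : R_lin_indep w1 w2 -> exists N0 c, (1 <= N0)%nat /\ 0 <= c /\
  forall N z, (N0 <= N)%nat -> Cmod z <= B ->
    Cmod (prodl (fun mn => wfactor z (lat w1 w2 mn)) (shell N) - 1) <= c * (/ INR N - / INR (S N)) /\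
    c * (/ INR N - / INR (S N)) <= 1 / 2.
Proof.
  intros Hi. destruct (lat_lower_bound w1 w2 Hi) as [k [Hk LB]].
  set (b := Rabs B). assert (b0 : 0 <= b) by apply Rabs_pos.
  set (g := 16 * exp 2 * (b / k) ^ 3).
  assert (bk : 0 <= b / k) by (apply Rdiv_le_0_compat; easy).
  assert (g0 : 0 <= g).
  { unfold g. pose proof (exp_pos 2). assert (0 <= (b / k) ^ 3) by now apply pow_le. nra. }
  destruct (INR_unbounded (4 * g + b / k + 1)) as [N0 HN0].
  exists N0, (2 * g). split; [|split; [lra|]].
  { apply INR_le. simpl INR. lra. }
  intros N z HN Hz.
  assert (HNr : INR N0 <= INR N) by now apply le_INR.
  rewrite S_INR. set (x := INR N) in *. assert (x1 : 1 <= x) by lra.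
  assert (Ex : 2 * g * (/ x - / (x + 1)) = 2 * g / (x * (x + 1))) by (field; lra).
  assert (Hh : 2 * g * (/ x - / (x + 1)) <= 1 / 2).
  { rewrite Ex. apply Rle_div_l; nra. }
  split; [|easy].
  set (e := 2 * exp 2 * (b / (k * (x + 1))) ^ 3).
  assert (bx : 0 <= b / (k * (x + 1))) by (apply Rdiv_le_0_compat; nra).
  assert (e0 : 0 <= e).
  { unfold e. pose proof (exp_pos 2). assert (0 <= (b / (k * (x + 1))) ^ 3) by now apply pow_le. nra. }
  assert (Le : INR (length (shell N)) * e <= g * (/ x - / (x + 1))).
  { rewrite length_shell, plus_INR, mult_INR. fold x. replace (INR 8) with 8 by (simpl; lra).
    apply Rle_trans with (g / ((x + 1) * (x + 1))).
    - right. unfold e, g. field. lra.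
    - replace (g * (/ x - / (x + 1))) with (g / (x * (x + 1))) by (field; lra).
      apply Rmult_le_compat_l; [easy|]. apply Rinv_le_contravar; nra. }
  eapply Rle_trans; [apply prodl_near1_small with (e := e)|]; [easy|lra| |lra].
  intros [m n] Ha. apply in_shell in Ha. destruct Ha as [Ha1 Ha2].
  assert (Hl : k * (x + 1) <= Cmod (lat w1 w2 (m, n))).
  { destruct (LB m n) as [L1 L2]. unfold lat. simpl fst. simpl snd.
    assert (Q : forall j, (Z.of_nat N < Z.abs j)%Z -> x + 1 <= Rabs (IZR j)).
    { intros j Hj. unfold x. rewrite <- abs_IZR, INR_IZR_INZ, <- plus_IZR. apply IZR_le. lia. }
    destruct Ha2 as [Ha2|Ha2]; apply Q in Ha2; nra. }
  assert (Hz' : Cmod z <= b) by (unfold b; pose proof (Rle_abs B); lra).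
  assert (Hbk : b <= k * (x + 1)).
  { apply Rle_trans with (k * (b / k)); [right; field; lra|]. apply Rmult_le_compat_l; lra. }
  assert (L0 : lat w1 w2 (m, n) <> 0%C) by (apply Cmod_gt_0; nra).
  eapply Rle_trans; [apply wfactor_near1; [easy|lra]|].
  unfold e. pose proof (exp_pos 2). apply Rmult_le_compat_l; [lra|]. apply pow_incr. split.
  - apply Rdiv_le_0_compat; [apply Cmod_ge_0|nra].
  - pose proof (Cmod_ge_0 z). unfold Rdiv. apply Rmult_le_compat; [easy| |easy|].
    + left. apply Rinv_0_lt_compat. nra.
    + apply Rinv_le_contravar; nra.
Qed.

(** The rate K / N is uniform on the disc, which will make the limit entire, and the nonvanishing of
    [l] is proved along with convergence. *)
Lemma sigma_quotients_cauchy f w1 w2 E : zeros_lattice f w1 w2 -> sigma_quotients f w1 w2 E ->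
  forall B, exists N0 K, 0 <= K /\ forall z, Cmod z <= B -> exists l : C, l <> 0%C /\
    forall N, (N0 <= N)%nat -> Cmod (E N z - l) <= K / INR N.
Proof.
  intros HZ HE B. destruct (sigma_quotients_neq0 f w1 w2 E HZ HE) as [k [Hk NZ]].
  assert (ST := sigma_quotients_step f w1 w2 E HZ HE).
  destruct (shell_near1 w1 w2 B (proj1 (proj2 HZ))) as [N1 [c [HN1 [Hc SH]]]].
  destruct (INR_unbounded (B / k)) as [N2 HN2].
  set (N0 := max N1 N2).
  assert (HN0 : 1 <= INR N0) by (apply (le_INR 1); lia).
  destruct (bounded_disc (E N0) B (holo_cont _ (proj1 HE N0))) as [M [HM0 HM]].
  set (M' := M * exp (2 * c)). pose proof (exp_pos (2 * c)) as ep.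
  assert (HM' : 0 < M') by (unfold M'; nra).
  exists N0, (2 * (M' * c)). split; [nra|]. intros z Hz.
  set (u := fun n => E (N0 + n)%nat z). set (q := fun n => / INR (N0 + n)).
  assert (qp : forall n, 0 < q n).
  { intros n. apply Rinv_0_lt_compat. rewrite plus_INR. pose proof (pos_INR n). lra. }
  assert (q0 : q 0%nat <= 1).
  { unfold q. rewrite Nat.add_0_r, <- Rinv_1. apply Rinv_le_contravar; lra. }
  assert (St : forall n, exists S, u n = (S * u (Datatypes.S n))%C /\ Cmod (S - 1) <= c * (q n - q (Datatypes.S n)) /\
     c * (q n - q (Datatypes.S n)) <= 1 / 2).
  { intros n. exists (prodl (fun mn => wfactor z (lat w1 w2 mn)) (shell (N0 + n))).
    unfold u, q. rewrite Nat.add_succ_r. split; [apply ST|]. apply SH; [lia|easy]. }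
  assert (Sp : forall n, 0 <= c * (q n - q (S n))).
  { intros n. destruct (St n) as [S0 [_ [A _]]]. pose proof (Cmod_ge_0 (S0 - 1)). lra. }
  (* Consecutive terms differ by a factor of modulus between 1 - x and 1 + x. With 0 <= x <= 1/2 one
     has (1 - x)(1 + 2 x) >= 1, so growth and decay are both bounded by exponentials of the
     telescoping sum c (q 0 - q n). *)
  assert (Up : forall n, Cmod (u n) <= Cmod (u 0%nat) * exp (2 * (c * (q 0%nat - q n))) /\
     Cmod (u 0%nat) <= Cmod (u n) * exp (c * (q 0%nat - q n))).
  { induction n as [|n [IH1 IH2]].
    - rewrite !Rminus_diag. rewrite Rmult_0_r, Rmult_0_r, exp_0. lra.
    - destruct (St n) as [S0 [Eu [A Ah]]]. specialize (Sp n).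
      set (x := c * (q n - q (S n))) in *.
      replace (2 * (c * (q 0%nat - q (S n)))) with (2 * (c * (q 0%nat - q n)) + 2 * x) by (unfold x; ring).
      replace (c * (q 0%nat - q (S n))) with (c * (q 0%nat - q n) + x) by (unfold x; ring).
      rewrite !exp_plus.
      pose proof (exp_ineq1_le (2 * x)) as X1. pose proof (exp_ineq1_le x) as X2.
      assert (S1 : 1 - x <= Cmod S0).
      { pose proof (Cmod_ge_sub 1 S0) as Q. rewrite Cmod_minus_sym, Cmod_1 in Q. lra. }
      assert (S2 : Cmod S0 <= 1 + x).
      { pose proof (Cmod_ge_sub S0 1) as Q. rewrite Cmod_1 in Q. lra. }
      rewrite Eu, Cmod_mult in IH1, IH2.
      pose proof (Cmod_ge_0 (u (S n))) as U0.
      set (v := Cmod (u (S n))) in *.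
      pose proof (exp_pos (2 * (c * (q 0%nat - q n)))). pose proof (exp_pos (c * (q 0%nat - q n))).
      split.
      + apply Rle_trans with (Cmod S0 * v * exp (2 * x)).
        * assert (1 <= Cmod S0 * exp (2 * x)).
          { apply Rle_trans with ((1 - x) * (1 + 2 * x)); [nra|]. apply Rmult_le_compat; lra. }
          nra.
        * rewrite <- Rmult_assoc. apply Rmult_le_compat_r; [apply Rlt_le, exp_pos|easy].
      + eapply Rle_trans; [exact IH2|].
        rewrite (Rmult_comm (exp (c * (q 0%nat - q n)))), <- Rmult_assoc.
        apply Rmult_le_compat_r; [lra|]. rewrite Rmult_comm. apply Rmult_le_compat_l; lra. }
  assert (UM : forall n, Cmod (u n) <= M').
  { intros n. destruct (Up n) as [A _]. eapply Rle_trans; [exact A|]. unfold M'.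
    apply Rmult_le_compat; [apply Cmod_ge_0|apply Rlt_le, exp_pos| |].
    - unfold u. rewrite Nat.add_0_r. now apply HM.
    - apply exp_le_compat. specialize (qp n). nra. }
  destruct (telescoping_cauchy u (fun n => M' * c * q n)) as [l Hl].
  - intros n. destruct (St n) as [S0 [Eu [A _]]]. rewrite Eu.
    replace (u (S n) - S0 * u (S n))%C with (- (u (S n) * (S0 - 1)))%C by ring.
    rewrite Cmod_opp, Cmod_mult.
    replace (M' * c * q n - M' * c * q (S n)) with (M' * (c * (q n - q (S n)))) by ring.
    apply Rmult_le_compat; [apply Cmod_ge_0|apply Cmod_ge_0|apply UM|easy].
  - intros n. specialize (qp n). assert (0 <= M' * c) by nra. nra.
  - intros eps He. destruct (INR_unbounded ((M' * c + 1) / eps)) as [n Hn]. exists n.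
    unfold q. assert (Q : INR n <= INR (N0 + n)) by (apply le_INR; lia).
    assert (0 <= M' * c) by nra.
    assert (0 < (M' * c + 1) / eps) by (apply Rdiv_lt_0_compat; lra).
    apply (Rlt_div_l (M' * c)); [lra|]. apply Rlt_div_l in Hn; [|easy]. nra.
  - exists l. split.
    (* By the second half of [Up], |u n| stays above |u 0| / exp c, while a zero limit would force
       |u n| below a multiple of 1 / (N0 + n). *)
    + intros El. subst l.
      assert (U0 : u 0%nat <> 0%C).
      { unfold u. rewrite Nat.add_0_r. apply NZ. eapply Rle_trans; [exact Hz|].
        assert (INR N2 <= INR N0) by (apply le_INR; lia).
        apply Rle_trans with (k * (B / k)); [right; field; lra|]. apply Rmult_le_compat_l; lra. }
      apply Cmod_gt_0 in U0. set (m := Cmod (u 0%nat) * / exp c).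
      assert (Hm : 0 < m) by (apply Rmult_lt_0_compat; [easy|apply Rinv_0_lt_compat, exp_pos]).
      assert (Lm : forall n, m <= Cmod (u n)).
      { intros n. destruct (Up n) as [_ A]. unfold m. apply (Rle_div_l (Cmod (u 0%nat))); [apply exp_pos|].
        eapply Rle_trans; [exact A|]. apply Rmult_le_compat_l; [apply Cmod_ge_0|]. apply exp_le_compat.
        specialize (qp n). nra. }
      assert (Mc : 0 <= M' * c) by nra.
      destruct (INR_unbounded (2 * (M' * c + 1) / m)) as [n Hn].
      specialize (Hl n). specialize (Lm n). replace (u n - 0)%C with (u n) in Hl by ring.
      assert (Q : INR n <= INR (N0 + n)) by (apply le_INR; lia).
      assert (P : 0 < 2 * (M' * c + 1) / m) by (apply Rdiv_lt_0_compat; lra).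
      assert (R1 : m <= 2 * (M' * c) / INR (N0 + n)).
      { replace (2 * (M' * c) / INR (N0 + n)) with (2 * (M' * c * q n)) by (unfold q; field; lra). lra. }
      apply Rle_div_r in R1; [|lra]. apply Rlt_div_l in Hn; [|easy]. nra.
    + intros N HN. specialize (Hl (N - N0)%nat). unfold u, q in Hl.
      replace (N0 + (N - N0))%nat with N in Hl by lia.
      replace (2 * (M' * c) / INR N) with (2 * (M' * c * / INR N)); [easy|].
      field. apply le_INR in HN. lra.
Qed.

Lemma sigma_quotients_limit f w1 w2 E : zeros_lattice f w1 w2 -> sigma_quotients f w1 w2 E ->
  exists F, holo F /\ (forall z, F z <> 0%C) /\ forall z, tends (fun N => E N z) (F z).
Proof.
  intros HZ HE. assert (HC := sigma_quotients_cauchy f w1 w2 E HZ HE).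
  assert (P : forall z, exists l : C, l <> 0%C /\ tends (fun N => E N z) l).
  { intros z. destruct (HC (Cmod z)) as [N0 [K [HK H]]]. destruct (H z (Rle_refl _)) as [l [l0 Hl]].
    exists l. split; [easy|]. now apply tends_of_bound with K N0. }
  apply choice in P. destruct P as [F HF]. exists F. split; [|split; intros z; apply HF].
  apply holo_limit with E; [apply HE|]. intros B eps He.
  destruct (HC B) as [N0 [K [HK H]]]. destruct (INR_unbounded ((K + 1) / eps)) as [M HM].
  exists (max N0 M). intros z Hz. destruct (H z Hz) as [l [l0 Hl]].
  assert (El : F z = l).
  { apply tends_unique with (fun N => E N z); [apply HF|]. now apply tends_of_bound with K N0. }
  rewrite El. eapply Rle_trans; [apply Hl; lia|].
  assert (INR M <= INR (max N0 M)) by (apply le_INR; lia).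
  assert (0 < (K + 1) / eps) by (apply Rdiv_lt_0_compat; lra).
  apply Rle_div_l; [lra|]. apply Rlt_div_l in HM; [|easy]. nra.
Qed.

(** * Quasi-periodicity of the limit *)

Lemma prodl_seq_shift (H : nat -> C) len a :
  (prodl (fun i => H (S i)) (seq a len) * H a = prodl H (seq a len) * H (a + len)%nat)%C.
Proof.
  revert a. induction len as [|len IH]; intros a.
  - simpl. rewrite Nat.add_0_r. unfold prodl. simpl. ring.
  - simpl seq. rewrite !prodl_cons. rewrite Nat.add_succ_r, <- Nat.add_succ_l.
    specialize (IH (S a)).
    transitivity (H a * (prodl (fun i => H (S i)) (seq (S a) len) * H (S a)))%C; [ring|]. rewrite IH. ring.
Qed.

Lemma prodl_zrange_shift (G : Z -> C) N :
  (prodl (fun m => G (m + 1)%Z) (zrange N) * G (- Z.of_nat N)%Z =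
   prodl G (zrange N) * G (Z.of_nat N + 1)%Z)%C.
Proof.
  unfold zrange. rewrite !prodl_map.
  pose proof (prodl_seq_shift (fun i => G (Z.of_nat i - Z.of_nat N)%Z) (2 * N + 1) 0) as E.
  cbv beta in E.
  rewrite (prodl_ext (fun i => G (Z.of_nat (S i) - Z.of_nat N)%Z) (fun i => G (Z.of_nat i - Z.of_nat N + 1)%Z)) in E.
  - replace (Z.of_nat (0 + (2 * N + 1)) - Z.of_nat N)%Z with (Z.of_nat N + 1)%Z in E by lia.
    replace (Z.of_nat 0 - Z.of_nat N)%Z with (- Z.of_nat N)%Z in E by lia. exact E.
  - intros i _. cbv beta. apply (f_equal G). lia.
Qed.

(** Moving the index window up and down by one alters the product only at its ends. The identity is
    cross-multiplied because values of [G] may vanish. *)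
Lemma prodl_zrange_double_shift (G : Z -> C) N :
  (prodl (fun m => G (m + 1)%Z) (zrange N) * prodl (fun m => G (m - 1)%Z) (zrange N) *
     (G (Z.of_nat N) * G (- Z.of_nat N)%Z) =
   prodl G (zrange N) * prodl G (zrange N) * (G (Z.of_nat N + 1)%Z * G (- (Z.of_nat N + 1))%Z))%C.
Proof.
  pose proof (prodl_zrange_shift G N) as E1.
  pose proof (prodl_zrange_shift (fun m => G (m - 1)%Z) N) as E2. cbv beta in E2.
  rewrite (prodl_ext (fun m => G (m + 1 - 1)%Z) G) in E2 by (intros; f_equal; lia).
  replace (Z.of_nat N + 1 - 1)%Z with (Z.of_nat N) in E2 by lia.
  replace (- Z.of_nat N - 1)%Z with (- (Z.of_nat N + 1))%Z in E2 by lia.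
  transitivity ((prodl (fun m => G (m + 1)%Z) (zrange N) * G (- Z.of_nat N)%Z) *
    (prodl (fun m => G (m - 1)%Z) (zrange N) * G (Z.of_nat N)))%C; [ring|].
  rewrite E1, <- E2. ring.
Qed.

(** The polynomial analogue of sigma on a finite box, origin included. Translation by [w1] moves
    each row, as defined next, onto the neighbouring one. *)
Definition box_poly (w1 w2 : C) (N : nat) (z : C) : C := prodl (fun mn => (z - lat w1 w2 mn)%C) (full_box N).
Definition row_poly (w1 w2 : C) (N : nat) (m : Z) (z : C) : C :=
  prodl (fun n => (z - lat_pt w1 w2 m n)%C) (zrange N).

Lemma box_poly_rows w1 w2 N z : box_poly w1 w2 N z = prodl (fun m => row_poly w1 w2 N m z) (zrange N).
Proof. unfold box_poly, full_box. now rewrite prodl_list_prod. Qed.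

Lemma row_poly_translate w1 w2 N m z (e : Z) :
  row_poly w1 w2 N m (z + RtoC (IZR e) * w1) = row_poly w1 w2 N (m - e) z.
Proof.
  apply prodl_ext. intros n _. unfold lat_pt. rewrite minus_IZR, RtoC_minus. ring.
Qed.

Lemma box_poly_second_difference w1 w2 N z :
  (box_poly w1 w2 N (z + w1) * box_poly w1 w2 N (z - w1) *
    (row_poly w1 w2 N (Z.of_nat N) z * row_poly w1 w2 N (- Z.of_nat N) z) =
   box_poly w1 w2 N z * box_poly w1 w2 N z *
    (row_poly w1 w2 N (Z.of_nat N + 1) z * row_poly w1 w2 N (- (Z.of_nat N + 1)) z))%C.
Proof.
  rewrite !box_poly_rows. rewrite <- (prodl_zrange_double_shift (fun m => row_poly w1 w2 N m z)).
  rewrite (prodl_ext (fun m => row_poly w1 w2 N m (z + w1)) (fun m => row_poly w1 w2 N (m - 1) z)).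
  - rewrite (prodl_ext (fun m => row_poly w1 w2 N m (z - w1)) (fun m => row_poly w1 w2 N (m + 1) z)).
    + ring.
    + intros m _. replace (z - w1)%C with (z + RtoC (IZR (-1)) * w1)%C by (simpl; ring).
      rewrite row_poly_translate. reflexivity || (f_equal; lia).
  - intros m _. replace (z + w1)%C with (z + RtoC (IZR 1) * w1)%C by (simpl; ring).
    apply row_poly_translate.
Qed.

(** [T N] compares the ratio of two adjacent boundary rows at [z] with the same ratio at [z0]. A
    single factor (z - l') / (z - l) is only 1 + O(1/N), too weak for a row of 2 N + 1 factors;
    after division by its value at [z0] it is 1 + (z - z0)(l' - l) / ((z - l)(z0 - l')), that is 1 +
    O(N^(-2)). The sign [s] selects the upper or lower side. *)
Lemma row_ratio_tends w1 w2 z z0 (s : Z) : R_lin_indep w1 w2 -> (s = 1 \/ s = -1)%Z ->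
  exists T, tends T 1 /\ exists N0, forall N, (N0 <= N)%nat ->
   (T N * (row_poly w1 w2 N (s * Z.of_nat N) z * row_poly w1 w2 N (s * (Z.of_nat N + 1)) z0) =
    row_poly w1 w2 N (s * (Z.of_nat N + 1)) z * row_poly w1 w2 N (s * Z.of_nat N) z0)%C.
Proof.
  intros Hi Hs. destruct (lat_lower_bound w1 w2 Hi) as [k [Hk LB]].
  set (fac := fun (N : nat) (n : Z) =>
    ((z - lat_pt w1 w2 (s * (Z.of_nat N + 1)) n) * (z0 - lat_pt w1 w2 (s * Z.of_nat N) n) /
     ((z - lat_pt w1 w2 (s * Z.of_nat N) n) * (z0 - lat_pt w1 w2 (s * (Z.of_nat N + 1)) n)))%C).
  set (W := Cmod (z - z0) * Cmod w1). assert (HW : 0 <= W) by (apply Rmult_le_pos; apply Cmod_ge_0).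
  pose proof (Cmod_ge_0 z) as Pz. pose proof (Cmod_ge_0 z0) as Pz0.
  destruct (INR_unbounded (2 * (Cmod z + Cmod z0) / k + 24 * W / (k * k) + 1)) as [N0 HN0].
  assert (A1 : 0 <= 2 * (Cmod z + Cmod z0) / k) by (apply Rdiv_le_0_compat; lra).
  assert (A2 : 0 <= 24 * W / (k * k)) by (apply Rdiv_le_0_compat; nra).
  assert (Far : forall N y j n, (N0 <= N)%nat -> (Z.of_nat N <= j)%Z -> Cmod y <= Cmod z + Cmod z0 ->
    k * INR N / 2 <= Cmod (y - lat_pt w1 w2 (s * j) n)).
  { intros N y j n HN Hj Hy. destruct (LB (s * j)%Z n) as [L1 _].
    assert (Q : INR N <= Rabs (IZR (s * j))).
    { rewrite <- abs_IZR, INR_IZR_INZ. apply IZR_le. destruct Hs as [-> | ->]; lia. }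
    assert (HNr : INR N0 <= INR N) by now apply le_INR.
    assert (Y : Cmod y <= k * INR N / 2).
    { eapply Rle_trans; [exact Hy|]. apply Rle_trans with (k * (2 * (Cmod z + Cmod z0) / k) / 2).
      - right. field. lra.
      - apply Rmult_le_compat_r; [lra|]. apply Rmult_le_compat_l; lra. }
    pose proof (Cmod_ge_sub (lat_pt w1 w2 (s * j) n) y) as T. rewrite Cmod_minus_sym in T. nra. }
  exists (fun N => prodl (fac N) (zrange N)). split.
  - apply tends_of_bound with (24 * W / (k * k)) N0; [easy|]. intros N HN.
    assert (HNr : INR N0 <= INR N) by now apply le_INR.
    set (x := INR N) in *. assert (x1 : 1 <= x) by lra.
    set (e := W / ((k * x / 2) * (k * x / 2))).
    assert (kx : 0 < k * x / 2) by nra.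
    assert (e0 : 0 <= e) by (apply Rdiv_le_0_compat; nra).
    assert (Le : INR (length (zrange N)) * e <= 12 * W / (k * k) / x).
    { rewrite length_zrange, plus_INR, mult_INR. fold x. simpl INR.
      apply Rle_trans with (3 * x * e); [apply Rmult_le_compat_r; lra|]. right. unfold e. field. lra. }
    assert (Sm : 12 * W / (k * k) / x <= 1 / 2).
    { apply Rle_div_l; [lra|]. replace (24 * W / (k * k)) with (2 * (12 * W / (k * k))) in * by (field; lra). lra. }
    apply Rle_trans with (2 * (INR (length (zrange N)) * e)).
    2:{ replace (24 * W / (k * k) / x) with (2 * (12 * W / (k * k) / x)) by (field; lra). lra. }
    apply prodl_near1_small; [easy|lra|]. intros n _.
    set (l := lat_pt w1 w2 (s * Z.of_nat N) n). set (l' := lat_pt w1 w2 (s * (Z.of_nat N + 1)) n).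
    assert (F1 : k * x / 2 <= Cmod (z - l)) by (apply Far; [easy|lia|lra]).
    assert (F2 : k * x / 2 <= Cmod (z0 - l')) by (apply Far; [easy|lia|lra]).
    assert (N1 : (z - l)%C <> 0%C) by (apply Cmod_gt_0; lra).
    assert (N2 : (z0 - l')%C <> 0%C) by (apply Cmod_gt_0; lra).
    replace (fac N n - 1)%C with ((z - z0) * (l' - l) / ((z - l) * (z0 - l')))%C.
    2:{ unfold fac. fold l l'. field. easy. }
    assert (El : Cmod (l' - l) = Cmod w1).
    { replace (l' - l)%C with (RtoC (IZR s) * w1)%C.
      - rewrite Cmod_mult, Cmod_R, <- abs_IZR. replace (Z.abs s) with 1%Z by (destruct Hs as [-> | ->]; reflexivity). ring.
      - unfold l, l', lat_pt. rewrite !mult_IZR, plus_IZR, !RtoC_mult, RtoC_plus. ring. }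
    rewrite Cmod_div, !Cmod_mult, El.
    + fold W. unfold e. unfold Rdiv. apply Rmult_le_compat_l; [easy|]. apply Rinv_le_contravar; [nra|].
      apply Rmult_le_compat; lra.
    + intros Q. apply Cmult_integral in Q. tauto.
  - exists N0. intros N HN. unfold row_poly. rewrite <- !prodl_mult. apply prodl_ext. intros n _.
    assert (HNr : INR N0 <= INR N) by now apply le_INR.
    assert (kx : 0 < k * INR N / 2) by nra.
    assert (N1 : (z - lat_pt w1 w2 (s * Z.of_nat N) n)%C <> 0%C).
    { apply Cmod_gt_0. eapply Rlt_le_trans; [exact kx|]. apply Far; [easy|lia|lra]. }
    assert (N2 : (z0 - lat_pt w1 w2 (s * (Z.of_nat N + 1)) n)%C <> 0%C).
    { apply Cmod_gt_0. eapply Rlt_le_trans; [exact kx|]. apply Far; [easy|lia|lra]. }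
    unfold fac. field. easy.
Qed.

(* The exponent is quadratic in [z], so its second differences do not depend on [z]. *)
Definition wcofactor (z l : C) : C := (- l * cexp (- (z / l + RtoC (/ 2) * (z / l * (z / l)))))%C.

Lemma wfactor_wcofactor (z l : C) : l <> 0%C -> (wfactor z l * wcofactor z l = z - l)%C.
Proof.
  intros H. unfold wfactor, wcofactor. cbv zeta. set (u := (z / l + RtoC (/ 2) * (z / l * (z / l)))%C).
  transitivity ((1 - z / l) * - l * (cexp u * cexp (- u)))%C; [ring|]. rewrite cexp_opp. field. easy.
Qed.

Lemma wcofactor_second_difference (z w l : C) :
  (wcofactor (z + w) l * wcofactor (z - w) l = wcofactor z l * wcofactor z l * cexp (- (w / l * (w / l))))%C.
Proof.
  unfold wcofactor.
  transitivity (- l * - l * (cexp (- ((z + w) / l + RtoC (/ 2) * ((z + w) / l * ((z + w) / l)))) *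
    cexp (- ((z - w) / l + RtoC (/ 2) * ((z - w) / l * ((z - w) / l))))))%C; [ring|].
  rewrite <- cexp_plus.
  set (u := (- (z / l + RtoC (/ 2) * (z / l * (z / l))))%C).
  transitivity (- l * - l * (cexp u * cexp u * cexp (- (w / l * (w / l)))))%C; [|ring].
  rewrite <- !cexp_plus. do 2 f_equal. unfold u, Cdiv. rewrite RtoC_inv by lra. set (i := (/ l)%C). field.
Qed.

(** Multiplying by the cofactors turns each [wfactor] into a linear factor, and the origin of the
    full box accounts for the leading factor [z]. *)
Lemma sigma_quotients_box_poly f w1 w2 E : zeros_lattice f w1 w2 -> sigma_quotients f w1 w2 E ->
  forall N z, (f z * prodl (fun mn => wcofactor z (lat w1 w2 mn)) (box N) = box_poly w1 w2 N z * E N z)%C.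
Proof.
  intros [_ [Hi _]] [_ Ef] N z. rewrite (Ef N), sigma_partial_prodl.
  unfold box_poly. rewrite (prodl_perm _ _ _ (full_box_perm N)), prodl_cons.
  rewrite (prodl_ext (fun mn => (z - lat w1 w2 mn)%C)
    (fun mn => (wfactor z (lat w1 w2 mn) * wcofactor z (lat w1 w2 mn))%C) (box N)).
  - rewrite prodl_mult. unfold lat at 3, lat_pt. simpl. ring.
  - intros [m n] Ha. symmetry. apply wfactor_wcofactor. apply lat_neq0; [easy|]. now apply in_box in Ha.
Qed.

Lemma box_poly_neq0 f w1 w2 N z : zeros_lattice f w1 w2 -> f z <> 0%C -> box_poly w1 w2 N z <> 0%C.
Proof.
  intros [_ [_ Hz]] Fz. apply prodl_neq0. intros [m n] _ Q. apply Fz, Hz. exists m, n. now apply Cminus_eq0.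
Qed.

Lemma row_poly_neq0 f w1 w2 N m z : zeros_lattice f w1 w2 -> f z <> 0%C -> row_poly w1 w2 N m z <> 0%C.
Proof.
  intros [_ [_ Hz]] Fz. apply prodl_neq0. intros n _ Q. apply Fz, Hz. exists m, n. now apply Cminus_eq0.
Qed.

(** Three multiplicative second differences are combined: that of [f] is a constant by
    [sigma_like_shift], that of the cofactors is a constant, and that of [box_poly] consists of
    boundary rows. The constant [k] depends on [N]. *)
Lemma sigma_quotients_second_difference f w1 w2 E N : zeros_lattice f w1 w2 -> sigma_quotients f w1 w2 E ->
  exists k : C, k <> 0%C /\ forall z, f z <> 0%C ->
  (row_poly w1 w2 N (Z.of_nat N + 1) z * row_poly w1 w2 N (- (Z.of_nat N + 1)) z * (E N (z + w1) * E N (z - w1)) =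
   k * (row_poly w1 w2 N (Z.of_nat N) z * row_poly w1 w2 N (- Z.of_nat N) z) * (E N z * E N z))%C.
Proof.
  intros HZ HE. assert (BP := sigma_quotients_box_poly f w1 w2 E HZ HE N).
  assert (Fw : f w1 = 0%C).
  { rewrite <- (zeros_lattice_zero f w1 w2 (1%Z, 0%Z) HZ). f_equal. unfold lat, lat_pt. simpl. ring. }
  destruct (sigma_like_shift f w1 (proj1 HZ) Fw) as [k [Hk Sh]].
  set (VV := fun z => prodl (fun mn => wcofactor z (lat w1 w2 mn)) (box N)).
  change (forall z, (f z * VV z = box_poly w1 w2 N z * E N z)%C) in BP.
  set (e := prodl (fun mn => cexp (- (w1 / lat w1 w2 mn * (w1 / lat w1 w2 mn)))) (box N)).
  assert (e0 : e <> 0%C) by (apply prodl_neq0; intros; apply cexp_neq0).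
  assert (EV : forall z, (VV (z + w1) * VV (z - w1) = VV z * VV z * e)%C).
  { intros z. unfold VV, e. rewrite <- !prodl_mult. apply prodl_ext. intros mn _. apply wcofactor_second_difference. }
  exists (k * e)%C. split; [intros Q; apply Cmult_integral in Q; tauto|].
  intros z Fz. assert (G0 := box_poly_neq0 f w1 w2 N z HZ Fz).
  pose proof (box_poly_second_difference w1 w2 N z) as SD.
  set (Up := (row_poly w1 w2 N (Z.of_nat N + 1) z * row_poly w1 w2 N (- (Z.of_nat N + 1)) z)%C) in *.
  set (Lo := (row_poly w1 w2 N (Z.of_nat N) z * row_poly w1 w2 N (- Z.of_nat N) z)%C) in *.
  set (G := box_poly w1 w2 N) in *.
  assert (Q : (G z * G z * (Up * (E N (z + w1) * E N (z - w1)) - k * e * Lo * (E N z * E N z)) = 0)%C).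
  { transitivity ((G z * G z * Up) * (E N (z + w1) * E N (z - w1)) - k * e * Lo * ((G z * E N z) * (G z * E N z)))%C; [ring|].
    rewrite <- SD, <- BP.
    transitivity (Lo * ((G (z + w1) * E N (z + w1)) * (G (z - w1) * E N (z - w1))) - Lo * ((k * (f z * f z)) * (VV z * VV z * e)))%C; [ring|].
    rewrite <- !BP, <- Sh, <- EV. ring. }
  apply Cmult_integral in Q. destruct Q as [Q|Q]; [apply Cmult_integral in Q; tauto|].
  now apply Cminus_eq0.
Qed.

(** The constant of the previous lemma varies with [N] in an uncontrolled way, so the relations at
    [z] and at a fixed [z0] are divided by each other before passing to the limit; the boundary rows
    then enter through two factors tending to 1. *)
Lemma limit_second_difference f w1 w2 E F : zeros_lattice f w1 w2 -> sigma_quotients f w1 w2 E ->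
  holo F -> (forall z, F z <> 0%C) -> (forall z, tends (fun N => E N z) (F z)) ->
  exists k : C, k <> 0%C /\ forall z, (F (z + w1) * F (z - w1) = k * (F z * F z))%C.
Proof.
  intros HZ HE HF F0 LF. assert (HZ' := HZ). destruct HZ' as [[Hf [_ [[z0 Hz0] _]]] [Hi _]].
  assert (Key : forall z, f z <> 0%C ->
    (F (z + w1) * F (z - w1) * (F z0 * F z0) = F (z0 + w1) * F (z0 - w1) * (F z * F z))%C).
  { intros z Fz.
    destruct (row_ratio_tends w1 w2 z z0 1 Hi (or_introl eq_refl)) as [T1 [LT1 [M1 E1]]].
    destruct (row_ratio_tends w1 w2 z z0 (-1) Hi (or_intror eq_refl)) as [T2 [LT2 [M2 E2]]].
    apply tends_unique with (fun N => (E N (z + w1)%C * E N (z - w1)%C * (E N z0 * E N z0) * (T1 N * T2 N))%C).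
    - rewrite <- (Cmult_1_r (F (z + w1) * F (z - w1) * (F z0 * F z0))%C), <- (Cmult_1_r 1).
      repeat apply tends_mult; auto.
    - apply tends_eventually with (u := fun N => (E N (z0 + w1)%C * E N (z0 - w1)%C * (E N z * E N z))%C) (N1 := max M1 M2).
      2:{ repeat apply tends_mult; auto. }
      intros N HN. specialize (E1 N ltac:(lia)). specialize (E2 N ltac:(lia)).
      rewrite !Z.mul_1_l in E1.
      replace (-1 * (Z.of_nat N + 1))%Z with (- (Z.of_nat N + 1))%Z in E2 by lia.
      replace (-1 * Z.of_nat N)%Z with (- Z.of_nat N)%Z in E2 by lia.
      destruct (sigma_quotients_second_difference f w1 w2 E N HZ HE) as [k [Hk SD]].
      assert (S1 := SD z Fz). assert (S2 := SD z0 Hz0).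
      assert (RN := fun m y => row_poly_neq0 f w1 w2 N m y HZ).
      assert (Ra := RN (Z.of_nat N) z Fz). assert (Rb := RN (- Z.of_nat N)%Z z Fz).
      assert (Rc := RN (Z.of_nat N + 1)%Z z0 Hz0). assert (Rd := RN (- (Z.of_nat N + 1))%Z z0 Hz0).
      set (a := row_poly w1 w2 N (Z.of_nat N) z) in *. set (b := row_poly w1 w2 N (- Z.of_nat N) z) in *.
      set (c := row_poly w1 w2 N (Z.of_nat N + 1) z0) in *. set (d := row_poly w1 w2 N (- (Z.of_nat N + 1)) z0) in *.
      set (a' := row_poly w1 w2 N (Z.of_nat N) z0) in *. set (b' := row_poly w1 w2 N (- Z.of_nat N) z0) in *.
      set (c' := row_poly w1 w2 N (Z.of_nat N + 1) z) in *. set (d' := row_poly w1 w2 N (- (Z.of_nat N + 1)) z) in *.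
      set (X := (E N (z + w1)%C * E N (z - w1)%C)%C) in *. set (X0 := (E N (z0 + w1)%C * E N (z0 - w1)%C)%C) in *.
      set (Y := (E N z * E N z)%C) in *. set (Y0 := (E N z0 * E N z0)%C) in *.
      (* The rows in this product are nonzero because [f] vanishes neither at [z] nor at [z0], so
         the bracket can be isolated. *)
      assert (P : (k * (a * b * c * d) * (X * Y0 * (T1 N * T2 N) - X0 * Y) = 0)%C).
      { transitivity (k * X * Y0 * ((T1 N * (a * c)) * (T2 N * (b * d))) - (c * d * X0) * (k * (a * b) * Y))%C; [ring|].
        rewrite E1, E2, S2, <- S1. ring. }
      symmetry. apply Cminus_eq0. apply Cmult_integral in P. destruct P as [P|P]; [exfalso|exact P].
      repeat (apply Cmult_integral in P; destruct P as [P|P]; try easy). }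
  exists (F (z0 + w1) * F (z0 - w1) / (F z0 * F z0))%C. split.
  - intros Q. apply (f_equal (fun x => x * (F z0 * F z0))%C) in Q.
    replace (F (z0 + w1) * F (z0 - w1) / (F z0 * F z0) * (F z0 * F z0))%C with (F (z0 + w1) * F (z0 - w1))%C in Q by (field; auto).
    rewrite Cmult_0_l in Q. apply Cmult_integral in Q. destruct Q as [Q|Q]; now apply F0 in Q.
  - intros z. apply Cminus_eq0.
    apply (holo_mult_zero f (fun z => (F (z + w1) * F (z - w1) - F (z0 + w1) * F (z0 - w1) / (F z0 * F z0) * (F z * F z))%C)); auto.
    + holos.
    + intros y. destruct (classic (f y = 0%C)) as [Fy|Fy]; [rewrite Fy; ring|].
      specialize (Key y Fy).
      replace (F (y + w1) * F (y - w1))%C with (F (y + w1) * F (y - w1) * (F z0 * F z0) / (F z0 * F z0))%C by (field; auto).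
      rewrite Key. field. auto.
    + now exists z0.
Qed.

(** * Growth from constant second differences along a lattice *)

Lemma second_difference_Z (a : Z -> R) k : (forall n, a (n + 1)%Z + a (n - 1)%Z - 2 * a n = k) ->
  forall n, a n = a 0%Z + IZR n * (a 1%Z - a 0%Z) + IZR n * (IZR n - 1) / 2 * k.
Proof.
  intros H.
  set (b := fun n => a n - (a 0%Z + IZR n * (a 1%Z - a 0%Z) + IZR n * (IZR n - 1) / 2 * k)).
  assert (Hb : forall n, b (n + 1)%Z + b (n - 1)%Z = 2 * b n).
  { intros n. unfold b. rewrite plus_IZR, minus_IZR. specialize (H n). nra. }
  assert (K : forall n, b n = 0 /\ b (n + 1)%Z = 0).
  { intros n. induction n as [|n IH|n IH] using Z.peano_ind.
    - unfold b. simpl. split; field.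
    - unfold Z.succ. split; [easy|]. specialize (Hb (n + 1)%Z).
      replace (n + 1 - 1)%Z with n in Hb by lia. lra.
    - unfold Z.pred. replace (n + -1 + 1)%Z with n by lia. specialize (Hb n).
      replace (n - 1)%Z with (n + -1)%Z in Hb by lia. lra. }
  intros n. destruct (K n) as [Q _]. unfold b in Q. lra.
Qed.

(** Integrality matters: for real arguments close to 0 the inequality fails. *)
Lemma int_sq_bound n : Rabs (IZR n * (IZR n - 1) / 2) <= Rabs (IZR n) * Rabs (IZR n).
Proof.
  rewrite <- Rabs_mult. rewrite (Rabs_pos_eq (IZR n * IZR n)) by nra.
  destruct (Z.le_gt_cases 1 n) as [H|H].
  - apply IZR_le in H. apply Rabs_le. nra.
  - destruct (Z.eq_dec n 0) as [-> |H0].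
    + replace (0 * (0 - 1) / 2) with 0 by field. rewrite Rabs_R0. lra.
    + assert (Q : (n <= -1)%Z) by lia. apply IZR_le in Q. apply Rabs_le. nra.
Qed.

Lemma second_difference_bound (a : Z -> R) k U0 n : (forall n, a (n + 1)%Z + a (n - 1)%Z - 2 * a n = k) ->
  Rabs (a 0%Z) <= U0 -> Rabs (a 1%Z) <= U0 ->
  Rabs (a n) <= U0 * (1 + 2 * Rabs (IZR n)) + Rabs k * (Rabs (IZR n) * Rabs (IZR n)).
Proof.
  intros H H0 H1. rewrite (second_difference_Z a k H n).
  eapply Rle_trans; [apply Rabs_triang|]. apply Rplus_le_compat.
  - eapply Rle_trans; [apply Rabs_triang|]. rewrite Rabs_mult.
    pose proof (Rabs_triang (a 1%Z) (- a 0%Z)) as T. rewrite Rabs_Ropp in T.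
    pose proof (Rabs_pos (IZR n)). unfold Rminus. nra.
  - rewrite Rabs_mult, Rmult_comm. apply Rmult_le_compat_l; [apply Rabs_pos|apply int_sq_bound].
Qed.

(** log |F| is bounded near the origin, and moving along [w2] makes it at most quadratic. For the
    motion along [w1] the initial values are then already quadratic, and the linear term of
    [second_difference_bound] multiplies them by 1 + 2 |m|; this is the origin of the exponent 3. *)
Lemma lattice_quasi_periodic_growth F w1 w2 : R_lin_indep w1 w2 -> holo F -> (forall z, F z <> 0%C) ->
  (exists k : C, k <> 0%C /\ forall z, (F (z + w1) * F (z - w1) = k * (F z * F z))%C) ->
  (exists k : C, k <> 0%C /\ forall z, (F (z + w2) * F (z - w2) = k * (F z * F z))%C) ->
  exists K, 0 <= K /\ forall z, Cmod (F z) <= exp (K * (1 + Cmod z) ^ 3).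
Proof.
  intros Hi HF F0 [k1 [k10 R1]] [k2 [k20 R2]].
  set (u := fun z => ln (Cmod (F z))).
  assert (Fp : forall z, 0 < Cmod (F z)) by (intros; now apply Cmod_gt_0).
  assert (SD : forall k w : C, (k <> 0)%C -> (forall z, (F (z + w) * F (z - w) = k * (F z * F z))%C) ->
    forall z, u (z + w)%C + u (z - w)%C - 2 * u z = ln (Cmod k)).
  { intros k w Hk R z. specialize (R z). apply (f_equal Cmod) in R. rewrite !Cmod_mult in R.
    apply (f_equal ln) in R. apply Cmod_gt_0 in Hk.
    rewrite !ln_mult in R; auto; [|now apply Rmult_lt_0_compat]. unfold u. lra. }
  set (T := Cmod w1 + Cmod w2).
  pose proof (Cmod_ge_0 w1) as P1. pose proof (Cmod_ge_0 w2) as P2.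
  (* A reduced point has modulus at most T / 2; adding [w1] stays within 2 T and then [w2] within 3
     T. Bounds on both [F] and [1 / F] are taken, so that log |F| is bounded on both sides. *)
  destruct (bounded_disc F (3 * T) (holo_cont F HF)) as [M1 [HM1 B1]].
  destruct (bounded_disc (fun z => (/ F z)%C) (3 * T) (holo_cont _ (holo_inv F HF F0))) as [M2 [HM2 B2]].
  set (U := M1 + M2).
  assert (HU : forall z, Cmod z <= 3 * T -> Rabs (u z) <= U).
  { intros z Hz. specialize (B1 z Hz). specialize (B2 z Hz). cbv beta in B2. rewrite Cmod_inv in B2 by auto.
    assert (L : forall x, 0 < x -> ln x <= x).
    { intros x Hx. pose proof (exp_ineq1_le (ln x)). rewrite exp_ln in H by easy. lra. }
    specialize (Fp z). unfold u. apply Rabs_le. unfold U.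
    pose proof (L _ Fp). assert (I := L _ (Rinv_0_lt_compat _ Fp)). rewrite ln_Rinv in I by easy. lra. }
  assert (U0 : 0 <= U) by (unfold U; lra).
  destruct (lat_lower_bound w1 w2 Hi) as [k [Hk LB]].
  set (c2 := 2 * U + Rabs (ln (Cmod k2))). set (c1 := 2 * c2 + Rabs (ln (Cmod k1))).
  pose proof (Rabs_pos (ln (Cmod k1))) as a1. pose proof (Rabs_pos (ln (Cmod k2))) as a2.
  assert (c20 : 0 <= c2) by (unfold c2; lra). assert (c10 : 0 <= c1) by (unfold c1; lra).
  assert (kT : 0 <= (1 + T) / k) by (apply Rdiv_le_0_compat; unfold T; lra).
  assert (Step2 : forall t n, Cmod t <= 2 * T -> Rabs (u (t + RtoC (IZR n) * w2)%C) <= c2 * (1 + Rabs (IZR n)) ^ 2).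
  { intros t n Ht.
    assert (Q := second_difference_bound (fun n => u (t + RtoC (IZR n) * w2)%C) (ln (Cmod k2)) U n).
    cbv beta in Q. eapply Rle_trans; [apply Q|].
    - intros j. rewrite plus_IZR, minus_IZR, RtoC_plus, RtoC_minus.
      replace (t + (RtoC (IZR j) + 1) * w2)%C with (t + RtoC (IZR j) * w2 + w2)%C by ring.
      replace (t + (RtoC (IZR j) - 1) * w2)%C with (t + RtoC (IZR j) * w2 - w2)%C by ring.
      now apply SD.
    - apply HU. replace (t + RtoC (IZR 0) * w2)%C with t by (simpl; ring). unfold T in *. lra.
    - apply HU. replace (t + RtoC (IZR 1) * w2)%C with (t + w2)%C by (simpl; ring).
      pose proof (Cmod_triangle t w2). unfold T in *. lra.
    - pose proof (Rabs_pos (IZR n)). unfold c2. nra. }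
  exists (c1 * (1 + (1 + T) / k) ^ 3). split.
  { apply Rmult_le_pos; [easy|]. apply pow_le. lra. }
  intros z. apply Rnot_lt_le. intros Hl.
  apply ln_increasing in Hl; [|apply exp_pos]. rewrite ln_exp in Hl. fold (u z) in Hl. revert Hl. apply Rle_not_lt.
  eapply Rle_trans; [apply Rle_abs|].
  destruct (R_basis_coords w1 w2 z Hi) as [x [y Ez]].
  destruct (nearest_integer x) as [m Hm]. destruct (nearest_integer y) as [n Hn].
  set (t := (RtoC (x - IZR m) * w1 + RtoC (y - IZR n) * w2)%C).
  assert (Et : (z = t + lat_pt w1 w2 m n)%C) by (rewrite Ez; unfold t, lat_pt; rewrite !RtoC_minus; ring).
  assert (Tt : 2 * Cmod t <= T).
  { unfold t, T. pose proof (Cmod_triangle (RtoC (x - IZR m) * w1) (RtoC (y - IZR n) * w2)) as Q.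
    rewrite !Cmod_mult, !Cmod_R in Q. nra. }
  set (mu := (1 + T) / k * (1 + Cmod z)).
  pose proof (Cmod_ge_0 z) as Pz. pose proof (Cmod_ge_0 t) as Pt.
  assert (Hmn : Rabs (IZR m) <= mu /\ Rabs (IZR n) <= mu).
  { destruct (LB m n) as [L1 L2].
    assert (Q : Cmod (lat_pt w1 w2 m n) <= Cmod z + T).
    { replace (lat_pt w1 w2 m n) with (z - t)%C by (rewrite Et; ring). pose proof (Cmod_le_add z t). lra. }
    assert (Q2 : Cmod z + T <= k * mu).
    { unfold mu. replace (k * ((1 + T) / k * (1 + Cmod z))) with ((1 + T) * (1 + Cmod z)) by (field; lra).
      unfold T in *. nra. }
    split; apply Rmult_le_reg_l with k; lra. }
  assert (mu0 : 0 <= mu) by (unfold mu; apply Rmult_le_pos; lra).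
  assert (Hz3 : (1 + mu) ^ 3 <= (1 + (1 + T) / k) ^ 3 * (1 + Cmod z) ^ 3).
  { rewrite <- Rpow_mult_distr. apply pow_incr. split; [lra|]. unfold mu. nra. }
  assert (Main : Rabs (u z) <= c1 * (1 + mu) ^ 3).
  2:{ eapply Rle_trans; [exact Main|]. rewrite Rmult_assoc. now apply Rmult_le_compat_l. }
  assert (Q := second_difference_bound (fun m => u (t + RtoC (IZR n) * w2 + RtoC (IZR m) * w1)%C)
    (ln (Cmod k1)) (c2 * (1 + mu) ^ 2) m).
  cbv beta in Q.
  assert (mu2 : forall t, Cmod t <= 2 * T -> Rabs (u (t + RtoC (IZR n) * w2)%C) <= c2 * (1 + mu) ^ 2).
  { intros t' Ht'. eapply Rle_trans; [now apply Step2|]. apply Rmult_le_compat_l; [easy|].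
    apply pow_incr. pose proof (Rabs_pos (IZR n)). lra. }
  replace (u z) with (u (t + RtoC (IZR n) * w2 + RtoC (IZR m) * w1)%C).
  2:{ f_equal. rewrite Et. unfold lat_pt. ring. }
  eapply Rle_trans; [apply Q|].
  - intros j. rewrite plus_IZR, minus_IZR, RtoC_plus, RtoC_minus.
    replace (t + IZR n * w2 + (RtoC (IZR j) + 1) * w1)%C with (t + RtoC (IZR n) * w2 + RtoC (IZR j) * w1 + w1)%C by ring.
    replace (t + IZR n * w2 + (RtoC (IZR j) - 1) * w1)%C with (t + RtoC (IZR n) * w2 + RtoC (IZR j) * w1 - w1)%C by ring.
    now apply SD.
  - replace (t + RtoC (IZR n) * w2 + RtoC (IZR 0) * w1)%C with (t + RtoC (IZR n) * w2)%C by (simpl; ring).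
    apply mu2. lra.
  - replace (t + RtoC (IZR n) * w2 + RtoC (IZR 1) * w1)%C with (t + w1 + RtoC (IZR n) * w2)%C by (simpl; ring).
    apply mu2. pose proof (Cmod_triangle t w1). unfold T in *. lra.
  - destruct Hmn as [Hm' _]. pose proof (Rabs_pos (IZR m)) as m0.
    set (r := Rabs (IZR m)) in *. unfold c1.
    assert (S1 : c2 * (1 + mu) ^ 2 * (1 + 2 * r) <= c2 * (1 + mu) ^ 2 * (2 * (1 + mu))).
    { apply Rmult_le_compat_l; [|lra]. apply Rmult_le_pos; [easy|apply pow_le; lra]. }
    assert (S2 : r * r <= (1 + mu) ^ 3).
    { apply Rle_trans with ((1 + mu) * (1 + mu) * 1); [nra|]. simpl.
      replace ((1 + mu) * ((1 + mu) * ((1 + mu) * 1))) with ((1 + mu) * (1 + mu) * (1 + mu)) by ring.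
      apply Rmult_le_compat_l; nra. }
    assert (S3 : Rabs (ln (Cmod k1)) * (r * r) <= Rabs (ln (Cmod k1)) * (1 + mu) ^ 3) by (apply Rmult_le_compat_l; easy).
    replace ((2 * c2 + Rabs (ln (Cmod k1))) * (1 + mu) ^ 3) with
      (c2 * (1 + mu) ^ 2 * (2 * (1 + mu)) + Rabs (ln (Cmod k1)) * (1 + mu) ^ 3) by ring.
    lra.
Qed.

(** * The classification *)

Lemma tends_inv u l : tends u l -> l <> 0%C -> tends (fun N => / u N)%C (/ l)%C.
Proof.
  intros H Hl eps He. assert (Hm := Hl). apply Cmod_gt_0 in Hm. set (m := Cmod l) in *.
  assert (P : 0 < eps * (m * m / 2)) by (apply Rmult_lt_0_compat; nra).
  destruct (H (Rmin (m / 2) (eps * (m * m / 2)))) as [N0 K]; [apply Rmin_pos; lra|].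
  exists N0. intros N HN. specialize (K N HN).
  assert (K1 := Rlt_le_trans _ _ _ K (Rmin_l _ _)). assert (K2 := Rlt_le_trans _ _ _ K (Rmin_r _ _)).
  assert (Hu : m / 2 <= Cmod (u N)).
  { pose proof (Cmod_ge_sub l (u N)) as Q. rewrite Cmod_minus_sym in Q. fold m in Q. lra. }
  assert (Hu0 : u N <> 0%C) by (apply Cmod_gt_0; lra).
  replace (/ u N - / l)%C with (- (u N - l) / (u N * l))%C by (field; auto).
  rewrite Cmod_div, Cmod_opp, Cmod_mult by (intros E; apply Cmult_integral in E; tauto).
  fold m. apply Rlt_div_l; [nra|]. eapply Rlt_le_trans; [exact K2|].
  apply Rmult_le_compat_l; nra.
Qed.

Lemma tends_filterlim (u : nat -> C) (l : C) : tends u l ->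
  filterlim u eventually (@locally C_UniformSpace l).
Proof.
  intros H. apply filterlim_locally. intros eps. destruct (H eps (cond_pos eps)) as [N0 K].
  exists N0. intros N HN. apply C_NormedModule_mixin_compat1. now apply K.
Qed.

Lemma zeros_lattice_swap f w1 w2 : zeros_lattice f w1 w2 -> zeros_lattice f w2 w1.
Proof.
  intros [Hs [Hi Hz]]. split; [easy|split].
  - intros a b E. destruct (Hi b a) as [A B]; [rewrite <- E; ring|easy].
  - intros z. rewrite Hz. split; intros [m [n ->]]; exists n, m; unfold lat_pt; ring.
Qed.

(** The sigma function is obtained as [f / F], with [F] the limit of the quotients: where [E N z] is
    nonzero, [f z / E N z] is the partial sigma product times [z], so its limit exists. *)
Lemma rank2_case f w1 w2 : zeros_lattice f w1 w2 ->
  exists (s : C -> C) (alpha beta : C), is_weierstrass_sigma w1 w2 s /\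
    forall z, f z = (s z * cexp (alpha * (z * z) + beta))%C.
Proof.
  intros HZ. destruct (sigma_quotients_exist f w1 w2 HZ) as [E HE].
  assert (HE' : sigma_quotients f w2 w1 E).
  { destruct HE as [HE Ef]. split; [easy|]. intros N z. rewrite sigma_partial_swap. apply Ef. }
  destruct (sigma_quotients_limit f w1 w2 E HZ HE) as [F [HF [F0 LF]]].
  assert (R1 := limit_second_difference f w1 w2 E F HZ HE HF F0 LF).
  assert (R2 := limit_second_difference f w2 w1 E F (zeros_lattice_swap f w1 w2 HZ) HE' HF F0 LF).
  destruct (lattice_quasi_periodic_growth F w1 w2 (proj1 (proj2 HZ)) HF F0 R1 R2) as [K [HK Gr]].
  destruct (even_zero_free_cubic_growth F K HF F0) as [al [be EF]]; auto.
  { intros z. apply tends_unique with (fun N => E N z); [|apply LF].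
    apply tends_eventually with (u := fun N => E N (- z)%C) (N1 := 0%nat); [|apply LF].
    intros N _. apply (sigma_quotients_even f w1 w2 E HZ HE). }
  exists (fun z => (f z * / F z)%C), al, be. split.
  - intros z. apply tends_filterlim.
    (* Being closer to [F z] than |F z| forces [E N z <> 0] for all large [N]. *)
    destruct (LF z (Cmod (F z))) as [N0 HN0]; [apply Cmod_gt_0, F0|].
    apply tends_eventually with (u := fun N => (f z * / E N z)%C) (N1 := N0).
    + intros N HN. specialize (HN0 N HN). rewrite (proj2 HE N z).
      assert (E N z <> 0%C).
      { intros E0. rewrite E0, Cmod_minus_sym in HN0. replace (F z - 0)%C with (F z) in HN0 by ring. lra. }
      field. easy.
    + apply tends_mult; [apply tends_const|]. now apply tends_inv.
  - intros z. rewrite <- EF. field. auto.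
Qed.

Theorem mainTheorem1 (f : C -> C) :
  entire f ->
  (forall z : C, f (Copp z) = Copp (f z)) ->
  (exists z : C, f z <> RtoC 0) ->
  (forall x y z w : C,
     Cminus
       (Cminus
          (Cmult (Cmult (Cmult (f x) (f y)) (f z)) (f w))
          (Cmult (Cmult (Cmult
             (f (Cdiv (Cminus (Cplus (Cplus x y) z) w) (RtoC 2)))
             (f (Cdiv (Cplus (Cminus (Cplus x y) z) w) (RtoC 2))))
             (f (Cdiv (Cplus (Cplus (Cminus x y) z) w) (RtoC 2))))
             (f (Cdiv (Cplus (Cplus (Cplus (Copp x) y) z) w) (RtoC 2)))))
       (Cmult (Cmult (Cmult
          (f (Cdiv (Cplus (Cplus (Cplus x y) z) w) (RtoC 2)))
          (f (Cdiv (Cminus (Cminus (Cplus x y) z) w) (RtoC 2))))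
          (f (Cdiv (Cminus (Cplus (Cminus x y) z) w) (RtoC 2))))
          (f (Cdiv (Cplus (Cminus (Cminus x y) z) w) (RtoC 2))))
     = RtoC 0) ->
  exists alpha beta : C,
    (forall z : C, f z = Cmult z (cexp (Cplus (Cmult alpha (Cmult z z)) beta)))
    \/ (exists a : C, a <> RtoC 0 /\
          forall z : C,
            f z = Cmult (csin (Cmult a z)) (cexp (Cplus (Cmult alpha (Cmult z z)) beta)))
    \/ (exists (w1 w2 : C) (s : C -> C),
          R_lin_indep w1 w2 /\ is_weierstrass_sigma w1 w2 s /\
          forall z : C,
            f z = Cmult (s z) (cexp (Cplus (Cmult alpha (Cmult z z)) beta))).
Proof.
  intros Hf Ho Hnz H4.
  assert (Hs : sigma_like f).
  { split; [now apply entire_holo|]. split; [easy|]. split; [easy|]. intros a b c.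
    specialize (H4 (a + b)%C (a - b)%C c c).
    replace ((a + b + (a - b) + c - c) / 2)%C with a in H4 by field.
    replace ((a + b + (a - b) - c + c) / 2)%C with a in H4 by field.
    replace ((a + b - (a - b) + c + c) / 2)%C with (b + c)%C in H4 by field.
    replace ((- (a + b) + (a - b) + c + c) / 2)%C with (c - b)%C in H4 by field.
    replace ((a + b + (a - b) + c + c) / 2)%C with (a + c)%C in H4 by field.
    replace ((a + b + (a - b) - c - c) / 2)%C with (a - c)%C in H4 by field.
    replace ((a + b - (a - b) + c - c) / 2)%C with b in H4 by field.
    replace ((a + b - (a - b) - c + c) / 2)%C with b in H4 by field.
    apply Cminus_eq0. rewrite <- H4. ring. }
  destruct (discrete_subgroup_classification (fun z => f z = 0%C)) as [R0|[[w [Hw R1]]|[w1 [w2 [Hi R2]]]]].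
  - split; [now apply odd_zero|]. split; [|split].
    + intros z w Hz Hw. now apply sigma_like_zeros_add.
    + intros z Hz. now apply sigma_like_zeros_opp.
    + now apply sigma_like_zeros_discrete.
  - destruct (rank0_case f Hs R0) as [al [be E]]. exists al, be. now left.
  - destruct (rank1_case f w Hs Hw R1) as [a [al [be [Ha E]]]]. exists al, be. right; left. now exists a.
  - destruct (rank2_case f w1 w2) as [s [al [be [Hsig E]]]]; [now split|].
    exists al, be. right; right. now exists w1, w2, s.
Qed.
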